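(* Let $m\geq 1$, let $f$ be a probability density function on $\mathbb{R}^m$, let $X$ be a random vector in $\mathbb{R}^m$ with density $f$, and let $X_1,X_2,\dots$ be independent random vectors in $\mathbb{R}^m$, each with density $f$. Suppose that $\mathbb{E}\|X\|^{\alpha}<\infty$ for some $\alpha>0$ and that there is $M>0$ with $f(x)\leq M$ for all $x\in\mathbb{R}^m$. Then for any fixed integer $k\geq 1$, $$\mathbb{E}\left[\widehat{H}_{N,k}-H(f)\right]^2\to 0\quad\text{as } N\to\infty,$$ where $\widehat{H}_{N,k}$ is the $k$th nearest neighbour estimator of the Shannon entropy $H(f)$ computed from the sample $\mathcal{X}_N=\{X_1,\dots,X_N\}$.
   Context: $\|\cdot\|$ is the Euclidean norm on $\mathbb{R}^m$ and $\log$ is the natural logarithm. The (differential) Shannon entropy of a density $f$ on $\mathbb{R}^m$ is $H(f)=-\int_{\mathbb{R}^m}f(x)\log f(x)\,dx$ (with the integrand equal to $0$ where $f(x)=0$). For a finite set $F\subset\mathbb{R}^m$ and a point $x$, $\rho_k(x,F)$ denotes the Euclidean distance between $x$ and its $k$th nearest neighbour in the set $F\setminus\{x\}$. For $N>k$ the $k$th nearest neighbour estimator of $H(f)$ is $$\widehat{H}_{N,k}=\frac1N\sum_{i=1}^N\log\left[\rho_k^m(X_i,\mathcal{X}_N)\,V_m\,(N-1)\,e^{-\psi(k)}\right],$$ where $\rho_k^m$ is the $m$th power of $\rho_k$, $\psi(x)=\Gamma'(x)/\Gamma(x)$ is the digamma function and $V_m=\pi^{m/2}/\Gamma(m/2+1)$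 is the volume of the unit ball in $\mathbb{R}^m$. *)

(* Defs.v *)
From HB Require Import structures.
From mathcomp Require Import all_boot all_order all_algebra finmap.
From mathcomp Require Import all_classical all_reals all_analysis.

Set Implicit Arguments.
Unset Strict Implicit.
Unset Printing Implicit Defensive.

Import Order.TTheory GRing.Theory Num.Theory.
Import numFieldNormedType.Exports.

Local Open Scope classical_set_scope.
Local Open Scope ring_scope.

(* The space R^m is [m.-tuple R], whose library sigma-algebra is the one
   generated by the coordinate projections, i.e. the Borel sigma-algebra. *)

Definition tuple_cons (T : Type) (m : nat) (p : T * m.-tuple T) : m.+1.-tuple T :=
  [tuple of p.1 :: p.2].

(* The m-fold product of the Lebesgue measure on R, transported from nested
   pairs to tuples. *)
Fixpoint lebesgue_tuple (R : realType) (m : nat) : set (m.-tuple R) -> \bar R :=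
  match m with
  | 0 => dirac [tuple]
  | m'.+1 =>
      pushforward (product_measure1 (@lebesgue_measure R) (@lebesgue_tuple R m'))
        (@tuple_cons R m')
  end.
Arguments lebesgue_tuple {R} m.

Lemma measurable_tuple_cons (R : realType) (m : nat) :
  measurable_fun [set: (R * m.-tuple R)%type] (@tuple_cons R m).
Proof.
exact: (@measurable_cons _ _ (R * m.-tuple R)%type R fst m snd).
Qed.

Lemma lebesgue_tuple_sigma_finite_measure (R : realType) (m : nat) :
  exists mu : {sigma_finite_measure set (m.-tuple R) -> \bar R},
    lebesgue_tuple m = mu :> (set _ -> _).
Proof.
elim: m => [|m [mu Emu]].
  by exists (dirac ([tuple] : 0.-tuple R)).
pose pm : {measure set (measurableTypeR R * m.-tuple R)%type -> \bar R} :=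
  lebesgue_integral_fubini_product_measure1__canonical__measure_function_Measure
    (@lebesgue_measure R) mu.
have mc := @measurable_tuple_cons R m.
pose nu : {measure set (m.+1.-tuple R) -> \bar R} :=
  measure_function_pushforward__canonical__measure_function_Measure pm mc.
have sf : sigma_finite setT nu.
  have /sigma_finiteP[F [TF ndF Foo]] := sigma_finiteT (@lebesgue_measure R).
  have /sigma_finiteP[G [TG ndG Goo]] := sigma_finiteT mu.
  pose u (t : m.+1.-tuple R) : R * m.-tuple R := (thead t, [tuple of behead t]).
  have cK : cancel (@tuple_cons R m) u.
    by case=> x t; rewrite /u /tuple_cons /= theadE; congr pair; exact: val_inj.
  have mu_ : measurable_fun setT u.
    apply: measurable_fun_pair; first exact: measurable_tnth.
    exact: measurable_behead.
  exists (fun n => u @^-1` (F n `*` G n)).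
    apply/esym; rewrite -subTset => t _.
    have [i _ Fi] : (\bigcup_n F n) (u t).1 by rewrite -TF.
    have [j _ Gj] : (\bigcup_n G n) (u t).2 by rewrite -TG.
    exists (maxn i j) => //; split.
    - by move: Fi; exact/subsetPset/ndF/leq_maxl.
    - by move: Gj; exact/subsetPset/ndG/leq_maxr.
  move=> n; have [mF Fn] := Foo n; have [mG Gn] := Goo n; split.
    by rewrite -[X in measurable X]setTI; apply: mu_ => //; exact: measurableX.
  rewrite /nu /= /pushforward -comp_preimage.
  rewrite (_ : u \o _ = id); last by apply/funext => x; exact: cK.
  by rewrite preimage_id /pm /= product_measure1E// lte_mul_pinfty// ge0_fin_numE.
pose S := @Measure_isSigmaFinite.Build _ _ _ nu sf.
pose nu' : {sigma_finite_measure set (m.+1.-tuple R) -> \bar R} :=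
  HB.pack (nu : set _ -> \bar R) nu S.
exists nu'.
by rewrite /= /nu' /nu /= Emu.
Qed.

Section lebesgue_tuple_measure.
Context (R : realType) (m : nat).

Let lebesgue_tuple0 : @lebesgue_tuple R m set0 = 0%E.
Proof.
by have [mu ->] := lebesgue_tuple_sigma_finite_measure R m; exact: measure0.
Qed.

Let lebesgue_tuple_ge0 (A : set (m.-tuple R)) : (0 <= lebesgue_tuple m A)%E.
Proof.
by have [mu ->] := lebesgue_tuple_sigma_finite_measure R m; exact: measure_ge0.
Qed.

Let lebesgue_tuple_sigma_additive :
  semi_sigma_additive (@lebesgue_tuple R m : set (m.-tuple R) -> \bar R).
Proof.
have [mu ->] := lebesgue_tuple_sigma_finite_measure R m.
exact: measure_semi_sigma_additive.
Qed.

HB.instance Definition _ := isMeasure.Build _ (m.-tuple R) R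
  (@lebesgue_tuple R m) lebesgue_tuple0 lebesgue_tuple_ge0
  lebesgue_tuple_sigma_additive.

Let lebesgue_tuple_sigma_finite :
  sigma_finite [set: m.-tuple R] (@lebesgue_tuple R m).
Proof.
have [mu ->] := lebesgue_tuple_sigma_finite_measure R m; exact: sigma_finiteT.
Qed.

HB.instance Definition _ := Measure_isSigmaFinite.Build _ (m.-tuple R) R
  (@lebesgue_tuple R m) lebesgue_tuple_sigma_finite.

End lebesgue_tuple_measure.

Lemma lebesgue_tuple_box (R : realType) (m : nat) (A : 'I_m -> set R) :
  (forall i, measurable (A i)) ->
  lebesgue_tuple m [set x : m.-tuple R | forall i, A i (tnth x i)] =
    (\prod_(i < m) lebesgue_measure (A i))%E.
Proof.
elim: m A => [|m IH] A mA.
  by rewrite big_ord0 /= diracE mem_set// => -[].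
rewrite big_ord_recl /= /pushforward.
rewrite -IH; last by move=> i; exact: mA.
pose B := [set x : m.-tuple R | forall i, A (lift ord0 i) (tnth x i)].
have mB : measurable B.
  rewrite (_ : B = \bigcap_(i in [set: 'I_m])
      ((fun x : m.-tuple R => tnth x i) @^-1` A (lift ord0 i))); last first.
    by apply/seteqP; split => x Bx i; [move=> _; exact: Bx|exact: (Bx i)].
  apply: fin_bigcap_measurable => [|i _]; first exact: finite_finset.
  by rewrite -[X in measurable X]setTI; exact: measurable_tnth.
have -> : @tuple_cons R m @^-1`
    [set x : m.+1.-tuple R | forall i, A i (tnth x i)] = A ord0 `*` B.
  apply/seteqP; split => -[x t].
    move=> At; split => [|i]; first exact: (At ord0).
    have := At (lift ord0 i); rewrite /= tnthS.
    by congr (A _ (tnth _ _)); exact: val_inj.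
  move=> [/= A0 Bt] i; have [j ->|->//] := unliftP ord0 i.
  have := Bt j; rewrite /= tnthS.
  by congr (A _ (tnth _ _)); exact: val_inj.
exact: (@product_measure1E _ _ _ _ R (@lebesgue_measure R)
  [the {sigma_finite_measure set _ -> \bar R} of @lebesgue_tuple R m] _ _ (mA ord0) mB).
Qed.

Definition enorm (R : realType) (m : nat) (x : m.-tuple R) : R :=
  Num.sqrt (\sum_(i < m) tnth x i ^+ 2).

Definition edist (R : realType) (m : nat) (x y : m.-tuple R) : R :=
  enorm [tuple tnth x i - tnth y i | i < m].

(* For k >= 1 and #|F \ {x}| >= k, the k-th smallest of the distances from x to
   the points of F \ {x} (ties counted with multiplicity); 0 when there are
   fewer than k such points. *)
Definition knn_dist (R : realType) (m k : nat) (x : m.-tuple R)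
    (F : {fset m.-tuple R}) : R :=
  nth 0 (sort <=%R [seq edist x y | y <- enum_fset (F `\ x)%fset]) k.-1.

Definition Gamma (R : realType) (x : R) : R :=
  \int[@lebesgue_measure R]_(t in `]0, +oo[) (t `^ (x - 1) * expR (- t)).

Definition digamma (R : realType) (x : R) : R :=
  derive1 (@Gamma R) x / Gamma x.

Definition unit_ball_vol (R : realType) (m : nat) : R :=
  pi `^ (m%:R / 2) / Gamma (m%:R / 2 + 1).

(* Extended-real valued, so that no finiteness is presupposed; the integrand
   vanishes where f does. *)
Definition entropy (R : realType) (m : nat) (f : m.-tuple R -> R) : \bar R :=
  (- \int[lebesgue_tuple m]_x (f x * ln (f x))%:E)%E.

Definition is_pdf (R : realType) (m : nat) (f : m.-tuple R -> R) : Prop :=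
  [/\ measurable_fun [set: m.-tuple R] f,
      forall x, 0 <= f x &
      (\int[lebesgue_tuple m]_x (f x)%:E = 1)%E].

Definition has_density (d : measure_display) (Omega : measurableType d)
    (R : realType) (P : probability Omega R) (m : nat)
    (X : {RV P >-> m.-tuple R}) (f : m.-tuple R -> R) : Prop :=
  forall A : set (m.-tuple R), measurable A ->
    distribution P X A = (\int[lebesgue_tuple m]_(x in A) (f x)%:E)%E.

Definition mutually_independent (d d' : measure_display)
    (Omega : measurableType d) (T : measurableType d') (R : realType)
    (P : probability Omega R) (I : choiceType) (X : I -> {RV P >-> T}) : Prop :=
  forall (J : {fset I}) (A : I -> set T),
    (forall i, i \in J -> measurable (A i)) ->
    P (\bigcap_(i in [set` J]) (X i @^-1` A i)) =
      (\prod_(i <- J) P (X i @^-1` A i))%E.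

Definition sample (R : realType) (T : Type) (m : nat) (X : nat -> T -> m.-tuple R)
    (N : nat) (w : T) : {fset m.-tuple R} :=
  [fset X (val i) w | i in 'I_N]%fset.

(* The sample points are X 0, ..., X N.-1. *)
Definition entropy_estimator (R : realType) (T : Type) (m k : nat)
    (X : nat -> T -> m.-tuple R) (N : nat) (w : T) : R :=
  N%:R^-1 * \sum_(i < N)
    ln (knn_dist k (X i w) (sample X N w) ^+ m * unit_ball_vol R m
        * (N%:R - 1) * expR (- digamma (k%:R : R))).

(* Main.v *)
(** Let c = exp (y + psi(k)) and let r be the radius of the balls of volume
    c / (N - 1).  The i-th summand Y_i of the estimator exceeds y exactly when
    fewer than k of the other sample points lie within r of X_i; given X_i = x,
    this has probability P(Bin(N - 1, p) < k) with p the probability of the ball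
    B(x, r), and by the L^1 form of Lebesgue differentiation its mean tends to
    Phi(y) = E[Q_k(c f(X))], where Q_k(t) = P(Poisson(t) < k).  For two points at
    distance more than 2r the balls are disjoint and the counts are negatively
    dependent, so the fraction of indices with Y_i > y converges to Phi(y) in
    L^2.  Phi is the tail of ln G - psi(k) - ln f(X), where G is an independent
    Gamma(k) variable; since E[ln G] = psi(k), the mean of this variable is H(f).
    Finally Y_i and the limit variable have exponential tails, uniformly in N:
    the lower one because f is bounded, the upper one because a cell of a grid of
    side r / m contains at most k points with Y_i > y while few points are far
    from the origin.  Hence all the variables can be replaced, up to a uniformly
    small L^2 error, by a staircase function of them, which is a finite linear
    combination of indicators of the events Y_i > y. *)
From HB Require Import structures.
Require Import Defs.
From mathcomp Require Import all_boot all_order all_algebra finmap.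
From mathcomp Require Import all_classical all_reals all_analysis.
From mathcomp Require Import measurable_realfun.
From mathcomp Require Import ring lra zify.

Import Order.TTheory GRing.Theory Num.Theory.
Import numFieldNormedType.Exports.
Import Defs.

Set Implicit Arguments.
Unset Strict Implicit.
Unset Printing Implicit Defensive.

Local Open Scope classical_set_scope.
Local Open Scope ring_scope.

(** * Tuples and Euclidean distance *)

Section tuple_rectangles.
Context d (T : measurableType d) (n : nat).

(** Only the events Y_i > y have accessible probabilities: once one or two sample points are frozen
    they are binomial events. The staircase does the work of weak convergence and uniform
    integrability at once: its error depends on the tail constants alone, so n is fixed before N and
    finitely many levels y remain.

    The main obstacle is the upper tail of Y_i, where a moment of order alpha must yield an
    exponential rate uniform in N. Write L = y + psi(k). The grid bound contains terms of order 1/N,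
    too large when N is small compared with e^(sL); in that range a union bound over the points far
    from the origin takes over. The rate s comes from balancing these two regimes.

    Differentiation is used on average only: N times the error of a ball probability is integrated
    against the law of X, which costs a factor M, and N r^m is bounded, so an integrated oscillation
    of order o(r^m) is enough.

    The tails of the limit variable are inherited from those of Y_i as N grows, and with them the
    finiteness of H(f). Samples with ties form a null event, on which the summands are replaced by
    0. *)

Definition tuple_rect (A : 'I_n -> set T) : set (n.-tuple T) :=
  [set x | forall i, A i (tnth x i)].

Lemma measurable_tuple_rect (A : 'I_n -> set T) :
  (forall i, measurable (A i)) -> measurable (tuple_rect A).
Proof.
move=> mA; rewrite (_ : tuple_rect A = \bigcap_(i in [set: 'I_n])
    ((fun x : n.-tuple T => tnth x i) @^-1` A i)); last first.
  by apply/seteqP; split => x Bx i; [move=> _; exact: Bx|exact: (Bx i)].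
apply: fin_bigcap_measurable => [|i _]; first exact: finite_finset.
by rewrite -[X in measurable X]setTI; exact: measurable_tnth.
Qed.

(** The library sigma-algebra on tuples is generated by preimages under the coordinates, so it is
    enough to find these in the one generated by [G]. It serves for boxes with measurable sides and,
    later, for open boxes. *)
Lemma tuple_measurable_generated (G : set (set (n.-tuple T))) :
  G `<=` measurable ->
  (forall i A, measurable A -> <<s G >> [set x : n.-tuple T | A (tnth x i)]) ->
  measurable = <<s G >>.
Proof.
move=> mG sG; apply/seteqP; split; last first.
  by apply: smallest_sub => //; exact: sigma_algebra_measurable.
apply: smallest_sub; first exact: smallest_sigma_algebra.
move=> A; case: n G mG sG A => [|n'] G mG sG A; first by rewrite big_ord0.
rewrite -bigcup_mkord_ord => -[i _ [B mB <-]]; rewrite setTI; exact: sG.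
Qed.

Lemma measurable_tuple_rectE :
  @measurable _ (n.-tuple T) =
    <<s [set tuple_rect A | A in [set A | forall i, measurable (A i)]] >>.
Proof.
apply: tuple_measurable_generated.
  by move=> _ [A mA <-]; exact: measurable_tuple_rect.
move=> i A mA; apply: sub_sigma_algebra.
exists (fun j => if j == i then A else setT) => /=.
  by move=> j; case: ifP.
apply/seteqP; split => x /= h; first by have := h i; rewrite eqxx.
by move=> j; case: eqP => // ->.
Qed.

Lemma tuple_rect_setI (A B : 'I_n -> set T) :
  tuple_rect A `&` tuple_rect B = tuple_rect (fun i => A i `&` B i).
Proof. by apply/seteqP; split=> x /= => [[a b] i|h]; split => // i; case: (h i). Qed.

End tuple_rectangles.

Section tuple_measure_unique.
Context (R : realType) d (T : measurableType d) (n : nat).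
Variables m1 m2 : {measure set (n.-tuple T) -> \bar R}.
Variable g : (set T)^nat.
Hypothesis mg : forall k, measurable (g k).
Hypothesis ndg : nondecreasing_seq g.
Hypothesis g_cover : \bigcup_k g k = setT.
Hypothesis m1g : forall k, (m1 (tuple_rect (fun=> g k)) < +oo)%E.
Hypothesis m12 : forall A : 'I_n -> set T, (forall i, measurable (A i)) ->
  m1 (tuple_rect A) = m2 (tuple_rect A).

(** Boxes generate and are stable under intersection, and the cubes over [g] exhaust the space with
    finite measure. For probabilities [g] is constantly the whole space; for Lebesgue measure it is
    a growing sequence of intervals. *)
Lemma tuple_measure_unique A : measurable A -> m1 A = m2 A.
Proof.
apply: (measure_unique _ (fun k => tuple_rect (fun=> g k)) (measurable_tuple_rectE T n)).
- move=> _ _ [A1 mA1 <-] [A2 mA2 <-]; rewrite tuple_rect_setI.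
  by eexists; last reflexivity; move=> i; exact: measurableI.
- by move=> k; exists (fun=> g k).
- apply/seteqP; split=> // x _.
  have h i : exists k, g k (tnth x i).
    by have : setT (tnth x i) by []; rewrite -g_cover => -[k]; exists k.
  have [h' hh] := choice h.
  exists (\max_(i < n) h' i) => // i.
  by have /subsetPset := ndg (leq_bigmax i : (h' i <= \max_(i < n) h' i)%N); apply.
- by move=> _ [A' mA' <-]; exact: m12.
- exact: m1g.
Qed.

End tuple_measure_unique.

Section euclid.
Context (R : realType) (m : nat).
Implicit Types x y z : m.-tuple R.

Lemma edist_ge0 x y : 0 <= edist x y. Proof. exact: sqrtr_ge0. Qed.

Lemma edist_sqr x y : edist x y ^+ 2 = \sum_(i < m) (tnth x i - tnth y i) ^+ 2.
Proof.
rewrite sqr_sqrtr; last by apply: sumr_ge0 => i _; exact: sqr_ge0.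
by apply: eq_bigr => i _; rewrite tnth_mktuple.
Qed.

Lemma enorm_sqr x : enorm x ^+ 2 = \sum_(i < m) tnth x i ^+ 2.
Proof. by rewrite sqr_sqrtr//; apply: sumr_ge0 => i _; exact: sqr_ge0. Qed.

Lemma edist_le x y r : 0 <= r ->
  (edist x y <= r) = (\sum_(i < m) (tnth x i - tnth y i) ^+ 2 <= r ^+ 2).
Proof. by move=> r0; rewrite -edist_sqr ler_sqr ?nnegrE// edist_ge0. Qed.

Lemma enorm_le x r : 0 <= r ->
  (enorm x <= r) = (\sum_(i < m) tnth x i ^+ 2 <= r ^+ 2).
Proof. by move=> r0; rewrite -enorm_sqr ler_sqr ?nnegrE// sqrtr_ge0. Qed.

Lemma edistC x y : edist x y = edist y x.
Proof.
apply/eqP; rewrite -(eqrXn2 (n := 2)) ?edist_ge0// !edist_sqr; apply/eqP.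
by apply: eq_bigr => i _; rewrite -sqrrN opprB.
Qed.

Lemma edist_eq0 x y : (edist x y == 0) = (x == y).
Proof.
apply/eqP/eqP => [xy|->]; last first.
  by apply/eqP; rewrite -sqrf_eq0 edist_sqr big1// => i _; rewrite subrr expr0n.
have := edist_sqr x y; rewrite xy expr0n /= => /esym/eqP.
rewrite psumr_eq0; last by move=> i _; exact: sqr_ge0.
move=> /allP h; apply: eq_from_tnth => i; apply/eqP.
by have := h i (mem_index_enum _); rewrite sqrf_eq0 subr_eq0.
Qed.

Lemma edist_coord x y i : `|tnth x i - tnth y i| <= edist x y.
Proof.
rewrite -ler_sqr ?nnegrE ?edist_ge0// edist_sqr real_normK ?num_real//.
by rewrite (bigD1 i)//= lerDl sumr_ge0// => j _; exact: sqr_ge0.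
Qed.

Lemma enorm_coord x i : `|tnth x i| <= enorm x.
Proof.
rewrite -ler_sqr ?nnegrE ?sqrtr_ge0// enorm_sqr real_normK ?num_real//.
by rewrite (bigD1 i)//= lerDl sumr_ge0// => j _; exact: sqr_ge0.
Qed.

(** In each coordinate (a - b)^2 <= 2 (a - c)^2 + 2 (b - c)^2, so the squared distance is at most 4
    r^2. Read backwards, balls of radius r about points more than 2r apart are disjoint. *)
Lemma edist_near x y z r : edist x z <= r -> edist y z <= r ->
  edist x y <= 2 * r.
Proof.
move=> xz yz; have r0 : 0 <= r by exact: le_trans (edist_ge0 _ _) xz.
rewrite edist_le ?mulr_ge0//; move: xz yz; rewrite !edist_le// => xz yz.
rewrite exprMn (le_trans (y := \sum_(i < m) (2 * (tnth x i - tnth z i) ^+ 2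
  + 2 * (tnth y i - tnth z i) ^+ 2)))//.
  apply: ler_sum => i _; rewrite -subr_ge0.
  rewrite [leRHS](_ : _ = (tnth x i + tnth y i - 2 * tnth z i) ^+ 2) ?sqr_ge0//.
  ring.
by rewrite big_split/= -!mulr_sumr; nra.
Qed.

Lemma edist_le_enorm x y r : enorm x <= r -> enorm y <= r -> edist x y <= 2 * r.
Proof.
move=> xr yr; have r0 : 0 <= r by exact: le_trans (sqrtr_ge0 _) xr.
rewrite edist_le ?mulr_ge0//; move: xr yr; rewrite !enorm_le// => xr yr.
rewrite exprMn (le_trans (y := \sum_(i < m) (2 * tnth x i ^+ 2 +
  2 * tnth y i ^+ 2)))//.
  apply: ler_sum => i _; rewrite -subr_ge0.
  rewrite [leRHS](_ : _ = (tnth x i + tnth y i) ^+ 2) ?sqr_ge0//.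
  ring.
by rewrite big_split/= -!mulr_sumr; nra.
Qed.

(** A sum of m squares of size at most h^2 is at most (m h)^2, since m <= m^2. This crude factor is
    the reason for grids of side r / m. *)
Lemma edist_le_coord x y (h : R) : (1 <= m)%N -> 0 <= h ->
  (forall i, `|tnth x i - tnth y i| <= h) -> edist x y <= m%:R * h.
Proof.
move=> m1 h0 xy; rewrite edist_le ?mulr_ge0//.
apply: (le_trans (y := \sum_(i < m) h ^+ 2)).
  apply: ler_sum => i _; rewrite -[X in X <= _]real_normK ?num_real//.
  by rewrite ler_sqr ?nnegrE.
rewrite sumr_const card_ord exprMn -[leLHS]mulr_natl.
apply: ler_wpM2r; first exact: sqr_ge0.
by rewrite expr2 ler_peMl// ler1n.
Qed.

Lemma measurable_edist_comp d (U : measurableType d) (f g : U -> m.-tuple R) :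
  measurable_fun setT f -> measurable_fun setT g ->
  measurable_fun setT (fun u => edist (f u) (g u)).
Proof.
move=> mf mg; rewrite (_ : (fun u => _) = (fun u =>
    Num.sqrt (\sum_(i < m) (tnth (f u) i - tnth (g u) i) ^+ 2))); last first.
  apply/funext => u; rewrite /edist /enorm; congr Num.sqrt.
  by apply: eq_bigr => i _; rewrite tnth_mktuple.
apply: (@measurableT_comp _ _ _ _ _ _ (@Num.sqrt R)).
  by apply: continuous_measurable_fun; exact: sqrt_continuous.
apply: measurable_sum => i; apply: measurable_funX.
by apply: measurable_funB; apply: (@measurableT_comp _ _ _ _ _ _ (fun x : m.-tuple R => tnth x i)) => //;
  exact: measurable_tnth.
Qed.

Lemma measurable_enorm : measurable_fun [set: m.-tuple R] (@enorm R m).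
Proof.
apply: (@measurableT_comp _ _ _ _ _ _ (@Num.sqrt R)).
  by apply: continuous_measurable_fun; exact: sqrt_continuous.
apply: measurable_sum => i; apply: measurable_funX; exact: measurable_tnth.
Qed.

End euclid.

(** * Measurability of counting events *)

Section counting.
Context d (U : measurableType d).

Lemma measurable_fun_set_le (R : realType) (f : U -> R) r :
  measurable_fun setT f -> measurable [set u | f u <= r].
Proof.
move=> mf; rewrite -[X in measurable X]setTI.
rewrite (_ : [set u | _] = f @^-1` `]-oo, r]); first exact: mf.
by apply/seteqP; split => u /=; rewrite in_itv.
Qed.

Lemma measurable_count (I : Type) (a : I -> U -> bool) (s : seq I) n :
  (forall i, measurable [set u | a i u]) ->
  measurable [set u | (count (a^~ u) s < n)%N].
Proof.
move=> ma; elim: s n => [|i s IH] n /=; first by case: n => [|n]; rewrite ?set_false ?set_true.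
case: n => [|n]; first by rewrite (_ : mkset _ = set0)//; apply/seteqP; split.
rewrite (_ : mkset _ =
  ([set u | a i u] `&` [set u | (count (a^~ u) s < n)%N]) `|`
  (~` [set u | a i u] `&` [set u | (count (a^~ u) s < n.+1)%N])).
  by apply: measurableU; apply: measurableI => //; apply: measurableC.
apply/seteqP; split => u /=; case: (a i u); rewrite ?add1n ?add0n ?ltnS.
- by left.
- by right.
- by case=> -[].
- by case=> -[].
Qed.

End counting.

(** * Independent samples *)

Section independent_sample.
Context (R : realType) d (Omega : measurableType d) (P : probability Omega R).
Context d' (T : measurableType d').
Variables (X : nat -> {RV P >-> T}) (mu : probability T R).
Hypothesis hlaw : forall i A, measurable A -> P (X i @^-1` A) = mu A.
Hypothesis hind : mutually_independent X.

Lemma independent_seq (s : seq nat) (B : nat -> set T) : uniq s ->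
  (forall i, i \in s -> measurable (B i)) ->
  P (\bigcap_(i in [set` s]) (X i @^-1` B i)) = (\prod_(i <- s) mu (B i))%E.
Proof.
move=> us mB; pose J := [fset i in s]%fset.
have JE : [set` J] = [set` s] by apply/seteqP; split=> i /=; rewrite !inE.
rewrite -JE hind; last by move=> i; rewrite !inE; exact: mB.
have pJ : perm_eq J s by apply: uniq_perm => // i; rewrite !inE.
rewrite (perm_big _ pJ)/= big_seq [RHS]big_seq.
by apply: eq_bigr => i si; rewrite hlaw//; exact: mB.
Qed.

Definition subsample (s : seq nat) (w : Omega) : (size s).-tuple T :=
  map_tuple (fun i => X i w) (in_tuple s).

Lemma measurable_subsample s : measurable_fun setT (subsample s).
Proof.
apply/measurable_fun_tnthP => i.
rewrite (_ : _ \o _ = X (tnth (in_tuple s) i)); first exact: measurable_funPT.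
by apply/funext => w /=; rewrite tnth_map.
Qed.

HB.instance Definition _ s :=
  isMeasurableFun.Build _ _ _ _ (subsample s) (@measurable_subsample s).

Definition with_subsample l s (w : Omega) : T * (size s).-tuple T :=
  (X l w, subsample s w).

Lemma measurable_with_subsample l s : measurable_fun setT (with_subsample l s).
Proof. by apply: measurable_fun_pair => //; exact: measurable_subsample. Qed.

HB.instance Definition _ l s :=
  isMeasurableFun.Build _ _ _ _ (with_subsample l s) (@measurable_with_subsample l s).

(** Both sides are finite measures in [B]; mutual independence makes them agree on boxes, hence on
    all measurable sets of tuples. *)
Lemma subsample_rect l s A B : uniq (l :: s) -> measurable A -> measurable B ->
  P (X l @^-1` A `&` subsample s @^-1` B) = (mu A * P (subsample s @^-1` B))%E.
Proof.
move=> uls mA mB; have mXA : measurable (X l @^-1` A) by exact: measurable_funPTI.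
have fA : mu A \is a fin_num by exact: fin_num_measure.
have mS := @measurable_subsample s.
pose m1 : {measure set ((size s).-tuple T) -> \bar R} :=
  measure_function_pushforward__canonical__measure_function_Measure
    (mrestr P mXA) mS.
pose m2 : {measure set ((size s).-tuple T) -> \bar R} :=
  mscale (NngNum (fine_ge0 (measure_ge0 mu A)))
    (measure_function_pushforward__canonical__measure_function_Measure P mS).
suff : m1 B = m2 B.
  by rewrite /m1 /m2 /= /mscale /pushforward /= /mrestr fineK// setIC.
apply: (@tuple_measure_unique _ _ _ _ m1 m2 (fun=> setT)) => //.
- by rewrite bigcup_const.
- move=> k; rewrite /m1 /= /pushforward /mrestr /= (le_lt_trans (probability_le1 _ _)) ?ltry//.
  apply: measurableI => //; apply: measurable_funPTI.
  exact: measurable_tuple_rect.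
move=> C mC; rewrite /m1 /m2 /= /mscale /pushforward /= /mrestr fineK//.
rewrite -[X in (_ * X)%E]/(P (subsample s @^-1` tuple_rect C)).
(* The box is indexed by positions in [s], independence by sample indices. [D] translates between
   them, unambiguously because [s] has no repetition. *)
pose D i := if insub (index i s) is Some j then C j else setT.
have mD i : measurable (D i) by rewrite /D; case: insubP.
have DE (j : 'I_(size s)) : D (tnth (in_tuple s) j) = C j.
  rewrite /D (tnth_nth 0%N)/= index_uniq//; last by case/andP: uls.
  by rewrite valK.
have sE : subsample s @^-1` tuple_rect C = \bigcap_(i in [set` s]) (X i @^-1` D i).
  apply/seteqP; split => w /= h.
    move=> i /= /(tnthP (in_tuple s))[j ->]; rewrite /preimage/= DE.
    by have := h j; rewrite tnth_map.
  move=> j; rewrite tnth_map -DE; apply: h => /=.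
  exact: (mem_tnth j (in_tuple s)).
rewrite sE independent_seq//; last by case/andP: uls.
pose D' i := if i == l then A else D i.
have D'E i : i \in s -> D' i = D i.
  by move=> si; rewrite /D'; case: eqP => // il; move: uls; rewrite /= -il si.
rewrite (_ : _ `&` _ = \bigcap_(i in [set` l :: s]) (X i @^-1` D' i)).
  rewrite independent_seq//; last by move=> i _; rewrite /D'; case: ifP.
  rewrite big_cons {1}/D' eqxx; congr (_ * _)%E.
  by rewrite big_seq [RHS]big_seq; apply: eq_bigr => i /D'E ->.
apply/seteqP; split => w.
  move=> [h hA] i /=; rewrite inE => /orP[/eqP ->|si].
    by rewrite /D' eqxx.
  by rewrite D'E//; apply: h.
move=> h; split.
  by move=> i /= si; rewrite -D'E//; apply: h; rewrite /= inE si orbT.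
by have := h l; rewrite /= inE eqxx /D' eqxx /=; apply.
Qed.

(** By [subsample_rect] the joint law is a product measure, so conditioning on [X l = x] amounts to
    freezing x. *)
Lemma subsample_fubini l s (E : set (T * (size s).-tuple T)) : uniq (l :: s) ->
  measurable E ->
  P [set w | E (X l w, subsample s w)] =
    (\int[mu]_x P [set w | E (x, subsample s w)])%E.
Proof.
move=> uls mE.
have this := @product_measure_unique _ _ _ _ R mu (distribution P (subsample s))
  (distribution P (with_subsample l s)).
transitivity (distribution P (with_subsample l s) E); first by [].
move: this => /(_ _ E mE) <-; last first.
  move=> A B mA mB; rewrite /distribution /= /pushforward /=.
  exact: subsample_rect.
rewrite /product_measure1; apply: eq_integral => x _.
rewrite /distribution /= /pushforward; congr (P _).
by apply/seteqP; split => w /=; rewrite /xsection /= inE.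
Qed.

Lemma subsample_fubini2 i j s (E : set (T * (T * (size s).-tuple T))) :
  uniq [:: i, j & s] -> measurable E ->
  P [set w | E (X i w, (X j w, subsample s w))] =
    (\int[mu]_x \int[mu]_y P [set w | E (x, (y, subsample s w))])%E.
Proof.
move=> uijs mE.
(* [g] regroups the sample as one point and a tuple headed by [X j], so that the one-point version
   applies twice. *)
pose g (z : T * (size s).+1.-tuple T) := (z.1, (thead z.2, [tuple of behead z.2])).
have mg : measurable_fun setT g.
  apply: measurable_fun_pair => //; apply: measurable_fun_pair.
    apply: (measurableT_comp (f := @thead _ _)) => //; exact: measurable_tnth.
  apply: (@measurableT_comp _ _ _ _ _ _
    (fun t : (size s).+1.-tuple T => [tuple of behead t])) => //.
  exact: measurable_behead.
have gE x w : g (x, subsample (j :: s) w) = (x, (X j w, subsample s w)).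
  rewrite /g /=; congr (_, (_, _)).
  by apply: val_inj.
have := @subsample_fubini i (j :: s) (g @^-1` E) uijs.
rewrite -[X in measurable X]setTI => /(_ (mg measurableT _ mE)).
rewrite /preimage /=; under eq_set do rewrite gE.
move=> ->; apply: eq_integral => x _; under eq_set do rewrite gE.
apply: (@subsample_fubini j s [set z | E (x, z)]); first by case/andP: uijs.
rewrite (_ : mkset _ = xsection E x); first exact: measurable_xsection.
by apply/seteqP; split=> z /=; rewrite /xsection /= inE.
Qed.

End independent_sample.

(* [binlt n a p] is the probability that a binomial (n, p) variable is < a *)
Fixpoint binlt (R : realType) (n a : nat) (p : R) : R :=
  match n, a with
  | _, 0 => 0
  | 0, _.+1 => 1
  | n'.+1, a'.+1 => p * binlt n' a' p + (1 - p) * binlt n' a'.+1 p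
  end.

(** * Binomial tails *)

Section binlt_theory.
Context (R : realType).
Implicit Types p : R.

Lemma binlt0 n p : binlt n 0 p = 0. Proof. by case: n. Qed.

Lemma binltSS n a p :
  binlt n.+1 a.+1 p = p * binlt n a p + (1 - p) * binlt n a.+1 p.
Proof. by []. Qed.

Lemma binlt_itv n a p : 0 <= p <= 1 -> 0 <= binlt n a p <= 1.
Proof.
move=> p01; elim: n a => [|n IH] [|a]; rewrite ?binlt0 ?binltSS ?lexx ?ler01//=.
by have := IH a; have := IH a.+1; nra.
Qed.

Lemma binlt_leS n a p : 0 <= p <= 1 -> binlt n a p <= binlt n a.+1 p.
Proof.
move=> p01; elim: n a => [|n IH] a; first by case: a => [|a] /=; rewrite ?ler01 ?lexx.
case: a => [|a]; last by rewrite !binltSS; have := IH a; have := IH a.+1; nra.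
by rewrite binlt0; case/andP: (binlt_itv n.+1 1 p01).
Qed.

Lemma binlt_leSn n a p : 0 <= p <= 1 -> binlt n.+1 a p <= binlt n a p.
Proof.
move=> p01; case: a => [|a]; first by rewrite !binlt0.
by rewrite binltSS; have := binlt_leS n a p01; nra.
Qed.

(** An extra trial changes the outcome only if it succeeds. *)
Lemma binlt_geSn n a p : 0 <= p <= 1 -> binlt n a p <= binlt n.+1 a p + p.
Proof.
move=> p01; case: a => [|a]; first by rewrite !binlt0 add0r; case/andP: p01.
rewrite binltSS; have := binlt_itv n a p01; have := binlt_itv n a.+1 p01; nra.
Qed.

(** Union bound: the count can reach [a.+1] only if some trial succeeds. *)
Lemma binlt_ge n a p : 0 <= p <= 1 -> 1 - n%:R * p <= binlt n a.+1 p.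
Proof.
move=> p01; elim: n => [|n IH]; first by rewrite mul0r subr0.
rewrite binltSS -natr1; have := binlt_itv n a p01; move: IH.
have := ler0n R n; set x := n%:R; nra.
Qed.

Lemma measurable_binlt d (U : measurableType d) n a (p : U -> R) :
  measurable_fun setT p -> measurable_fun setT (fun u => binlt n a (p u)).
Proof.
move=> mp; elim: n a => [|n IH] [|a] /=; try exact: measurable_cst.
apply: measurable_funD; apply: measurable_funM => //.
by apply: measurable_funB => //; exact: measurable_cst.
Qed.

End binlt_theory.

Lemma measurable_count_tuple d (U : measurableType d) d' (T : measurableType d')
    n (A : U -> T -> bool) (t : U -> n.-tuple T) a :
  measurable_fun setT t -> measurable [set z : U * T | A z.1 z.2] ->
  measurable [set u | (count (A u) (t u) < a)%N].
Proof.
move=> mt mA; rewrite (_ : mkset _ =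
    [set u | (count (fun i => A u (tnth (t u) i)) (enum 'I_n) < a)%N]).
  apply: (@measurable_count _ _ _ (fun i u => A u (tnth (t u) i))) => i.
  have mg : measurable_fun setT (fun u => (u, tnth (t u) i)).
    apply: measurable_fun_pair => //.
    apply: (@measurableT_comp _ _ _ _ _ _ (fun x : n.-tuple T => tnth x i)) => //.
    exact: measurable_tnth.
  by rewrite -[X in measurable X]setTI; exact: (mg measurableT _ mA).
by apply/seteqP; split => u /=; rewrite -(count_map (tnth (t u))) map_tnth_enum.
Qed.

Section scaled_indicator.
Context d (T : measurableType d) (R : realType).

Lemma measurable_cindic (c : R) (A : set T) : measurable A ->
  measurable_fun setT (fun x => c * \1_A x).
Proof. by move=> mA; apply: measurable_funM => //; exact: measurable_indic. Qed.

Lemma integral_cindic (mu : {measure set T -> \bar R}) (c : R) (A : set T) :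
  0 <= c -> measurable A -> (\int[mu]_x (c * \1_A x)%:E = c%:E * mu A)%E.
Proof.
move=> c0 mA; under eq_integral do rewrite EFinM.
rewrite ge0_integralZl_EFin//; last exact/measurable_EFinP/measurable_indic.
by rewrite integral_indic// setIT.
Qed.

End scaled_indicator.

(** * Counts of sample points in one set and in two disjoint sets *)

Section counting_law.
Context (R : realType) d (Omega : measurableType d) (P : probability Omega R).
Context d' (T : measurableType d').
Variables (X : nat -> {RV P >-> T}) (mu : probability T R).
Hypothesis hlaw : forall i A, measurable A -> P (X i @^-1` A) = mu A.
Hypothesis hind : mutually_independent X.
Implicit Types A B : pred T.

Definition hits (A : pred T) (s : seq nat) (w : Omega) : nat :=
  count (fun l => A (X l w)) s.

Lemma hits_subsample A s w : hits A s w = count A (subsample X s w).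
Proof. by rewrite /hits /= count_map. Qed.

Lemma measurable_prob_section s (E : set (T * (size s).-tuple T)) :
  measurable E -> measurable_fun setT (fun x => P [set w | E (x, subsample X s w)]).
Proof.
move=> mE; have := measurable_fun_xsection (distribution P (subsample X s)) mE.
congr (measurable_fun _ _); apply/funext => x /=.
rewrite /distribution /pushforward; congr (P _).
by apply/seteqP; split => w /=; rewrite /xsection /= inE.
Qed.

Let pr (A : pred T) : R := fine (mu [set x | A x]).

Let prE A : measurable [set x | A x] -> mu [set x | A x] = (pr A)%:E.
Proof. by move=> mA; rewrite /pr fineK// fin_num_measure. Qed.

Let pr01 A : measurable [set x | A x] -> 0 <= pr A <= 1.
Proof. by move=> mA; rewrite -!lee_fin -prE// measure_ge0 probability_le1. Qed.

Let prC (A : set T) : measurable A -> mu (~` A) = (1 - fine (mu A))%:E.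
Proof.
move=> mA; rewrite EFinB fineK ?fin_num_measure//.
by have := probability_setC mu mA; apply.
Qed.

Lemma hits_cons A l s w a : (hits A (l :: s) w < a)%N =
  (A (X l w) + count A (subsample X s w) < a)%N.
Proof. by rewrite -hits_subsample. Qed.

Lemma measurable_hits_section n A a : measurable [set x | A x] ->
  measurable [set z : T * n.-tuple T | (A z.1 + count A z.2 < a)%N].
Proof.
move=> mA; rewrite (_ : mkset _ = [set z : T * n.-tuple T |
  (count A [tuple of z.1 :: z.2] < a)%N])//.
apply: (@measurable_count_tuple _ _ _ _ _ (fun=> A)).
  exact: (@measurable_cons _ _ (T * n.-tuple T)%type T fst n snd).
by rewrite -[X in measurable X]setTI; exact: (@measurable_snd _ _ _ T measurableT _ mA).
Qed.

Let le_section_prob s (E : set (T * (size s).-tuple T)) (F : Omega -> bool) x :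
  measurable E -> measurable [set w | F w] ->
  (forall w, E (x, subsample X s w) -> F w) ->
  (P [set w | E (x, subsample X s w)] <= P [set w | F w])%E.
Proof.
move=> mE mF EF; apply: le_measure; rewrite ?inE//.
rewrite (_ : mkset _ = subsample X s @^-1` xsection E x).
  by apply: measurable_funPTI; exact: measurable_xsection.
by apply/seteqP; split=> w; rewrite /preimage/xsection/= inE.
Qed.

Lemma measurable_hits A s a : measurable [set x | A x] ->
  measurable [set w | (hits A s w < a)%N].
Proof.
move=> mA; apply: (@measurable_count _ _ _ (fun l w => A (X l w))) => l.
by rewrite -[X in measurable X]setTI; exact: (@measurable_funPT _ _ _ _ (X l) measurableT _ mA).
Qed.

Let measurable_hits2 A B s a b : measurable [set x | A x] ->
  measurable [set x | B x] ->
  measurable [set w | (hits A s w < a)%N && (hits B s w < b)%N].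
Proof.
move=> mA mB; rewrite (_ : mkset _ = [set w | (hits A s w < a)%N] `&`
  [set w | (hits B s w < b)%N]).
  by apply: measurableI; exact: measurable_hits.
by apply/seteqP; split => w /=; [move/andP|case=> -> ->].
Qed.

(** Conditioning on whether the head of [s] falls in [A] reproduces the recursion that defines
    [binlt]. *)
Lemma prob_hits A s a : uniq s -> measurable [set x | A x] ->
  P [set w | (hits A s w < a)%N] = (binlt (size s) a (pr A))%:E.
Proof.
move=> + mA; elim: s a => [|l s IH] [|a] us.
- by under eq_set do rewrite ltn0; rewrite set_false measure0.
- by under eq_set do rewrite /=; rewrite set_true probability_setT.
- by under eq_set do rewrite ltn0; rewrite set_false measure0.
have := subsample_fubini hlaw hind us (@measurable_hits_section (size s) A a.+1 mA).
rewrite /=; under eq_set do rewrite -hits_cons.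
move=> ->; have us' : uniq s by case/andP: us.
rewrite -(setUv [set x | A x]) ge0_integral_setU//=; [|exact: measurableC| |]; last 2 first.
- rewrite setUv.
  exact: (@measurable_prob_section s _ (@measurable_hits_section (size s) A a.+1 mA)).
- by apply/disj_setPS => x [].
rewrite (eq_integral (cst (binlt (size s) a (pr A))%:E)); last first.
  move=> x; rewrite inE /= => Ax; rewrite -IH//; congr (P _).
  by apply/seteqP; split => w /=; rewrite Ax add1n ltnS hits_subsample.
rewrite [X in (_ + X)%E](eq_integral (cst (binlt (size s) a.+1 (pr A))%:E)); last first.
  move=> x; rewrite inE /= => /negP/negbTE Ax; rewrite -IH//; congr (P _).
  by apply/seteqP; split => w /=; rewrite Ax add0n hits_subsample.
rewrite !integral_cst//; last exact: measurableC.
rewrite [X in (_ * X + _)%E](_ : _ = (pr A)%:E); last exact: prE.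
rewrite [X in (_ + _ * X)%E](_ : _ = (1 - pr A)%:E); last exact: prC.
rewrite -!EFinM -EFinD; congr (_%:E).
by rewrite mulrC [X in _ + X]mulrC.
Qed.

(* Negative orthant dependence of multinomial counts. *)
Lemma prob_hits2 A B s a b : uniq s ->
  measurable [set x | A x] -> measurable [set x | B x] ->
  (forall x, A x -> ~~ B x) ->
  (P [set w | (hits A s w < a)%N && (hits B s w < b)%N] <=
     (binlt (size s) a (pr A) * binlt (size s) b (pr B))%:E)%E.
Proof.
move=> + mA mB dAB; elim: s a b => [|l s IH] [|a] b us.
- by under eq_set do rewrite ltn0; rewrite set_false measure0 binlt0 mul0r.
- case: b => [|b].
    by under eq_set do rewrite ltn0 andbF; rewrite set_false measure0 mulr0.
  by rewrite /= mulr1 probability_le1// set_true.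
- by under eq_set do rewrite ltn0; rewrite set_false measure0 mul0r.
case: b => [|b].
  by under eq_set do rewrite ltn0 andbF; rewrite set_false measure0 mulr0.
have us' : uniq s by case/andP: us.
set n := size s; set p := pr A; set q := pr B.
pose E := [set z : T * n.-tuple T | (A z.1 + count A z.2 < a.+1)%N] `&`
  [set z : T * n.-tuple T | (B z.1 + count B z.2 < b.+1)%N].
have mE : measurable E by apply: measurableI; exact: measurable_hits_section.
have := subsample_fubini hlaw hind us mE.
rewrite (_ : mkset _ = [set w | (hits A (l :: s) w < a.+1)%N && (hits B (l :: s) w < b.+1)%N]); last first.
  apply/seteqP; split => w; rewrite /E /= !hits_cons; first by case=> -> ->.
  by move/andP.
move=> ->.
(* [c1], [c2] and [c3] are the induction bounds when the new point falls in [A], in [B], and in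
   neither; disjointness excludes a fourth case. *)
pose c1 := binlt n a p * binlt n b.+1 q.
pose c2 := binlt n a.+1 p * binlt n b q.
pose c3 := binlt n a.+1 p * binlt n b.+1 q.
pose D := ~` ([set x | A x] `|` [set x | B x]).
have mD : measurable D by apply: measurableC; exact: measurableU.
have p01 := pr01 mA; have q01 := pr01 mB.
have [Ga Ga1] := (binlt_itv n a p01, binlt_itv n a.+1 p01).
have [Hb Hb1] := (binlt_itv n b q01, binlt_itv n b.+1 q01).
have c10 : 0 <= c1 by rewrite /c1; nra.
have c20 : 0 <= c2 by rewrite /c2; nra.
have c30 : 0 <= c3 by rewrite /c3; nra.
pose g x := (c1 * \1_[set x | A x] x + c2 * \1_[set x | B x] x + c3 * \1_D x).
have mg : measurable_fun setT g.
  by apply: measurable_funD; [apply: measurable_funD|]; exact: measurable_cindic.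
apply: (@le_trans _ _ (\int[mu]_x (g x)%:E)%E).
  apply: ge0_le_integral => //.
  - exact: measurable_prob_section.
  - exact/measurable_EFinP.
  move=> x _; rewrite /g !indicE.
  have inE' (C : pred T) : (x \in [set x | C x]) = C x by apply/idP/idP; rewrite inE.
  have -> : (x \in D) = ~~ A x && ~~ B x.
    apply/idP/idP; rewrite inE /D /= not_orE; first by case=> /negP -> /negP ->.
    by case/andP => /negP ? /negP.
  rewrite !inE'; have [Ax|/negbTE nAx] := boolP (A x).
    have /negbTE nBx := dAB _ Ax.
    rewrite nBx !mulr0 mulr1 !addr0; apply: le_trans (IH a b.+1 us').
    apply: le_section_prob => [//||w [/=]]; first exact: measurable_hits2.
    by rewrite Ax nBx add1n add0n -!hits_subsample ltnS => h1 h2; exact/andP.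
  have [Bx|/negbTE nBx] := boolP (B x).
    rewrite !mulr0 mulr1 add0r addr0; apply: le_trans (IH a.+1 b us').
    apply: le_section_prob => [//||w [/=]]; first exact: measurable_hits2.
    by rewrite nAx Bx add1n add0n -!hits_subsample => h1; rewrite ltnS => h2; exact/andP.
  rewrite !mulr0 mulr1 !add0r; apply: le_trans (IH a.+1 b.+1 us').
  apply: le_section_prob => [//||w [/=]]; first exact: measurable_hits2.
  by rewrite nAx nBx !add0n -!hits_subsample => -> ->.
rewrite (_ : (fun x => (g x)%:E) = (fun x => (c1 * \1_[set x | A x] x)%:E +
   (c2 * \1_[set x | B x] x)%:E + (c3 * \1_D x)%:E)%E)//.
have cind0 c (C : set T) x : 0 <= c -> (0 <= (c * \1_C x)%:E)%E.
  by move=> c0; rewrite lee_fin mulr_ge0.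
have mcind c (C : set T) : measurable C -> measurable_fun setT (fun x => (c * \1_C x)%:E).
  by move=> mC; apply/measurable_EFinP; exact: measurable_cindic.
rewrite ge0_integralD//=; [|by move=> x _; rewrite adde_ge0 ?cind0| |by move=> x _; exact: cind0|exact: mcind]; last first.
  by apply: emeasurable_funD; exact: mcind.
rewrite ge0_integralD//=; [|by move=> x _; exact: cind0|exact: mcind|by move=> x _; exact: cind0|exact: mcind].
rewrite !integral_cindic//.
have muD : mu D = (1 - (p + q))%:E.
  rewrite /D prC; last exact: measurableU.
  have -> : mu ([set x | A x] `|` [set x | B x]) = (p + q)%:E; last by [].
  rewrite EFinD -!prE//; apply: measureU => //.
  by apply/seteqP; split => // x [/= Ax Bx]; move: (dAB _ Ax); rewrite Bx.
rewrite [X in (_ + _ * X <= _)%E](_ : _ = (1 - (p + q))%:E); last exact: muD.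
rewrite [X in (_ * X + _ + _)%E](_ : _ = p%:E); last exact: prE.
rewrite [X in (_ + _ * X + _)%E](_ : _ = q%:E); last exact: prE.
rewrite -!EFinM -!EFinD lee_fin /=.
have h1 : 0 <= binlt n a.+1 p - binlt n a p by rewrite subr_ge0 binlt_leS.
have h2 : 0 <= binlt n b.+1 q - binlt n b q by rewrite subr_ge0 binlt_leS.
(* The claimed bound is the product of two [binlt] recursions. Its excess over p c1 + q c2 + (1 - p
   - q) c3 is p q times the product of the two increments of [binlt] in the threshold, which are
   nonnegative. *)
rewrite -/n -subr_ge0 [leRHS](_ : _ = p * q *
  ((binlt n b.+1 q - binlt n b q) * (binlt n a.+1 p - binlt n a p))).
  by apply: mulr_ge0; apply: mulr_ge0 => //; [case/andP: p01|case/andP: q01].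
rewrite /c1 /c2 /c3; ring.
Qed.

End counting_law.

(** * Volume of balls *)

Section affine.
Context (R : realType).

Lemma lebesgue_measure_affine (c r : R) (A : set R) : 0 < r -> measurable A ->
  lebesgue_measure A = (r%:E * lebesgue_measure [set t | A (c + r * t)%R])%E.
Proof.
move=> r0; pose h (t : R) := c + r * t.
have mh : measurable_fun [set: measurableTypeR R] (h : _ -> measurableTypeR R).
  by apply: measurable_funD => //; apply: measurable_funM.
pose m2 : {measure set (measurableTypeR R) -> \bar R} :=
  mscale (NngNum (ltW r0))
    (measure_function_pushforward__canonical__measure_function_Measure
       (@lebesgue_measure R) mh).
apply: (@lebesgue_measure_unique R m2) => _ [[a b] _ <-] /=.
rewrite /m2 /mscale /= /pushforward /=.
rewrite (_ : h @^-1` _ = `](a - c) / r, (b - c) / r]%classic); last first.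
  apply/seteqP; split => t; rewrite /preimage /= !in_itv /= /h ltr_pdivrMr// ler_pdivlMr//;
    by rewrite ltrBlDl lerBrDl [t * r]mulrC.
rewrite !lebesgue_measure_itv /= !lte_fin ltr_pM2r ?invr_gt0// ltrD2r.
case: ifP => _; rewrite ?mule0// -EFinB -EFinM; congr (_%:E).
by rewrite -mulrBl opprB addrA subrK mulrC divfK// gt_eqF.
Qed.

Context (m : nat).
Implicit Types x c : m.-tuple R.

Definition affine_tuple c r x := [tuple tnth c i + r * tnth x i | i < m].

Lemma measurable_affine_tuple c r : measurable_fun setT (affine_tuple c r).
Proof.
apply/measurable_fun_tnthP => i.
rewrite (_ : _ \o _ = fun x => tnth c i + r * tnth x i); last first.
  by apply/funext => x /=; rewrite tnth_mktuple.
apply: measurable_funD => //; apply: measurable_funM => //; exact: measurable_tnth.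
Qed.

Lemma lebesgue_tuple_rect (A : 'I_m -> set R) : (forall i, measurable (A i)) ->
  lebesgue_tuple m (tuple_rect A) = (\prod_(i < m) lebesgue_measure (A i))%E.
Proof. by move=> mA; rewrite -lebesgue_tuple_box. Qed.

Lemma prod_EFin (s : 'I_m -> R) : (\prod_(i < m) (s i)%:E)%E = (\prod_(i < m) s i)%:E.
Proof. by rewrite (big_morph _ EFinM erefl). Qed.

Lemma lebesgue_tuple_cube_lty (k : R) :
  (lebesgue_tuple m (tuple_rect (fun=> `[(- k)%R, k]%classic)) < +oo)%E.
Proof.
rewrite lebesgue_tuple_rect; last by move=> _; exact: measurable_itv.
rewrite (eq_bigr (fun=> (fine (lebesgue_measure `[- k, k]%classic))%:E)).
  by rewrite prod_EFin ltry.
move=> i _; rewrite fineK// lebesgue_measure_itv /=.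
by case: ifP => _.
Qed.

Lemma cover_itv_nat : \bigcup_k `[- (k%:R : R), k%:R]%classic = [set: R].
Proof.
apply/seteqP; split => // x _; exists (Num.bound `|x|) => //=.
rewrite in_itv /= -ler_norml; apply: ltW; exact: archi_boundP (normr_ge0 _).
Qed.

Lemma nondecreasing_itv_nat :
  nondecreasing_seq (fun k => `[- (k%:R : R), k%:R]%classic).
Proof.
move=> i j ij; apply/subsetPset => x /=; rewrite !in_itv /= => /andP[h1 h2].
have ij' : i%:R <= j%:R :> R by rewrite ler_nat.
by rewrite (le_trans _ h1) ?lerN2//= (le_trans h2).
Qed.

Lemma lebesgue_tuple_affine c r A : 0 < r -> measurable A ->
  lebesgue_tuple m A =
    ((r ^+ m)%:E * lebesgue_tuple m [set x | A (affine_tuple c r x)])%E.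
Proof.
move=> r0; have rm0 : 0 <= r ^+ m by apply: exprn_ge0; exact: ltW.
have mh := @measurable_affine_tuple c r.
pose m2 : {measure set (m.-tuple R) -> \bar R} :=
  mscale (NngNum rm0)
    (measure_function_pushforward__canonical__measure_function_Measure
       (@lebesgue_tuple R m) mh).
apply: (@tuple_measure_unique R _ R m (@lebesgue_tuple R m) m2
  (fun k => `[- (k%:R : R), k%:R]%classic)).
- by move=> k; exact: measurable_itv.
- exact: nondecreasing_itv_nat.
- exact: cover_itv_nat.
- by move=> k; exact: lebesgue_tuple_cube_lty.
move=> B mB; rewrite /m2 /= /mscale /= /pushforward /=.
pose B' i := [set t | B i (tnth c i + r * t)].
have mB' i : measurable (B' i).
  have h : measurable_fun setT (fun t : R => tnth c i + r * t).
    by apply: measurable_funD => //; exact: measurable_funM.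
  by rewrite -[X in measurable X]setTI; exact: (h measurableT _ (mB i)).
rewrite (_ : _ @^-1` _ = tuple_rect B'); last first.
  by apply/seteqP; split => x h i; have := h i; rewrite tnth_mktuple.
rewrite !lebesgue_tuple_rect//.
transitivity (\prod_(i < m) (r%:E * lebesgue_measure (B' i)))%E.
  by apply: eq_bigr => i _; rewrite (lebesgue_measure_affine (tnth c i) r0).
by rewrite big_split /= prod_EFin prodr_const card_ord.
Qed.

Definition cball x (r : R) := [set y | edist x y <= r].

Lemma measurable_cball x r : measurable (cball x r).
Proof. by apply: measurable_fun_set_le; apply: measurable_edist_comp. Qed.

Definition unit_ball : set (m.-tuple R) := [set y | enorm y <= 1].

Lemma lebesgue_cball0 x r : 0 < r ->
  lebesgue_tuple m (cball x r) = ((r ^+ m)%:E * lebesgue_tuple m unit_ball)%E.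
Proof.
move=> r0; rewrite (lebesgue_tuple_affine x r0); last exact: measurable_cball.
congr (_ * lebesgue_tuple m _)%E; apply/seteqP.
suff h y : cball x r (affine_tuple x r y) = unit_ball y by split => y /=; rewrite h.
rewrite /cball /unit_ball /= edist_le ?(ltW r0)// enorm_le//.
rewrite (eq_bigr (fun i => r ^+ 2 * tnth y i ^+ 2)); last first.
  by move=> i _; rewrite tnth_mktuple; ring.
by rewrite -mulr_sumr expr1n ger_pMr ?exprn_gt0.
Qed.

Lemma lebesgue_enorm_ball r : 0 < r ->
  lebesgue_tuple m [set y | enorm y <= r] =
  ((r ^+ m)%:E * lebesgue_tuple m unit_ball)%E.
Proof.
move=> r0; rewrite -(lebesgue_cball0 [tuple 0 | i < m] r0); congr (lebesgue_tuple m _).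
apply/funext => y; rewrite /cball /= edist_le ?enorm_le ?(ltW r0)//.
by under [in RHS]eq_bigr do rewrite tnth_mktuple sub0r sqrrN.
Qed.

End affine.

Lemma integral_lebesgue_tupleS (R : realType) (m : nat)
    (f : m.+1.-tuple R -> \bar R) :
  measurable_fun setT f -> (forall x, (0 <= f x)%E) ->
  (\int[lebesgue_tuple m.+1]_x f x =
   \int[lebesgue_measure]_t \int[lebesgue_tuple m]_x f (tuple_cons (t, x)))%E.
Proof.
move=> mf f0.
have mc : measurable_fun [set: measurableTypeR R * m.-tuple R] (@tuple_cons R m).
  exact: measurable_tuple_cons.
pose lam : {measure set (measurableTypeR R * m.-tuple R) -> \bar R} :=
  (@lebesgue_measure R \x @lebesgue_tuple R m)%E.
pose nu : {measure set (m.+1.-tuple R) -> \bar R} :=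
  measure_function_pushforward__canonical__measure_function_Measure lam mc.
rewrite (@eq_measure_integral _ _ _ _ nu)//.
rewrite ge0_integral_pushforward//=.
rewrite (@fubini_tonelli1 _ _ _ _ R (@lebesgue_measure R) (@lebesgue_tuple R m))//.
exact: measurableT_comp.
Qed.

Lemma integral_gauss_tuple (R : realType) (m : nat) :
  (\int[lebesgue_tuple m]_x (expR (- (\sum_(i < m) tnth x i ^+ 2)))%:E =
   (Num.sqrt pi ^+ m : R)%:E)%E.
Proof.
have mE n : measurable_fun [set: n.-tuple R]
    (fun x => (expR (- (\sum_(i < n) tnth x i ^+ 2)))%:E).
  apply/measurable_EFinP; apply: measurableT_comp; first exact: measurable_expR.
  apply: measurable_funN; apply: measurable_sum => i; apply: measurable_funX.
  exact: measurable_tnth.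
elim: m => [|m IH].
  rewrite /= integral_dirac//; last exact: (mE 0%N).
  by rewrite diracE mem_set// mul1e big_ord0 oppr0 expR0 expr0.
rewrite integral_lebesgue_tupleS//.
transitivity (\int[lebesgue_measure]_t ((Num.sqrt pi ^+ m : R)%:E * (gauss_fun t)%:E))%E.
  apply: eq_integral => t _.
  rewrite -IH muleC -ge0_integralZl_EFin//; [|exact: mE|exact: gauss_fun_ge0].
  apply: eq_integral => x _; rewrite -EFinM; congr (_%:E).
  rewrite big_ord_recl opprD expRD /gauss_fun /=; congr (_ * expR (- _)).
  by apply: eq_bigr => i _; rewrite tnthS; congr (tnth _ _ ^+ 2); exact: val_inj.
rewrite ge0_integralZl_EFin//; last 2 first.
- by move=> x _; rewrite lee_fin gauss_fun_ge0.
- by apply/measurable_EFinP; exact: measurable_gauss_fun.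
by rewrite integralT_gauss -EFinM -exprSr.
Qed.

Lemma integral_expRN_cy (R : realType) (s : R) :
  (\int[lebesgue_measure]_(t in `[s, +oo[) (expR (- t))%:E = (expR (- s))%:E)%E.
Proof.
have der x : is_derive x (1 : R) (fun t => - expR (- t)) (expR (- x)).
  have h := is_derive1_comp (is_derive_expR (- x)) (is_deriveN (is_derive_id x (1 : R))).
  by move: (is_deriveN h); rewrite mulrN1 opprK.
have cont x : {for x, continuous (fun t : R => - expR (- t))}.
  by apply/differentiable_continuous/derivable1_diffP; apply: ex_derive.
rewrite (@ge0_continuous_FTC2y _ _ (fun t => - expR (- t)) _ 0).
- by rewrite EFinN oppeK add0e.
- by move=> x _; exact: expR_ge0.
- apply: continuous_subspaceT => x; apply: continuous_comp.
    exact: opp_continuous.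
  exact: continuous_expR.
- rewrite -[X in _ --> X]oppr0; apply: cvgN; exact: cvgr_expR.
- by move=> x _; apply: ex_derive.
- by apply: cvg_at_right_filter; exact: cont.
- by move=> x _; rewrite derive1E derive_val.
Qed.

Section ball_volume.
Context (R : realType) (m : nat).

(** After the order of integration is exchanged, the section at level t is a ball of radius sqrt t,
    whose volume brings in t^(m/2). *)
Let integral_ball_tail :
  (\int[lebesgue_tuple m]_x (expR (- (\sum_(i < m) tnth x i ^+ 2)))%:E =
   lebesgue_tuple m (@unit_ball R m) *
   \int[lebesgue_measure]_(t in `]0%R, +oo[) (t `^ (m%:R / 2) * expR (- t))%:E)%E.
Proof.
pose q (x : m.-tuple R) := \sum_(i < m) tnth x i ^+ 2.
have mq : measurable_fun setT q.
  apply: measurable_sum => i; apply: measurable_funX; exact: measurable_tnth.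
have q0 x : 0 <= q x by apply: sumr_ge0 => i _; exact: sqr_ge0.
pose A := [set z : m.-tuple R * measurableTypeR R | q z.1 <= z.2].
have mA : measurable A.
  rewrite (_ : A = [set z | q z.1 - z.2 <= 0]); last first.
    by apply/seteqP; split => z /=; rewrite subr_le0.
  apply: measurable_fun_set_le; apply: measurable_funB => //.
  by apply: measurableT_comp.
pose h (z : m.-tuple R * measurableTypeR R) := (\1_A z * expR (- z.2))%:E.
have mh : measurable_fun setT h.
  apply/measurable_EFinP; apply: measurable_funM; first exact: measurable_indic.
  apply: measurableT_comp; first exact: measurable_expR.
  exact: measurable_funN.
have h0 z : (0 <= h z)%E by rewrite lee_fin mulr_ge0// expR_ge0.
transitivity (\int[lebesgue_tuple m]_x \int[lebesgue_measure]_t h (x, t))%E.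
  apply: eq_integral => x _; rewrite -integral_expRN_cy integral_mkcond.
  apply: eq_integral => t _; rewrite patchE /h indicE.
  have -> : (t \in `[q x, +oo[%classic) = ((x, t) \in A).
    by apply/idP/idP; rewrite !inE /A /= in_itv /= andbT.
  by case: ifP => _; rewrite ?mul1r ?mul0r.
rewrite (@fubini_tonelli _ _ _ _ R (@lebesgue_tuple R m) (@lebesgue_measure R) h)//.
pose w (t : measurableTypeR R) := (t `^ (m%:R / 2) * expR (- t))%:E.
have mw : measurable_fun setT w.
  apply/measurable_EFinP; apply: measurable_funM; first exact: measurable_powR.
  apply: measurableT_comp; first exact: measurable_expR.
  exact: measurable_funN.
have w0 t : (0 <= w t)%E by rewrite lee_fin mulr_ge0 ?powR_ge0 ?expR_ge0.
transitivity (\int[lebesgue_measure]_(t in `]0%R, +oo[) (lebesgue_tuple m (@unit_ball R m) * w t))%E;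
  last by apply: ge0_integralZl => //; exact: measurable_funTS.
rewrite [RHS]integral_mkcond; apply: ge0_ae_eq_integral => //.
- exact: measurable_fun_fubini_tonelli_G.
- apply/(measurable_restrictT _ _).1 => //.
  by apply: measurable_funTS; exact: measurable_funeM.
- by move=> y _; exact: integral_ge0.
- by move=> y _; rewrite patchE; case: ifP => // _; rewrite mule_ge0.
(* Scaling of balls requires a positive radius, so t = 0 is discarded as a null set. For t < 0 both
   functions vanish. *)
exists [set 0]; split; [exact: measurable_set1|exact: lebesgue_measure_set1|].
move=> t /=; apply: contra_notP => /eqP t0 _.
have [tn|tp] := ltP t 0.
  rewrite patchE memNset ?integral0_eq//; last by rewrite /= in_itv /= andbT; apply/negP; rewrite -leNgt ltW.
  move=> x _; rewrite /h indicE memNset ?mul0r// /A /=; apply/negP.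
  by rewrite -ltNge (lt_le_trans tn).
have {}tp : 0 < t by rewrite lt_neqAle eq_sym t0.
rewrite patchE mem_set; last by rewrite /= in_itv /= tp.
rewrite (_ : (fun x => h (x, t)) = (fun x => (expR (- t) * \1_[set y | enorm y <= Num.sqrt t] x)%:E)); last first.
  apply/funext => x; rewrite /h mulrC !indicE; congr (_ * (nat_of_bool _)%:R)%:E.
  have st : 0 < Num.sqrt t by rewrite sqrtr_gt0.
  apply/idP/idP; rewrite !inE /A /= enorm_le ?(ltW st)// sqr_sqrtr//; exact: ltW.
rewrite integral_cindic ?expR_ge0//; last first.
  by apply: measurable_fun_set_le; exact: measurable_enorm.
rewrite [X in (_ * X)%E](_ : _ = (Num.sqrt t ^+ m)%:E * lebesgue_tuple m (@unit_ball R m))%E;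
  last by apply: lebesgue_enorm_ball; rewrite sqrtr_gt0.
rewrite muleA [RHS]muleC /w; congr (_ * _)%E.
rewrite -EFinM mulrC; congr (_ * _)%:E.
by rewrite -powR12_sqrt ?(ltW tp)// -powR_mulrn ?powR_ge0// -powRrM mulrC.
Qed.

(* Tonelli applied to [exp (- |x|^2) = int_(|x|^2)^oo exp (- t) dt]. *)
Lemma lebesgue_unit_ball :
  lebesgue_tuple m (@unit_ball R m) = (unit_ball_vol R m)%:E /\ 0 < unit_ball_vol R m.
Proof.
have := integral_ball_tail; rewrite integral_gauss_tuple.
set I := (\int[_]_(_ in _) _)%E; set b := lebesgue_tuple m _ => bI.
have s0 : 0 < Num.sqrt pi ^+ m :> R by rewrite exprn_gt0// sqrtr_gt0 pi_gt0.
have I0 : (0 <= I)%E.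
  by apply: integral_ge0 => t _; rewrite lee_fin mulr_ge0 ?powR_ge0 ?expR_ge0.
have b0 : (0 <= b)%E by exact: measure_ge0.
have GE : Gamma (m%:R / 2 + 1 : R) = fine I.
  rewrite /Gamma /Rintegral; congr fine.
  by apply: eq_integral => t _; rewrite addrK.
rewrite /unit_ball_vol GE.
have -> : pi `^ (m%:R / 2) = Num.sqrt pi ^+ m :> R.
  by rewrite -powR12_sqrt ?pi_ge0// -powR_mulrn ?powR_ge0// -powRrM mulrC.
(* The product of the volume and the Gamma integral is a positive real number; the extended-real
   cases then show that each factor is positive and finite. *)
move: b I b0 I0 bI {GE} => [b| |] [I| |] //=; rewrite ?lee_fin => b0 I0.
- rewrite -EFinM => -[bI].
  have Ipos : 0 < I.
    by rewrite lt_neqAle I0 andbT eq_sym; apply: contraTneq s0 => I00; rewrite bI I00 mulr0 ltxx.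
  by rewrite bI mulfK ?gt_eqF//; split=> //; rewrite -(pmulr_lgt0 _ Ipos) -bI.
- move: b0; rewrite le_eqVlt => /predU1P[<-|b0].
    by rewrite mul0e => -[s00]; move: s0; rewrite s00 ltxx.
  by rewrite gt0_muley ?lte_fin.
- move: I0; rewrite le_eqVlt => /predU1P[<-|I0].
    by rewrite mule0 => -[s00]; move: s0; rewrite s00 ltxx.
  by rewrite gt0_mulye ?lte_fin.
Qed.

Lemma lebesgue_cball (x : m.-tuple R) r : 0 < r ->
  lebesgue_tuple m (cball x r) = (r ^+ m * unit_ball_vol R m)%:E.
Proof. by move=> r0; rewrite lebesgue_cball0// (lebesgue_unit_ball.1) -EFinM. Qed.

End ball_volume.

(** * Staircase functions *)

Section staircase.
Context (R : realType).
Implicit Types (t y : R) (n K : nat).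

(** The sum counts the natural numbers below t, so it is the ceiling of t; K terms are enough
    because t <= K. *)
Lemma sum_lt_itv t K : 0 <= t <= K%:R ->
  t <= \sum_(j < K) ((j%:R < t)%R : nat)%:R <= t + 1.
Proof.
have full : K%:R <= t -> \sum_(j < K) ((j%:R < t)%R : nat)%:R = K%:R :> R.
  move=> Kt; rewrite (eq_bigr (fun=> 1)) ?sumr_const ?card_ord// => j _.
  by rewrite (lt_le_trans _ Kt) ?ltr_nat// ltn_ord.
elim: K full => [|K IH] full; first by rewrite big_ord0; lra.
rewrite big_ord_recr /= => /andP[t0 tK].
have [Kt|tK'] := ltP K%:R t.
  rewrite (eq_bigr (fun=> 1)) ?sumr_const ?card_ord; last first.
    by move=> j _; rewrite (lt_trans _ Kt) ?ltr_nat// ltn_ord.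
  by move: tK; rewrite -natr1 /= => tK; apply/andP; split; lra.
rewrite addr0; apply: IH; last by rewrite t0.
move=> Kt; have -> : t = K%:R by apply/eqP; rewrite eq_le tK'.
rewrite (eq_bigr (fun=> 1)) ?sumr_const ?card_ord// => j _.
by rewrite ltr_nat ltn_ord.
Qed.

(** Steps of height 1 / n at the levels -n + j / n, which cut [-n, n) into 2 n^2 intervals. Up to a
    constant this is a combination of indicators of events level < y, so its mean needs only tail
    probabilities. *)
Definition stair n y : R :=
  - n%:R + n%:R^-1 * \sum_(j < 2 * n ^ 2) ((- n%:R + j%:R / n%:R < y)%R : nat)%:R.

Lemma stair_sum n y : (0 < n)%N ->
  \sum_(j < 2 * n ^ 2) ((- n%:R + j%:R / n%:R < y)%R : nat)%:R =
  \sum_(j < 2 * n ^ 2) ((j%:R < n%:R * (y + n%:R))%R : nat)%:R :> R.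
Proof.
move=> n0; apply: eq_bigr => j _; congr (nat_of_bool _)%:R.
by rewrite addrC ltrBlDr ltr_pdivrMr ?ltr0n// mulrC.
Qed.

Lemma stair_near n y : (0 < n)%N -> `|y| <= n%:R -> `|y - stair n y| <= n%:R^-1.
Proof.
move=> n0; rewrite ler_norml => /andP[y1 y2]; rewrite /stair stair_sum//.
have n0' : 0 < n%:R :> R by rewrite ltr0n.
set t := n%:R * (y + n%:R).
have := @sum_lt_itv t (2 * n ^ 2).
set S := \sum_(j < _) _ => /(_ _)/andP[|S1 S2].
  have t0 : 0 <= t by apply: mulr_ge0; lra.
  by rewrite t0 /= natrM natrX expr2 mulrCA ler_pM2l//; lra.
have St : t / n%:R = y + n%:R by rewrite /t mulrC mulKf// gt_eqF.
have {}S1 : t / n%:R <= n%:R^-1 * S by rewrite mulrC ler_pM2l// invr_gt0.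
have {}S2 : n%:R^-1 * S <= t / n%:R + n%:R^-1.
  by rewrite -[X in _ + X]mul1r -mulrDl mulrC ler_pM2r// invr_gt0.
by rewrite ler_norml; apply/andP; split; lra.
Qed.

Lemma stair_gt n y : (0 < n)%N -> n%:R < y -> stair n y = n%:R.
Proof.
move=> n0 ny; rewrite /stair stair_sum//; have n0' : 0 < n%:R :> R by rewrite ltr0n.
rewrite (eq_bigr (fun=> 1)).
  rewrite sumr_const card_ord natrM natrX expr2 mulrCA mulKf ?gt_eqF//; lra.
move=> j _; suff -> : j%:R < n%:R * (y + n%:R) by [].
apply: (@lt_trans _ _ (2 * n ^ 2)%:R); first by rewrite ltr_nat ltn_ord.
by rewrite natrM natrX expr2 mulrCA ltr_pM2l//; lra.
Qed.

Lemma stair_le n y : (0 < n)%N -> y <= - n%:R -> stair n y = - n%:R.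
Proof.
move=> n0 ny; rewrite /stair stair_sum// big1 ?mulr0 ?addr0// => j _.
rewrite ltNge (_ : _ <= _)//; apply: (@le_trans _ _ 0) => //.
by rewrite mulr_ge0_le0//; lra.
Qed.

Lemma stair_dist n y : (0 < n)%N ->
  `|y - stair n y| <= n%:R^-1 + Num.max 0 (`|y| - n%:R).
Proof.
move=> n0; have n0' : 0 < n%:R :> R by rewrite ltr0n.
have ni0 : 0 < n%:R^-1 :> R by rewrite invr_gt0.
have [yn|ny] := leP `|y| n%:R.
  by apply: (le_trans (stair_near n0 yn)); rewrite lerDl le_max lexx.
have -> : `|y - stair n y| = `|y| - n%:R.
  move: ny; have [y0|y0] := leP 0 y.
    by rewrite (ger0_norm y0) => ny; rewrite stair_gt// ger0_norm// subr_ge0 ltW.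
  by rewrite (ltr0_norm y0) => ny; rewrite stair_le// ?opprK ?ler0_norm; lra.
by rewrite -[leLHS]add0r lerD ?(ltW ni0)// le_max lexx orbT.
Qed.

End staircase.

(** * Lebesgue differentiation in L^1 *)

Section oscillation.
Context (R : realType) (m : nat).
Local Notation T := (m.-tuple R).
Local Notation lam := (@lebesgue_tuple R m).
Local Notation V := (unit_ball_vol R m).
Implicit Types (g h u : T -> R) (r : R).

Definition nearby r : set (T * T) := [set z | edist z.1 z.2 <= r].

Lemma measurable_nearby r : measurable (nearby r).
Proof. by apply: measurable_fun_set_le; exact: measurable_edist_comp. Qed.

Let measurable_nearbyM r (w : T * T -> R) : measurable_fun setT w ->
  measurable_fun setT (fun z => (\1_(nearby r) z * w z)%:E).
Proof.
move=> mw; apply/measurable_EFinP; apply: measurable_funM => //.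
by apply: measurable_indic; exact: measurable_nearby.
Qed.

Let section_nearby r (u : T -> R) x : 0 < r -> 0 <= u x ->
  (\int[lam]_y (\1_(nearby r) (x, y) * u x)%:E = (r ^+ m * V)%:E * (u x)%:E)%E.
Proof.
move=> r0 u0; rewrite (_ : (fun y => _) = (fun y => (u x * \1_(cball x r) y)%:E)); last first.
  apply/funext => y; rewrite mulrC !indicE.
  have -> // : (y \in cball x r) = ((x, y) \in nearby r).
  by apply/idP/idP; rewrite !inE.
rewrite integral_cindic//; last exact: measurable_cball.
transitivity ((u x)%:E * (r ^+ m * V)%:E)%E; last by rewrite muleC.
by congr (_ * _)%E; exact: lebesgue_cball.
Qed.

Let nearby_sym r x y : \1_(nearby r) (x, y) = \1_(nearby r) (y, x) :> R.
Proof.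
rewrite !indicE; have -> // : ((x, y) \in nearby r) = ((y, x) \in nearby r).
by apply/idP/idP; rewrite !inE /nearby /= edistC.
Qed.

Lemma integral_nearby1 r (u : T -> R) : 0 < r -> measurable_fun setT u ->
  (forall x, 0 <= u x) ->
  (\int[lam \x lam]_z (\1_(nearby r) z * u z.1)%:E =
   (r ^+ m * V)%:E * \int[lam]_x (u x)%:E)%E.
Proof.
move=> r0 mu u0; have [_ V0] := lebesgue_unit_ball R m.
have c0 : 0 <= r ^+ m * V by rewrite mulr_ge0 ?exprn_ge0// ltW.
have mu1 : measurable_fun setT (fun z : T * T => u z.1) by exact: measurableT_comp.
have u10 (z : T * T) : 0 <= u z.1 by [].
rewrite (@fubini_tonelli1 _ _ _ _ R lam lam _ (measurable_nearbyM r mu1)); last by move=> z; rewrite lee_fin mulr_ge0.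
rewrite -ge0_integralZl_EFin//; last 2 first.
- by move=> x _; rewrite lee_fin.
- exact/measurable_EFinP.
by apply: eq_integral => x _; exact: section_nearby.
Qed.

Lemma integral_nearby2 r (u : T -> R) : 0 < r -> measurable_fun setT u ->
  (forall x, 0 <= u x) ->
  (\int[lam \x lam]_z (\1_(nearby r) z * u z.2)%:E =
   (r ^+ m * V)%:E * \int[lam]_x (u x)%:E)%E.
Proof.
move=> r0 mu u0; rewrite -integral_nearby1//.
have mu1 : measurable_fun setT (fun z : T * T => u z.1) by exact: measurableT_comp.
have mu2 : measurable_fun setT (fun z : T * T => u z.2) by exact: measurableT_comp.
have u10 (z : T * T) : 0 <= u z.1 by [].
have u20 (z : T * T) : 0 <= u z.2 by [].
rewrite (@fubini_tonelli1 _ _ _ _ R lam lam _ (measurable_nearbyM r mu1)); last by move=> z; rewrite lee_fin mulr_ge0.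
rewrite (@fubini_tonelli2 _ _ _ _ R lam lam _ (measurable_nearbyM r mu2)); last by move=> z; rewrite lee_fin mulr_ge0.
apply: eq_integral => y _; apply: eq_integral => x _.
by rewrite nearby_sym.
Qed.

Definition osc r g : \bar R :=
  (\int[lam \x lam]_z (\1_(nearby r) z * `|g z.2 - g z.1|)%:E)%E.

Let measurable_osc r g : measurable_fun setT g ->
  measurable_fun setT (fun z : T * T => (\1_(nearby r) z * `|g z.2 - g z.1|)%:E).
Proof.
move=> mg; apply: measurable_nearbyM.
apply: measurableT_comp; first exact: normr_measurable.
by apply: measurable_funB; apply: measurableT_comp.
Qed.

Lemma le_osc_add r g h u : measurable_fun setT g -> measurable_fun setT h ->
  measurable_fun setT u ->
  (forall x y, `|g y - g x| <= `|h y - h x| + `|u y - u x|) ->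
  (osc r g <= osc r h + osc r u)%E.
Proof.
move=> mg mh mu ghu; rewrite /osc -ge0_integralD//; last 2 first.
- exact: measurable_osc.
- exact: measurable_osc.
apply: ge0_le_integral => //; first exact: measurable_osc.
  by apply: emeasurable_funD; exact: measurable_osc.
by move=> z _; rewrite -EFinD lee_fin -mulrDr ler_wpM2l.
Qed.

(** Over the pairs at distance at most r, each of u x and u y integrates to r^m V times the integral
    of u. Applied with u the absolute difference of two functions, and with u the indicator of a
    boundary layer. *)
Lemma osc_le_mass r g u : 0 < r -> measurable_fun setT g -> measurable_fun setT u ->
  (forall x, 0 <= u x) ->
  (forall x y, edist x y <= r -> `|g y - g x| <= u x + u y) ->
  (osc r g <= (2 * (r ^+ m * V))%:E * \int[lam]_x (u x)%:E)%E.
Proof.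
move=> r0 mg mu u0 gu; have [_ V0] := lebesgue_unit_ball R m.
have c0 : 0 <= r ^+ m * V by rewrite mulr_ge0 ?exprn_ge0// ltW.
have I0 : (0 <= \int[lam]_x (u x)%:E)%E by apply: integral_ge0 => x _; rewrite lee_fin.
rewrite mulrDl mul1r EFinD ge0_muleDl ?lee_fin//.
have mu1 : measurable_fun setT (fun z : T * T => u z.1) by exact: measurableT_comp.
have mu2 : measurable_fun setT (fun z : T * T => u z.2) by exact: measurableT_comp.
have u10 (z : T * T) : 0 <= u z.1 by [].
have u20 (z : T * T) : 0 <= u z.2 by [].
rewrite -{1}integral_nearby1// -integral_nearby2// -ge0_integralD//; last 4 first.
- by move=> z _; rewrite lee_fin mulr_ge0.
- exact: measurable_nearbyM.
- by move=> z _; rewrite lee_fin mulr_ge0.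
- exact: measurable_nearbyM.
apply: ge0_le_integral => //; first exact: measurable_osc.
  by apply: emeasurable_funD; exact: measurable_nearbyM.
move=> [x y] _ /=; rewrite -EFinD lee_fin -mulrDr indicE.
by have [xy|_] := boolP (_ \in _); rewrite ?mul0r// !mul1r gu//; move: xy; rewrite inE.
Qed.

(* Up to the volume of the unit ball, the mean of |g y - g x| over the ball
   B(x, r), integrated in x, tends to 0 with r. *)
Definition small_osc g :=
  forall e, 0 < e -> exists2 r0, 0 < r0 &
    forall r, 0 < r <= r0 -> (osc r g <= (e * r ^+ m)%:E)%E.

Lemma small_osc_add g h u : measurable_fun setT g -> measurable_fun setT h ->
  measurable_fun setT u ->
  (forall x y, `|g y - g x| <= `|h y - h x| + `|u y - u x|) ->
  small_osc h -> small_osc u -> small_osc g.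
Proof.
move=> mg mh mu ghu oh ou e e0; have e2 : 0 < e / 2 by rewrite divr_gt0.
have [r1 r10 h1] := oh _ e2; have [r2 r20 h2] := ou _ e2.
exists (Num.min r1 r2); first by rewrite lt_min r10.
move=> r /andP[r0]; rewrite le_min => /andP[rr1 rr2].
apply: (le_trans (le_osc_add r mg mh mu ghu)).
rewrite (splitr e) mulrDl EFinD leeD//; [apply: h1|apply: h2]; exact/andP.
Qed.

Lemma small_osc_scale c g : measurable_fun setT g -> small_osc g ->
  small_osc (fun x => c * g x).
Proof.
move=> mg og e e0; have c0 : 0 < `|c| + 1 by rewrite ltr_wpDl.
have [r1 r10 h1] := og _ (divr_gt0 e0 c0); exists r1 => // r rr.
have r0 : 0 < r by case/andP: rr.
apply: (@le_trans _ _ ((`|c| + 1)%:E * osc r g)%E).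
  rewrite /osc -ge0_integralZl_EFin//; [|exact: measurable_osc].
  apply: ge0_le_integral => //.
  - exact: (@measurable_osc r (fun x => c * g x) (measurable_funM (measurable_cst c) mg)).
  - by apply: measurable_funeM; exact: measurable_osc.
  move=> z _; rewrite -EFinM lee_fin mulrCA ler_wpM2l//.
  by rewrite -mulrBr normrM ler_wpM2r// lerDl.
apply: (@le_trans _ _ ((`|c| + 1)%:E * (e / (`|c| + 1) * r ^+ m)%:E)%E).
  by apply: lee_wpmul2l; [rewrite lee_fin ltW|exact: h1].
by rewrite -EFinM lee_fin mulrA mulrCA divff ?mulr1// gt_eqF.
Qed.

(** The oscillation of g - h is at most 2 r^m V times its L^1 norm, so small oscillation is stable
    under L^1 approximation. *)
Lemma small_osc_approx g : measurable_fun setT g ->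
  (forall e, 0 < e -> exists h, [/\ measurable_fun setT h, small_osc h &
     (\int[lam]_x (`|g x - h x|%R)%:E <= e%:E)%E]) ->
  small_osc g.
Proof.
move=> mg gh e e0; have [_ V0] := lebesgue_unit_ball R m.
(* Chosen so that 2 V r^m e' is one half of e r^m. *)
pose e' := e / 2 / (2 * V).
have e'0 : 0 < e' by rewrite /e' !divr_gt0// mulr_gt0.
have [h [mh oh ghe]] := gh _ e'0.
have [r1 r10 h1] := oh _ (divr_gt0 e0 (ltr0Sn R 1)).
exists r1 => // r rr; have r0 : 0 < r by case/andP: rr.
have mgh : measurable_fun setT (fun x => g x - h x) by exact: measurable_funB.
apply: (@le_trans _ _ (osc r h + osc r (fun x => (g x - h x)%R))%E).
  apply: le_osc_add => // x y.
  rewrite (_ : g y - g x = (h y - h x) + ((g y - h y) - (g x - h x))); last by ring.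
  exact: ler_normD.
rewrite (splitr e) mulrDl EFinD leeD//; first exact: h1.
apply: (le_trans (@osc_le_mass r _ (fun x => `|g x - h x|) r0 mgh _ _ _)) => //.
- by apply: measurableT_comp => //; exact: normr_measurable.
- by move=> x y _; rewrite [leRHS]addrC; exact: ler_normB.
apply: (@le_trans _ _ ((2 * (r ^+ m * V))%:E * e'%:E)%E).
  apply: lee_wpmul2l => //; rewrite lee_fin; apply: mulr_ge0 => //.
  by apply: mulr_ge0; [apply: exprn_ge0|]; exact: ltW.
rewrite -EFinM lee_fin /e' le_eqVlt; apply/orP; left; apply/eqP.
by field; rewrite gt_eqF.
Qed.

End oscillation.

(** * Open boxes as a generating family stable under intersection *)

Section open_boxes.
Context (R : realType) (m : nat).
Local Notation T := (m.-tuple R).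
Implicit Types a b : 'I_m -> R.

(** Open sides ensure that the copies shrunk by 1 / (n + 1) exhaust the box, so that the boundary
    layer between them has vanishing volume. *)
Definition open_box a b : set T := tuple_rect (fun i => `]a i, b i[%classic).

Lemma measurable_open_box a b : measurable (open_box a b).
Proof. by apply: measurable_tuple_rect => i; exact: measurable_itv. Qed.

Lemma open_box_setI a b a' b' : open_box a b `&` open_box a' b' =
  open_box (fun i => Num.max (a i) (a' i)) (fun i => Num.min (b i) (b' i)).
Proof.
rewrite /open_box tuple_rect_setI; congr tuple_rect; apply/funext => i.
apply/seteqP; split => x /=; rewrite !in_itv /= gt_max lt_min.
  by case=> /andP[-> ->] /andP[-> ->].
by case/andP=> /andP[-> ->] /andP[-> ->].
Qed.

Definition open_cube (k : nat) : set T := open_box (fun=> - k%:R) (fun=> k%:R).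

Lemma open_box_measurableE :
  @measurable _ T = <<s [set open_box ab.1 ab.2 | ab in setT] >>.
Proof.
apply: tuple_measurable_generated.
  by move=> _ [ab _ <-]; exact: measurable_open_box.
move=> i A mA; set G := [set _ | _ in _].
have : measurable_fun [set: g_sigma_algebraType G] ((fun x : T => tnth x i) : g_sigma_algebraType G -> R).
  apply: (measurability _ (RGenOInfty.measurableE R)) => _ /= -[_ [r ->] <-].
  rewrite setTI (_ : _ @^-1` _ = \bigcup_n open_box
    (fun j => if j == i then r else - n%:R) (fun=> n%:R)).
    apply: bigcup_measurable => n _; apply: sub_sigma_algebra.
    by exists (fun j => if j == i then r else - n%:R, fun=> n%:R).
  apply/seteqP; split => x.
    rewrite /preimage /= in_itv /= andbT => rx.
    have h j : exists n : nat, `|tnth x j| < n%:R.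
      by exists (Num.bound `|tnth x j|); exact: archi_boundP.
    have [N hN] := choice h.
    exists (\max_(j < m) N j)%N => // j; rewrite /= in_itv /=.
    have : `|tnth x j| < (\max_(j < m) N j)%:R.
      by rewrite (lt_le_trans (hN j))// ler_nat leq_bigmax.
    by rewrite ltr_norml => /andP[h1 ->]; case: eqP => [->|_]; rewrite ?rx ?h1.
  move=> [n _ /(_ i)]; rewrite /= eqxx /preimage /= !in_itv /=.
  by case/andP => ->.
by move=> /(_ measurableT _ mA); rewrite setTI.
Qed.

Lemma open_box_setI_closed :
  setI_closed [set open_box ab.1 ab.2 | ab in [set: ('I_m -> R) * ('I_m -> R)]].
Proof.
move=> _ _ [[a b] _ <-] [[a' b'] _ <-]; rewrite open_box_setI.
by exists (fun i => Num.max (a i) (a' i), fun i => Num.min (b i) (b' i)).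
Qed.

Lemma lebesgue_open_box_lty a b : (lebesgue_tuple m (open_box a b) < +oo)%E.
Proof.
rewrite lebesgue_tuple_rect; last by move=> i; exact: measurable_itv.
rewrite (eq_bigr (fun i => (fine (lebesgue_measure `]a i, b i[%classic))%:E)).
  by rewrite prod_EFin ltry.
move=> i _; rewrite fineK// lebesgue_measure_itv /=.
by case: ifP => _.
Qed.

Lemma open_box_near a b r x y : edist x y <= r ->
  open_box (fun i => a i + r) (fun i => b i - r) x -> open_box a b y.
Proof.
move=> xyr h i; have := h i; rewrite /= !in_itv /=.
have := le_trans (edist_coord x y i) xyr.
by rewrite ler_norml => /andP[h1 h2] /andP[h3 h4]; apply/andP; split; lra.
Qed.

End open_boxes.

(** * Small oscillation of bounded densities *)

Section small_osc_density.
Context (R : realType) (m : nat).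
Local Notation T := (m.-tuple R).
Local Notation lam := (@lebesgue_tuple R m).
Local Notation V := (unit_ball_vol R m).

Lemma decreasing_measure_small (B : (set T)^nat) e : 0 < e ->
  (forall n, measurable (B n)) -> (lam (B 0%N) < +oo)%E ->
  nonincreasing_seq B -> \bigcap_n B n = set0 ->
  exists n, (lam (B n) <= e%:E)%E.
Proof.
move=> e0 mB B0 ndB B00.
have := @nonincreasing_cvg_mu _ _ _ lam B B0 mB (bigcap_measurable (ex_intro _ 0%N I) (fun k _ => mB k)) ndB.
rewrite B00 measure0 => /fine_cvgP[[N1 _ fB] /cvgrPdist_le /(_ e e0)[N2 _ h]].
exists (maxn N1 N2); have := h _ (leq_maxr N1 N2).
have {}fB := fB _ (leq_maxl N1 N2).
by rewrite /= sub0r normrN -lee_fin ger0_norm ?fine_ge0// fineK.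
Qed.

(** If the indicator differs at two points at distance at most r, the one inside lies in the layer
    between the box and its copy shrunk by r. The volume of this layer tends to 0 with r. *)
Lemma small_osc_open_box a b : @small_osc R m (\1_(open_box a b)).
Proof.
move=> e e0; have [_ V0] := lebesgue_unit_ball R m.
pose A := @open_box R m a b.
pose A' r := @open_box R m (fun i => a i + r) (fun i => b i - r).
pose B n := A `\` A' n.+1%:R^-1.
have A'S r r' : r <= r' -> A' r' `<=` A' r.
  by move=> rr x h i; have := h i; rewrite /= !in_itv /= => /andP[]; lra.
have mA : measurable A by exact: measurable_open_box.
have mB n : measurable (B n) by apply: measurableD => //; exact: measurable_open_box.
have e1 : 0 < e / (2 * V) by rewrite divr_gt0// mulr_gt0.
have [|||n hn] := @decreasing_measure_small B _ e1 mB.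
- apply: le_lt_trans (lebesgue_open_box_lty a b).
  by rewrite le_measure ?inE//; exact: subDsetl.
- move=> i j ij; apply/subsetPset; apply: setDS; apply: A'S.
  by rewrite lef_pV2 ?posrE// ler_nat ltnS.
- apply/seteqP; split => // x h.
  have [Ax _] := h 0%N I.
  have gap i : exists n : nat, n.+1%:R^-1 < Num.min (tnth x i - a i) (b i - tnth x i).
    have /andP[h1 h2] : a i < tnth x i < b i by have := Ax i; rewrite /= in_itv.
    have p0 : 0 < Num.min (tnth x i - a i) (b i - tnth x i) by rewrite lt_min !subr_gt0 h1.
    have [k hk] := ltr_add_invr p0; exists k; by rewrite add0r in hk.
  have [N hN] := choice gap.
  have [_ []] := h (\max_(i < m) N i)%N I => i.
  have /lt_le_trans := hN i.
  have : (\max_(i < m) N i).+1%:R^-1 <= (N i).+1%:R^-1 :> R.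
    by rewrite lef_pV2 ?posrE// ler_nat ltnS leq_bigmax.
  move=> /le_lt_trans /(_ (hN i)); rewrite lt_min => /andP[+ +] _.
  by rewrite /= in_itv /=; set z := _^-1 => h1 h2; apply/andP; split; lra.
exists n.+1%:R^-1 => // r /andP[r0 rn].
have mD : measurable (A `\` A' r) by apply: measurableD => //; exact: measurable_open_box.
apply: (le_trans (@osc_le_mass R m r _ (\1_(A `\` A' r)) r0 _ _ _ _)) => //.
  move=> x y xy; rewrite !indicE.
  have key u v : edist u v <= r -> u \in A -> v \notin A -> u \in A `\` A' r.
    move=> uv; rewrite inE => Au; rewrite notin_setE => nAv; rewrite inE; split=> // A'u.
    by apply: nAv; exact: open_box_near uv A'u.
  have [yA|yA] := boolP (y \in A); have [xA|xA] := boolP (x \in A).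
  - by rewrite subrr normr0 addr_ge0.
  - by rewrite (key y x) ?subr0 ?normr1 ?lerDr// edistC.
  - by rewrite (key x y) ?sub0r ?normrN ?normr1 ?lerDl.
  - by rewrite subrr normr0 addr_ge0.
rewrite integral_indic// setIT.
apply: (@le_trans _ _ ((2 * (r ^+ m * V))%:E * (e / (2 * V))%:E)%E).
  apply: lee_wpmul2l; first by rewrite lee_fin; apply: mulr_ge0 => //; apply: mulr_ge0; [apply: exprn_ge0|]; exact: ltW.
  apply: le_trans hn; rewrite le_measure ?inE//.
  by apply: setDS; exact: A'S.
rewrite -EFinM lee_fin le_eqVlt; apply/orP; left; apply/eqP.
by field; rewrite gt_eqF.
Qed.

Lemma small_osc_cst0 : @small_osc R m (cst 0).
Proof.
move=> e e0; exists 1 => // r /andP[r0 _].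
rewrite /osc integral0_eq; first by rewrite lee_fin; apply: mulr_ge0; [|apply: exprn_ge0]; exact: ltW.
by move=> z _; rewrite subrr normr0 mulr0.
Qed.

Lemma small_osc_D (g h : T -> R) : measurable_fun setT g -> measurable_fun setT h ->
  small_osc g -> small_osc h -> small_osc (fun x => g x + h x).
Proof.
move=> mg mh; apply: small_osc_add => //; first exact: measurable_funD.
move=> x y; rewrite (_ : g y + h y - _ = (g y - g x) + (h y - h x)); last by ring.
exact: ler_normD.
Qed.

Lemma small_osc_sum n (g : 'I_n -> T -> R) : (forall i, measurable_fun setT (g i)) ->
  (forall i, small_osc (g i)) -> small_osc (fun x => \sum_(i < n) g i x).
Proof.
move=> mg og; elim: n g mg og => [|n IH] g mg og.
  rewrite (_ : (fun x => _) = cst 0); first exact: small_osc_cst0.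
  by apply/funext => x; rewrite big_ord0.
rewrite (_ : (fun x => _) = (fun x => \sum_(i < n) g (widen_ord (leqnSn n) i) x + g ord_max x)).
  apply: small_osc_D => //; first exact: measurable_sum.
  by apply: IH.
by apply/funext => x; rewrite big_ord_recr.
Qed.

(** Dynkin induction on [A] from open boxes. The fixed cube keeps measures finite, so a countable
    disjoint union is an L^1 limit of its finite parts; a complement within the cube is a difference
    of two indicators. *)
Lemma small_osc_indic k (A : set T) : measurable A ->
  small_osc (\1_(A `&` @open_cube R m k) : T -> R).
Proof.
pose C := @open_cube R m k; have mC : measurable C by exact: measurable_open_box.
have mi (B : set T) : measurable B -> measurable_fun setT (\1_(B `&` C) : T -> R).
  by move=> mB; apply: measurable_indic; exact: measurableI.
rewrite {1}open_box_measurableE; move: A.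
apply: (dynkin_induction (open_box_measurableE R m) (@open_box_setI_closed R m)).
- by rewrite setTI; exact: small_osc_open_box.
- move=> _ [[a b] _ <-] /=; rewrite /C /open_cube open_box_setI.
  exact: small_osc_open_box.
- move=> A mA oA; rewrite (_ : \1_(~` A `&` C) =
    (fun x => \1_C x + (-1) * \1_(A `&` C) x)).
    apply: small_osc_D.
    + exact: measurable_indic.
    + by apply: measurable_funM => //; exact: mi.
    + exact: small_osc_open_box.
    + by apply: small_osc_scale => //; exact: mi.
  apply/funext => x; rewrite !indicE !in_setI in_setC.
  by case: (x \in A); case: (x \in C) => /=; rewrite ?mulr1 ?mulr0 ?addr0 ?subrr// mulN1r subrr.
- move=> F mF tF oF; apply: small_osc_approx.
    by apply: mi; exact: bigcup_measurable.
  move=> e e0; pose U n := \big[setU/set0]_(i < n) F i.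
  have mU n : measurable (U n) by exact: bigsetU_measurable.
  have oU n : small_osc (\1_(U n `&` C) : T -> R).
    elim: n => [|n IH].
      rewrite /U big_ord0 set0I (_ : \1_set0 = cst 0); first exact: small_osc_cst0.
      by apply/funext => x; rewrite indicE in_set0.
    rewrite (_ : \1_(U n.+1 `&` C) = (fun x => \1_(U n `&` C) x + \1_(F n `&` C) x)).
      by apply: small_osc_D => //; exact: mi.
    apply/funext => x; rewrite !indicE /U big_ord_recr /= -/(U n) !in_setI in_setU.
    have [xF|xF] := boolP (x \in F n); last by rewrite orbF addr0.
    have -> : x \in U n = false.
      apply/negP; rewrite inE /U -bigcup_mkord => -[j /= jn Fj].
      have /trivIsetP/(_ j n I I) := tF; rewrite lt_eqF// => /(_ isT)/seteqP[+ _].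
      by apply; split; [exact: Fj|rewrite inE in xF].
    by rewrite add0r.
  pose B n := (\bigcup_k F k `\` U n) `&` C.
  have mB n : measurable (B n).
    by apply: measurableI => //; apply: measurableD => //; exact: bigcup_measurable.
  have [|||n hn] := @decreasing_measure_small B _ e0 mB.
  + apply: le_lt_trans (@lebesgue_open_box_lty R m (fun=> - k%:R) (fun=> k%:R)).
    by apply: le_measure; rewrite ?inE//; exact: subIsetr.
  + move=> i j ij; apply/subsetPset; apply: setSI; apply: setDS.
    by apply: subset_bigsetU.
  + apply/seteqP; split => // x h; have [[[j _ Fj] _] _] := h 0%N I.
    have [[_ nU] _] := h j.+1 I; apply: nU.
    by rewrite /U -bigcup_mkord; exists j => /=.
  exists (\1_(U n `&` C)); split => //; first exact: mi.
  rewrite (eq_integral (EFin \o \1_(B n))); first by rewrite integral_indic// setIT.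
  move=> x _; rewrite /= !indicE; congr (_%:E).
  have BE : (x \in B n) = [&& x \in \bigcup_k F k, x \notin U n & x \in C].
    apply/idP/and3P; first by rewrite inE => -[[h1 h2] h3]; split; rewrite ?notin_setE ?inE.
    by case; rewrite !inE notin_setE => h1 h2 h3; split.
  rewrite BE !in_setI -/C.
  have UF : x \in U n -> x \in \bigcup_k F k.
    rewrite !inE /U -bigcup_mkord => -[j _ Fj]; by exists j.
  case: (x \in C); rewrite ?andbF ?subrr ?normr0// !andbT.
  move: UF; case: (x \in U n) => [->//|_]; first by rewrite subrr normr0 andbF.
  by rewrite subr0 andbT normr_nat.
Qed.

(** In L^1, f is close to its staircase cut off outside a large cube: integrability controls the
    outside, and inside the error is at most 1 / n as soon as n >= M. That staircase is a finite
    combination of indicators. *)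
Lemma small_osc_bounded (f : T -> R) (M : R) : measurable_fun setT f ->
  (forall x, 0 <= f x <= M) -> (\int[lam]_x (f x)%:E < +oo)%E -> small_osc f.
Proof.
move=> mf f0M fi; apply: small_osc_approx => // e e0.
have f0 x : 0 <= f x by case/andP: (f0M x).
pose C k : set T := @open_cube R m k.
have mC k : measurable (C k) by exact: measurable_open_box.
have ndC : nondecreasing_seq C.
  move=> i j ij; apply/subsetPset => x h l; have := h l; rewrite /= !in_itv /= => /andP[h1 h2].
  have ij' : i%:R <= j%:R :> R by rewrite ler_nat.
  by apply/andP; split; lra.
have CT : \bigcup_k C k = setT.
  apply/seteqP; split => // x _.
  have h j : exists n : nat, `|tnth x j| < n%:R.
    by exists (Num.bound `|tnth x j|); exact: archi_boundP.
  have [N hN] := choice h.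
  exists (\max_(j < m) N j)%N => // j; rewrite /= in_itv /= -ltr_norml.
  by rewrite (lt_le_trans (hN j))// ler_nat leq_bigmax.
have [k hk] : exists k, (\int[lam]_(x in ~` C k) (f x)%:E <= (e / 2)%:E)%E.
  have mfE : measurable_fun setT (EFin \o f) by exact/measurable_EFinP.
  have I0 (A : set T) : (0 <= \int[lam]_(x in A) (f x)%:E)%E.
    by apply: integral_ge0 => x _; rewrite lee_fin.
  have Isplit k : (\int[lam]_x (f x)%:E =
      \int[lam]_(x in C k) (f x)%:E + \int[lam]_(x in ~` C k) (f x)%:E)%E.
    rewrite -ge0_integral_setU ?setUv//.
    - exact: measurableC.
    - by move=> x _; rewrite lee_fin.
    - by apply/disj_setPS => x [].
  have := @ge0_nondecreasing_set_cvg_integral _ _ _ C (EFin \o f) lam ndC mC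
    (fun k => measurable_funTS mfE) (fun i x _ => f0 x).
  rewrite CT -[X in _ --> X]fineK; last by rewrite ge0_fin_numE.
  move=> /fine_cvgP[_ /cvgrPdist_le /(_ _ (divr_gt0 e0 (ltr0Sn R 1)))[k _ /(_ k (leqnn k)) h]].
  exists k; move: h => /=; move: fi (I0 (C k)) (I0 (~` C k)); rewrite (Isplit k).
  move: (\int[lam]_(x in C k) _)%E (\int[lam]_(x in ~` C k) _)%E => [a| |] [a'| |] //=.
  by rewrite !lee_fin => _ a0 a'0; rewrite addrAC subrr add0r ger0_norm.
have lC : (0 <= fine (lam (C k))) by rewrite fine_ge0.
have lCE : lam (C k) = (fine (lam (C k)))%:E.
  by rewrite fineK// ge0_fin_numE//; exact: lebesgue_open_box_lty.
(* M <= n keeps the values of f in the range where [stair n] is accurate to 1 / n; the last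
   condition makes this error integrate to at most e / 2 over the cube. *)
have [n [n0 Mn Cn]] : exists n, [/\ (0 < n)%N, M <= n%:R &
    n%:R^-1 * fine (lam (C k)) <= e / 2].
  exists (Num.bound (`|M| + fine (lam (C k)) / (e / 2))).+1.
  have := @archi_boundP _ (`|M| + fine (lam (C k)) / (e / 2)).
  set b := Num.bound _ => /(_ _)/ltW bb.
  have q0 : 0 <= fine (lam (C k)) / (e / 2) by apply: divr_ge0 => //; rewrite divr_ge0// ltW.
  have {}bb : `|M| + fine (lam (C k)) / (e / 2) <= b.+1%:R.
    by rewrite (le_trans (bb _)) ?addr_ge0// ler_nat.
  split => //.
    by apply: le_trans bb; rewrite (le_trans (ler_norm _))// lerDl.
  rewrite mulrC ler_pdivrMr ?ltr0n// mulrC -ler_pdivrMr ?divr_gt0//.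
  by apply: le_trans bb; rewrite lerDr.
pose h (x : T) : R := - n%:R * \1_(C k) x + n%:R^-1 *
  \sum_(j < 2 * n ^ 2) \1_([set x | - n%:R + j%:R / n%:R < f x] `&` C k) x.
have mj (j : 'I_(2 * n ^ 2)) : measurable [set x | - n%:R + j%:R / n%:R < f x].
  rewrite -[X in measurable X]setTI (_ : [set x | _] = f @^-1` `]- n%:R + j%:R / n%:R, +oo[%classic).
    exact: mf.
  by apply/seteqP; split => x /=; rewrite in_itv /= andbT.
have mS : measurable_fun setT (fun x => \sum_(j < 2 * n ^ 2)
    \1_([set x | - n%:R + j%:R / n%:R < f x] `&` C k) x : R).
  apply: measurable_sum => j; apply: measurable_indic.
  by apply: measurableI => //; exact: mj.
have mh : measurable_fun setT h.
  apply: measurable_funD; apply: measurable_funM => //; exact: measurable_indic.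
exists h; split => //.
  apply: small_osc_D.
  - by apply: measurable_funM => //; exact: measurable_indic.
  - exact: measurable_funM.
  - apply: small_osc_scale; first exact: measurable_indic.
    exact: small_osc_open_box.
  - apply: small_osc_scale => //; apply: small_osc_sum => j.
      by apply: measurable_indic; apply: measurableI => //; exact: mj.
    by apply: small_osc_indic; exact: mj.
have hC x : C k x -> h x = stair n (f x).
  move=> Cx; rewrite /h /stair indicE mem_set// mulr1; congr (_ + _ * _).
  apply: eq_bigr => j _; rewrite indicE in_setI (mem_set Cx) andbT; congr (nat_of_bool _)%:R.
  by apply/idP/idP; rewrite inE.
have hNC x : ~ C k x -> h x = 0.
  move=> Cx; rewrite /h indicE memNset// mulr0 add0r big1 ?mulr0// => j _.
  by rewrite indicE in_setI (memNset Cx) andbF.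
have -> : e%:E = (e / 2)%:E + (e / 2)%:E :> \bar R by rewrite -EFinD -splitr.
rewrite (_ : \int[lam]_x _ = \int[lam]_(x in C k) `|f x - h x|%:E
  + \int[lam]_(x in ~` C k) `|f x - h x|%:E)%E; last first.
  rewrite -ge0_integral_setU ?setUv//.
  - exact: measurableC.
  - apply/measurable_EFinP; apply: measurableT_comp => //; exact: measurable_funB.
  - by apply/disj_setPS => x [].
rewrite leeD//; last first.
  rewrite (eq_integral (EFin \o f))// => x; rewrite inE => Cx.
  by rewrite hNC// subr0 ger0_norm.
apply: (@le_trans _ _ (\int[lam]_(x in C k) (cst n%:R^-1%:E) x)%E).
  apply: ge0_le_integral => //.
  - apply: measurable_funTS; apply/measurable_EFinP; apply: measurableT_comp => //.
    exact: measurable_funB.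
  - move=> x Cx; rewrite lee_fin hC//; apply: stair_near => //.
    by have /andP[f0x fM] := f0M x; rewrite ger0_norm// (le_trans fM).
rewrite integral_cst// [X in (_ * X)%E](_ : _ = (fine (lam (C k)))%:E); last exact: lCE.
by rewrite -EFinM lee_fin.
Qed.

End small_osc_density.

(** * Poisson and Gamma laws *)

Section poisson_tail.
Context (R : realType).
Implicit Types t x p : R.

(** As a function of a this is the Poisson law of mean t; as a function of t > 0 it is the density
    of the Gamma law of shape a + 1. Both readings are used. *)
Definition poisson_mass (a : nat) t : R := expR (- t) * (t ^+ a / a`!%:R).

Fixpoint poisson_lt (a : nat) t : R :=
  if a is a'.+1 then poisson_lt a' t + poisson_mass a' t else 0.

Lemma is_derive_expRN t : is_derive t (1 : R) (fun x => expR (- x)) (- expR (- t)).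
Proof.
have := is_derive1_comp (is_derive_expR (- t)) (is_deriveN (is_derive_id t (1 : R))).
by rewrite mulrN1.
Qed.

Lemma is_derive_poisson_massS a t :
  is_derive t (1 : R) (poisson_mass a.+1) (poisson_mass a t - poisson_mass a.+1 t).
Proof.
have h1 : is_derive t (1 : R) (fun x : R => x ^+ a.+1) (a.+1%:R * t ^+ a).
  have := is_deriveX a.+1 (is_derive_id t (1 : R)).
  rewrite /GRing.scale /= mulr1 (_ : (id : R -> R) ^+ a.+1 = (fun x => x ^+ a.+1))//.
  by elim: (a.+1) => [|n IHn]; apply/funext => x; rewrite ?expr0// !exprS IHn.
have h2 : is_derive t (1 : R) (fun x : R => x ^+ a.+1 / a.+1`!%:R) (t ^+ a / a`!%:R).
  have := is_deriveM h1 (is_derive_cst (a.+1`!%:R^-1 : R) t 1).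
  rewrite /GRing.scale /= mulr0 add0r => h; apply: (is_derive_eq h).
  rewrite factS natrM invfM; field.
  by rewrite nat1r !pnatr_eq0 -lt0n fact_gt0.
have h := is_deriveM (is_derive_expRN t) h2.
apply: (is_derive_eq h); rewrite /poisson_mass /GRing.scale /=; ring.
Qed.

Lemma is_derive_poisson_mass0 t :
  is_derive t (1 : R) (poisson_mass 0) (- poisson_mass 0 t).
Proof.
rewrite (_ : poisson_mass 0 = (fun x => expR (- x))).
  exact: is_derive_expRN.
by apply/funext => x; rewrite /poisson_mass expr0 fact0 divr1 mulr1.
Qed.

(** The derivatives of the successive masses telescope. This makes [poisson_lt a.+1] the tail
    function of the Gamma density [poisson_mass a]. *)
Lemma is_derive_poisson_lt a t :
  is_derive t (1 : R) (poisson_lt a.+1) (- poisson_mass a t).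
Proof.
elim: a => [|a IH].
  rewrite (_ : poisson_lt 1 = poisson_mass 0); first exact: is_derive_poisson_mass0.
  by apply/funext => x /=; rewrite add0r.
have := is_deriveD IH (is_derive_poisson_massS a t).
by rewrite addrA addNr add0r.
Qed.

Lemma mean_value (f df : R -> R) a b : a <= b ->
  (forall x, is_derive x (1 : R) f (df x)) ->
  exists2 c, a <= c <= b & f b - f a = df c * (b - a).
Proof.
move=> ab der; have [|c] := @MVT_segment R f df a b ab.
  by apply: derivable_within_continuous => x _; exact: ex_derive.
by rewrite in_itv /= => ? ?; exists c.
Qed.

Lemma poisson_mass_itv a t : 0 <= t -> 0 <= poisson_mass a t <= 1.
Proof.
move=> t0; rewrite /poisson_mass mulr_ge0 ?expR_ge0//=; last first.
  by rewrite divr_ge0 ?exprn_ge0.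
rewrite expRN mulrC ler_pdivrMr ?expR_gt0// mul1r.
case: a => [|a]; first by rewrite expr0 fact0 divr1 -expR0 ler_expR.
by apply: le_trans (expR_ge1Dxn a t0); rewrite lerDr.
Qed.

Lemma poisson_lt_ge0 a t : 0 <= t -> 0 <= poisson_lt a t.
Proof.
move=> t0; elim: a => //= a IH; rewrite addr_ge0//.
by case/andP: (poisson_mass_itv a t0).
Qed.

Lemma poisson_ltS0 a : poisson_lt a.+1 0 = 1.
Proof.
elim: a => [|a IH].
  by rewrite /= /poisson_mass oppr0 expR0 expr0 fact0 divr1 mul1r add0r.
by rewrite [LHS]/= -/(poisson_lt a.+1 0) IH /poisson_mass expr0n /= mul0r mulr0 addr0.
Qed.

Lemma poisson_lt_le1 a t : 0 <= t -> poisson_lt a t <= 1.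
Proof.
case: a => [_|a t0]; first exact: ler01.
have [c /andP[c0 _]] := mean_value t0 (is_derive_poisson_lt a).
rewrite poisson_ltS0 subr0 => h; rewrite -subr_le0 h mulNr oppr_le0 mulr_ge0//.
by case/andP: (poisson_mass_itv a c0).
Qed.

Let lip (f df : R -> R) s t : (forall x, is_derive x (1 : R) f (df x)) ->
  (forall x, 0 <= x -> `|df x| <= 1) -> 0 <= s -> 0 <= t ->
  `|f s - f t| <= `|s - t|.
Proof.
move=> der df1; wlog st : s t / t <= s.
  move=> h s0 t0; have [ts|st] := leP t s; first exact: h.
  by rewrite distrC (distrC s); apply: h => //; exact: ltW.
move=> s0 t0; have [c /andP[c0 _] ->] := mean_value st der.
by rewrite normrM ler_piMl// df1// (le_trans t0).
Qed.

Lemma poisson_lt_lipschitz a s t : 0 <= s -> 0 <= t ->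
  `|poisson_lt a s - poisson_lt a t| <= `|s - t|.
Proof.
case: a => [|a]; first by rewrite /= subrr normr0.
apply: lip (is_derive_poisson_lt a) _ => x x0.
by have /andP[q0 q1] := poisson_mass_itv a x0; rewrite normrN ger0_norm.
Qed.

Let poisson_mass_lipschitz a s t : 0 <= s -> 0 <= t ->
  `|poisson_mass a s - poisson_mass a t| <= `|s - t|.
Proof.
case: a => [|a].
  apply: lip is_derive_poisson_mass0 _ => x x0.
  by have /andP[q0 q1] := poisson_mass_itv 0 x0; rewrite normrN ger0_norm.
apply: lip (is_derive_poisson_massS a) _ => x x0.
have := poisson_mass_itv a x0; have := poisson_mass_itv a.+1 x0.
by rewrite ler_norml => /andP[? ?] /andP[? ?]; apply/andP; split; lra.
Qed.

(** The derivative of [poisson_lt a.+1] equals [poisson_lt a - poisson_lt a.+1], so to first order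
    in p the step from t to t + p follows the recursion of [binlt]. The remainder is p times an
    increment of a 1-Lipschitz mass. *)
Let poisson_lt_taylor a t p : 0 <= t -> 0 <= p ->
  `|poisson_lt a.+1 (t + p) - (p * poisson_lt a t + (1 - p) * poisson_lt a.+1 t)| <= p ^+ 2.
Proof.
move=> t0 p0; have tp : t <= t + p by rewrite lerDl.
have [c /andP[tc cp]] := mean_value tp (is_derive_poisson_lt a).
rewrite [t + p - t]addrAC subrr add0r => h.
rewrite (_ : _ - _ = p * (poisson_mass a t - poisson_mass a c)); last first.
  have -> : poisson_lt a.+1 (t + p) = poisson_lt a.+1 t - poisson_mass a c * p.
    by rewrite -mulNr -h; ring.
  rewrite /=; ring.
rewrite normrM ger0_norm// expr2 ler_wpM2l//.
apply: (le_trans (poisson_mass_lipschitz a t0 (le_trans t0 tc))).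
by rewrite ler_norml; apply/andP; split; lra.
Qed.

(** Each trial takes a convex combination of the previous errors and adds p^2, by
    [poisson_lt_taylor]; n trials add n p^2. *)
Lemma binlt_poisson n a p : 0 <= p <= 1 ->
  `|binlt n a p - poisson_lt a (n%:R * p)| <= n%:R * p ^+ 2.
Proof.
move=> p01; have /andP[p0 p1] := p01; elim: n a => [|n IH] [|a].
- by rewrite /= subrr normr0 !mul0r.
- by rewrite mul0r poisson_ltS0 /= subrr normr0 mul0r.
- by rewrite /= subrr normr0 mulr_ge0// sqr_ge0.
have np0 : 0 <= n%:R * p by rewrite mulr_ge0.
have h := poisson_lt_taylor a np0 p0.
have -> : n.+1%:R * p = n%:R * p + p by rewrite -natr1 mulrDl mul1r.
rewrite binltSS; move: h (IH a) (IH a.+1).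
set x := poisson_lt a.+1 _; set y := poisson_lt a _; set z := poisson_lt a.+1 _.
set u := binlt n a p; set v := binlt n a.+1 p.
have -> : n.+1%:R * p ^+ 2 = n%:R * p ^+ 2 + p ^+ 2 by rewrite -natr1 mulrDl mul1r.
set N := n%:R * p ^+ 2.
rewrite !ler_norml => /andP[h1 h2] /andP[h3 h4] /andP[h5 h6].
have a1 : p * (u - y) <= p * N by rewrite ler_wpM2l.
have a2 : p * - N <= p * (u - y) by rewrite ler_wpM2l.
have a3 : (1 - p) * (v - z) <= (1 - p) * N by rewrite ler_wpM2l// subr_ge0.
have a4 : (1 - p) * - N <= (1 - p) * (v - z) by rewrite ler_wpM2l// subr_ge0.
apply/andP; split; lra.
Qed.

Lemma continuous_poisson_lt a : continuous (poisson_lt a).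
Proof.
case: a => [|a] t; first exact: cst_continuous.
by apply/differentiable_continuous/derivable1_diffP; apply: ex_derive; exact: is_derive_poisson_lt.
Qed.

Lemma continuous_poisson_mass a : continuous (poisson_mass a).
Proof.
case: a => [|a] t; apply/differentiable_continuous/derivable1_diffP; apply: ex_derive.
  exact: is_derive_poisson_mass0.
exact: is_derive_poisson_massS.
Qed.

Lemma measurable_poisson_lt a : measurable_fun setT (poisson_lt a).
Proof. by apply: continuous_measurable_fun; exact: continuous_poisson_lt. Qed.

Lemma measurable_poisson_mass a : measurable_fun setT (poisson_mass a).
Proof. by apply: continuous_measurable_fun; exact: continuous_poisson_mass. Qed.

(** For t > 0 the mass at a is (a + 1) / t times the mass at a + 1, which is at most 1. *)
Lemma cvg_poisson_mass a : poisson_mass a t @[t --> +oo%R] --> (0 : R).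
Proof.
apply: (@squeeze_cvgr _ _ _ _ (cst 0) (fun t => a.+1%:R * t^-1)).
- near=> t; have t0 : 0 < t by near: t; exact: nbhs_pinfty_gt.
  have /andP[-> _] := poisson_mass_itv a (ltW t0); rewrite /=.
  have /andP[_] := poisson_mass_itv a.+1 (ltW t0).
  rewrite (_ : poisson_mass a.+1 t = poisson_mass a t * t / a.+1%:R).
    by rewrite ler_pdivrMr ?ltr0n// mul1r -ler_pdivlMr.
  rewrite /poisson_mass factS natrM invfM exprSr; ring.
- exact: cvg_cst.
- rewrite -(mulr0 a.+1%:R); apply: cvgM; first exact: cvg_cst.
  by rewrite gtr0_cvgV0//; near=> x; near: x; exact: nbhs_pinfty_gt.
Unshelve. all: by end_near. Qed.

Lemma cvg_poisson_lt a : poisson_lt a t @[t --> +oo%R] --> (0 : R).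
Proof.
elim: a => [|a IH]; first exact: cvg_cst.
rewrite -[X in _ --> X](addr0 0); apply: cvgD IH _; exact: cvg_poisson_mass.
Qed.

Lemma integral_poisson_mass a l : 0 <= l ->
  (\int[lebesgue_measure]_(t in `[l, +oo[) (poisson_mass a t)%:E =
   (poisson_lt a.+1 l)%:E)%E.
Proof.
move=> l0; have der x : is_derive x (1 : R) (fun t => - poisson_lt a.+1 t) (poisson_mass a x).
  by have := is_deriveN (is_derive_poisson_lt a x); rewrite opprK.
rewrite (@ge0_continuous_FTC2y _ _ (fun t => - poisson_lt a.+1 t) _ 0).
- by rewrite EFinN oppeK add0e.
- by move=> x lx; have /andP[] := poisson_mass_itv a (le_trans l0 lx).
- by apply: continuous_subspaceT; exact: continuous_poisson_mass.
- by rewrite -[X in _ --> X]oppr0; apply: cvgN; exact: cvg_poisson_lt.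
- by move=> x _; apply: ex_derive.
- by apply: cvg_at_right_filter; apply: cvgN; exact: continuous_poisson_lt.
- by move=> x _; rewrite derive1E derive_val.
Qed.
End poisson_tail.

(** * The digamma function at positive integers *)

Section gamma_law.
Context (R : realType).
Local Notation lebesgue := (@lebesgue_measure R).
Local Notation D := (`]0%R, +oo[%classic : set (measurableTypeR R)).

(** Twice this function dominates 1 + |ln t| times the integrand of Gamma at every exponent within
    1/4 of a + 1. For t < 1 the power is at most t^(-1/4) and the logarithm costs a second factor
    t^(-1/4); for t >= 1 both are absorbed by t^(a + 1). The absolute value keeps the second summand
    nonnegative on the whole line. *)
Let dom (a : nat) (t : R) : R :=
  4 * (t `^ (- 2^-1) * \1_(`]0%R, 1%R[%classic) t) + a.+1`!%:R * poisson_mass a.+1 `|t|.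

(** The singularity at 0 is approached by the intervals [1 / (n + 2), 1], on which the primitive 2
    sqrt t bounds the integral by 2. *)
Let integrable_invsqrt : (\int[lebesgue]_(t in `]0%R, 1%R[%classic) (t `^ (- 2^-1))%:E < +oo)%E.
Proof.
pose g (t : R) := t `^ (- 2^-1).
pose F (n : nat) : set (measurableTypeR R) := `[n.+2%:R^-1, 1]%classic.
have mF n : measurable (F n) by exact: measurable_itv.
have ndF : nondecreasing_seq F.
  move=> i j ij; apply/subsetPset => x; rewrite /F /= !in_itv /= => /andP[h ->].
  by rewrite andbT (le_trans _ h)// lef_pV2 ?posrE// ler_nat !ltnS.
have mf : measurable_fun setT (fun t : R => (g t)%:E).
  by apply/measurable_EFinP; exact: measurable_powR.
have f0 i x : F i x -> (0 <= (g x)%:E)%E by rewrite lee_fin powR_ge0.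
have h := @ge0_nondecreasing_set_cvg_integral _ _ _ F (fun t : R => (g t)%:E)
  lebesgue ndF mF (fun k => measurable_funTS mf) f0.
apply: (@le_lt_trans _ _ (2%:E)); last exact: ltry.
apply: (@le_trans _ _ (\int[lebesgue]_(t in \bigcup_n F n) (g t)%:E)%E).
  apply: ge0_subset_integral => //.
  - exact: bigcup_measurable.
  - exact: measurable_funTS.
  - by move=> x _; rewrite lee_fin powR_ge0.
  move=> x; rewrite /= in_itv /= => /andP[x0 x1].
  have [n hn] := ltr_add_invr x0; exists n => //; rewrite /F /= in_itv /= (ltW x1) andbT.
  rewrite add0r in hn; apply: le_trans (ltW hn).
  by rewrite lef_pV2 ?posrE// ler_nat.
rewrite -(cvg_lim _ h)//; apply: lime_le; first exact: cvgP h.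
apply: nearW => n.
have n0 : 0 < n.+2%:R^-1 :> R by rewrite invr_gt0.
have n1 : n.+2%:R^-1 < 1 :> R by rewrite invf_lt1// ltr1n.
have der (x : R) : 0 < x -> is_derive x (1 : R) (fun t : R => 2 * t `^ 2^-1) (g x).
  move=> x0; have h2 := is_deriveZ 2 (is_derive1_powR 2^-1 x0).
  apply: (is_derive_eq h2).
  rewrite /GRing.scale /= mulrA mulfV ?mul1r// /g; congr (_ `^ _); lra.
have cont (x : R) : 0 < x -> {for x, continuous (fun t : R => 2 * t `^ 2^-1)}.
  move=> x0; have hx := der x x0.
  by apply/differentiable_continuous/derivable1_diffP; apply: ex_derive.
rewrite (@continuous_FTC2 _ g (fun t : R => 2 * t `^ 2^-1))//.
- by rewrite powR1 mulr1 -EFinB lee_fin lerBlDr lerDl mulr_ge0// powR_ge0.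
- apply: derivable_within_continuous => x; rewrite in_itv /= => /andP[x0 _].
  have hx := is_derive1_powR (- 2^-1) (lt_le_trans n0 x0).
  exact: ex_derive.
- split.
  + move=> x; rewrite in_itv /= => /andP[x0 _].
    have hx := der x (lt_trans n0 x0); exact: ex_derive.
  + by apply: cvg_at_right_filter; exact: cont.
  + by apply: cvg_at_left_filter; exact: cont.
- move=> x; rewrite in_itv /= => /andP[x0 _].
  have hx := der x (lt_trans n0 x0).
  by rewrite derive1E derive_val.
Qed.

Let mass_ge0 a (t : R) : 0 <= poisson_mass a `|t|.
Proof. by case/andP: (poisson_mass_itv a (normr_ge0 t)). Qed.

Let dom_ge0 a t : 0 <= dom a t.
Proof. by rewrite /dom addr_ge0 ?mulr_ge0 ?powR_ge0. Qed.

Let measurable_invsqrt : measurable_fun setT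
  (fun t : R => (t `^ (- 2^-1) * \1_(`]0%R, 1%R[%classic) t)%:E).
Proof.
apply/measurable_EFinP; apply: measurable_funM; first exact: measurable_powR.
exact: measurable_indic.
Qed.

Let measurable_mass a : measurable_fun setT (fun t : R => (poisson_mass a `|t|)%:E).
Proof.
apply/measurable_EFinP; apply: measurableT_comp; first exact: measurable_poisson_mass.
exact: normr_measurable.
Qed.

Lemma integral_poisson_mass_oy a :
  (\int[lebesgue]_(t in D) (poisson_mass a t)%:E = 1)%E.
Proof.
rewrite integral_itv_obnd_cbnd; first by rewrite integral_poisson_mass// poisson_ltS0.
by apply: measurable_funTS; apply/measurable_EFinP; exact: measurable_poisson_mass.
Qed.

Let integrable_dom a : lebesgue.-integrable D (EFin \o dom a).
Proof.
apply: (@integrableD _ _ _ lebesgue D _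
  (fun t => (4 * (t `^ (- 2^-1) * \1_(`]0%R, 1%R[%classic) t))%:E)
  (fun t => (a.+1`!%:R * poisson_mass a.+1 `|t|)%:E)) => //.
  suff h : lebesgue.-integrable D (fun t => (t `^ (- 2^-1) * \1_(`]0%R, 1%R[%classic) t)%:E).
    exact: (integrableZl _ 4 h).
  apply/integrableP; split; first exact: measurable_funTS.
  apply: le_lt_trans integrable_invsqrt; rewrite [leRHS]integral_mkcond.
  rewrite [leLHS]integral_mkcond; apply: ge0_le_integral => //.
  - by move=> t _; apply: erestrict_ge0.
  - apply/(measurable_restrictT _ _).1 => //; apply: measurable_funTS.
    exact: measurableT_comp.
  - apply/(measurable_restrictT _ _).1 => //; apply: measurable_funTS.
    by apply/measurable_EFinP; exact: measurable_powR.
  move=> t _; rewrite !patchE indicE.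
  case: (t \in `]0, 1[%classic).
    by case: ifP => _; rewrite /= ?mulr1 lee_fin ?ger0_norm ?powR_ge0.
  by rewrite mulr0 /= normr0; case: ifP.
suff h : lebesgue.-integrable D (fun t => (poisson_mass a.+1 `|t|)%:E).
  exact: (integrableZl _ (a.+1`!%:R) h).
apply/integrableP; split; first by apply: measurable_funTS; exact: measurable_mass.
apply: (@le_lt_trans _ _ (\int[lebesgue]_(t in D) (poisson_mass a.+1 t)%:E)%E); last first.
  by rewrite integral_poisson_mass_oy ltry.
rewrite le_eqVlt; apply/orP; left; apply/eqP; apply: eq_integral => t; rewrite inE /= in_itv /= andbT => t0; rewrite (ger0_norm (mass_ge0 _ _)).
by rewrite gtr0_norm.
Qed.

(** With u = t^(-1/4) one has |ln t| = 4 ln u and ln u <= u - 1. *)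
Let ln_le_powR (t : R) : 0 < t -> t < 1 -> `|ln t| <= 4 * t `^ (- 4^-1).
Proof.
move=> t0 t1; have s0 : 0 < t `^ (- 4^-1) by exact: powR_gt0.
have -> : `|ln t| = 4 * ln (t `^ (- 4^-1)).
  by rewrite ln_powR ler0_norm ?ln_le0// ?(ltW t1)//; field.
rewrite ler_pM2l//; have := @le_ln1Dx R (t `^ (- 4^-1) - 1).
rewrite [1 + _]addrC subrK; lra.
Qed.

Let powR_le_dom a (x t : R) : 0 < t -> a.+1%:R - 4^-1 < x < a.+1%:R + 4^-1 ->
  (1 + `|ln t|) * (t `^ (x - 1) * expR (- t)) <= 2 * dom a t.
Proof.
move=> t0 /andP[x1 x2]; have xa : a%:R - 4^-1 < x - 1 < a%:R + 4^-1.
  by move: x1 x2; rewrite -natr1; lra.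
have e1 : expR (- t) <= 1 by rewrite -expR0 ler_expR; lra.
have [t1|t1] := ltP t 1.
  have p1 : t `^ (x - 1) <= t `^ (- 4^-1).
    rewrite -(ler_ln)?posrE ?powR_gt0// !ln_powR.
    have l0 : ln t <= 0 by rewrite ln_le0// ltW.
    have a0 : 0 <= a%:R :> R by [].
    by rewrite ler_wnM2r//; lra.
  have p2 : 1 <= t `^ (- 4^-1).
    rewrite -[leLHS](powRr0 t) -ler_ln ?posrE ?powR_gt0// !ln_powR mul0r.
    have l0 : ln t <= 0 by rewrite ln_le0// ltW.
    nra.
  have p3 := ln_le_powR t0 t1.
  have p4 : t `^ (- 2^-1) = t `^ (- 4^-1) * t `^ (- 4^-1).
    by rewrite -powRD ?(gt_eqF t0) ?implybT//; congr (_ `^ _); lra.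
  have p5 : 0 <= t `^ (x - 1) by exact: powR_ge0.
  rewrite /dom indicE mem_set ?mulr1; last by rewrite /= in_itv /= t0.
  have m0 : 0 <= a.+1`!%:R * poisson_mass a.+1 `|t| by rewrite mulr_ge0.
  rewrite p4; move: p1 p2 p3 p5; set u := t `^ (- 4^-1); set v := t `^ (x - 1) => p1 p2 p3 p5.
  apply: (@le_trans _ _ ((1 + `|ln t|) * v)).
    by rewrite ler_wpM2l ?addr_ge0// ler_piMr.
  apply: (@le_trans _ _ ((u + 4 * u) * u)).
    by apply: ler_pM => //; exact: lerD.
  nra.
have t0' : t != 0 by rewrite gt_eqF.
(* The exponent x - 1 stays below a + 1/4, so a factor t^(3/4) of t^(a + 1) is left to absorb the
   logarithm. *)
set u := t `^ (3 / 4).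
have u1 : 1 <= u by rewrite -[leLHS](powRr0 t) ler_powR// divr_ge0.
have lu : 1 + `|ln t| <= 2 * u.
  rewrite ger0_norm ?ln_ge0//.
  have -> : ln t = 4 / 3 * ln u by rewrite /u ln_powR; field.
  have := @le_ln1Dx R (u - 1); rewrite [1 + _]addrC subrK.
  by move=> /(_ _)h; have := h ltac:(lra); lra.
have tu : t ^+ a.+1 = u * t `^ (a%:R + 4^-1).
  by rewrite -powR_mulrn ?(ltW t0)// /u -powRD ?t0' ?implybT// -natr1; congr (_ `^ _); lra.
have xu : t `^ (x - 1) <= t `^ (a%:R + 4^-1) by apply: ler_powR => //; lra.
have mE : a.+1`!%:R * poisson_mass a.+1 `|t| = expR (- t) * t ^+ a.+1.
  rewrite gtr0_norm// /poisson_mass; field.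
  by rewrite pnatr_eq0 -lt0n fact_gt0.
apply: (@le_trans _ _ (2 * (a.+1`!%:R * poisson_mass a.+1 `|t|))).
  rewrite mE tu; have e0 := expR_ge0 (- t); have v0 : 0 <= t `^ (x - 1) by exact: powR_ge0.
  rewrite [leRHS](_ : _ = 2 * u * (t `^ (a%:R + 4^-1) * expR (- t))); last by ring.
  by apply: ler_pM => //; rewrite ?mulr_ge0 ?addr_ge0// ler_wpM2r.
by rewrite ler_pM2l// /dom lerDr mulr_ge0// mulr_ge0 ?powR_ge0.
Qed.

Let gfun (x t : R) : R := t `^ (x - 1) * expR (- t).

Let measurable_gfun x : measurable_fun D (EFin \o gfun x).
Proof.
apply: measurable_funTS; apply/measurable_EFinP; apply: measurable_funM; first exact: measurable_powR.
apply: measurableT_comp; first exact: measurable_expR.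
exact: measurable_funN.
Qed.

Let integrable_2dom a : lebesgue.-integrable D (EFin \o (fun t => 2 * dom a t)).
Proof. exact: (integrableZl _ 2 (integrable_dom a)). Qed.

Let integrable_gfun a (x : R) : a.+1%:R - 4^-1 < x < a.+1%:R + 4^-1 ->
  lebesgue.-integrable D (EFin \o gfun x).
Proof.
move=> hx; apply: (le_integrable _ _ _ (integrable_2dom a)) => //.
move=> t; rewrite /= in_itv /= andbT => t0; rewrite lee_fin.
rewrite [X in X <= _]ger0_norm ?mulr_ge0 ?powR_ge0 ?expR_ge0//.
rewrite [leRHS]ger0_norm ?mulr_ge0//.
apply: le_trans (powR_le_dom t0 hx).
by rewrite ler_peMl ?mulr_ge0 ?powR_ge0 ?expR_ge0// lerDl.
Qed.

Let is_derive_gfun (x t : R) : 0 < t ->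
  is_derive x (1 : R) (gfun ^~ t) (ln t * gfun x t).
Proof.
move=> t0; pose h (y : R) : R := (y - 1) * ln t.
have hE : gfun ^~ t = (fun y => expR (- t) *: expR (h y)).
  by apply/funext => y; rewrite /gfun mulrC /powR gt_eqF.
have dh : is_derive x (1 : R) h (ln t).
  have h1 := is_deriveZ (ln t) (is_deriveD (is_derive_id x (1 : R)) (is_derive_cst (- 1 : R) x 1)).
  rewrite (_ : h = (ln t) \*: (id + cst (-1))); last first.
    by apply/funext => y; rewrite /h mulrC.
  by apply: (is_derive_eq h1); rewrite addr0 /GRing.scale /= mulr1.
have h2 := is_deriveZ (expR (- t)) (is_derive1_comp (is_derive_expR (h x)) dh).
rewrite hE; apply: (is_derive_eq h2).
rewrite /GRing.scale /= /gfun /h /powR gt_eqF//; ring.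
Qed.

Lemma Gamma_nat a : Gamma (a.+1%:R : R) = a`!%:R.
Proof.
rewrite /Gamma /Rintegral.
transitivity (fine (\int[lebesgue]_(t in D) (a`!%:R%:E * (poisson_mass a t)%:E))%E).
  congr fine; apply: eq_integral => t; rewrite inE /= in_itv /= andbT => t0.
  rewrite -natr1 addrK powR_mulrn ?(ltW t0)// -EFinM /poisson_mass; congr (_%:E).
  field; by rewrite pnatr_eq0 -lt0n fact_gt0.
rewrite ge0_integralZl_EFin//; last 2 first.
- by move=> t; rewrite /= in_itv /= andbT => /ltW/(poisson_mass_itv a)/andP[].
- by apply: measurable_funTS; apply/measurable_EFinP; exact: measurable_poisson_mass.
by rewrite integral_poisson_mass_oy mule1.
Qed.

Lemma integrable_ln_poisson_mass a :
  lebesgue.-integrable D (fun t : R => (ln t * poisson_mass a t)%:E).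
Proof.
suff h : lebesgue.-integrable D (fun t : R => (a`!%:R^-1 * (ln t * gfun a.+1%:R t))%:E).
  apply: eq_integrable h => // t; rewrite inE /= in_itv /= andbT => t0.
  rewrite /gfun -natr1 addrK powR_mulrn ?(ltW t0)// /poisson_mass; congr (_%:E).
  ring.
suff h : lebesgue.-integrable D (fun t : R => (ln t * gfun a.+1%:R t)%:E).
  exact: (integrableZl _ (a`!%:R^-1) h).
apply: (le_integrable _ _ _ (integrable_2dom a)) => //.
  apply/measurable_EFinP; apply: measurable_funM; first by apply: measurable_funTS; exact: measurable_ln.
  by apply/measurable_EFinP; exact: measurable_gfun.
move=> t; rewrite /= in_itv /= andbT => t0; rewrite lee_fin.
rewrite [leRHS]ger0_norm ?mulr_ge0// normrM [X in _ * X]ger0_norm; last first.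
  by rewrite mulr_ge0 ?powR_ge0 ?expR_ge0.
apply: (@le_trans _ _ ((1 + `|ln t|) * (t `^ (a.+1%:R - 1) * expR (- t)))).
  by rewrite ler_wpM2r ?mulr_ge0 ?powR_ge0 ?expR_ge0// lerDr.
by apply: powR_le_dom => //; apply/andP; split; lra.
Qed.

(** Differentiation under the integral sign on the interval of radius 1/4 about a + 1. Division by
    Gamma (a + 1) = a! turns the integrand into ln t times the Gamma density, so the right side is
    the mean of ln G. *)
Lemma digamma_nat a : digamma (a.+1%:R : R) =
  \int[lebesgue]_(t in D) (ln t * poisson_mass a t).
Proof.
rewrite /digamma Gamma_nat.
have Ia : (`]a.+1%:R - 4^-1, a.+1%:R + 4^-1[%classic : set R) a.+1%:R.
  by rewrite /= in_itv /=; apply/andP; split; lra.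
have -> : (@Gamma R)^`()%classic a.+1%:R = \int[lebesgue]_(t in D) partial1of2 gfun a.+1%:R t.
  apply: (@differentiation_under_integral R _ _ lebesgue gfun D _ _ _ _ Ia _ _ (fun t => 2 * dom a t)).
  - exact: measurable_itv.
  - by move=> x; rewrite /= in_itv /= => hx; exact: integrable_gfun hx.
  - move=> x t _; rewrite /= in_itv /= andbT => t0.
    by apply: ex_derive; exact: is_derive_gfun.
  - by move=> t; rewrite mulr_ge0.
  - exact: integrable_2dom.
  move=> x t; rewrite /= !in_itv /= andbT => hx t0.
  have := is_derive_gfun x t0; rewrite /partial1of2 derive1E => h.
  rewrite derive_val normrM [X in _ * X]ger0_norm; last by rewrite mulr_ge0 ?powR_ge0 ?expR_ge0.
  apply: le_trans (powR_le_dom t0 hx).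
  by rewrite ler_wpM2r ?mulr_ge0 ?powR_ge0 ?expR_ge0// lerDr.
rewrite mulrC -RintegralZl//; last first.
  apply: eq_integrable (integrableZl _ (a`!%:R) (integrable_ln_poisson_mass a)) => //.
  move=> t; rewrite inE /= in_itv /= andbT => t0.
  have := is_derive_gfun a.+1%:R t0; rewrite /partial1of2 derive1E => h.
  rewrite derive_val /gfun -natr1 addrK powR_mulrn ?(ltW t0)// /poisson_mass -EFinM; congr (_%:E).
  field; by rewrite pnatr_eq0 -lt0n fact_gt0.
apply: eq_Rintegral => t; rewrite inE /= in_itv /= andbT => t0.
have := is_derive_gfun a.+1%:R t0; rewrite /partial1of2 derive1E => h.
rewrite derive_val /gfun -natr1 addrK powR_mulrn ?(ltW t0)// /poisson_mass.
field; by rewrite pnatr_eq0 -lt0n fact_gt0.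
Qed.

End gamma_law.

(* Unlike [ge0_le_integral], no measurability is required. *)
Lemma integralT_le d (T : measurableType d) (R : realType)
    (mu : {measure set T -> \bar R}) (f g : T -> \bar R) :
  (forall x, 0 <= f x)%E -> (forall x, f x <= g x)%E ->
  (\int[mu]_x f x <= \int[mu]_x g x)%E.
Proof.
move=> f0 fg; rewrite !ge0_integralTE//; last by move=> x; exact: le_trans (fg x).
apply: le_ereal_sup => _ [h hf <-]; exists h => // x.
exact: le_trans (hf x) (fg x).
Qed.

Lemma integral_probability_cst d (T : measurableType d) (R : realType)
    (P : probability T R) (c : \bar R) : (\int[P]_w (cst c) w = c)%E.
Proof.
rewrite integral_cst// [X in (_ * X)%E](_ : _ = 1%E) ?mule1//.
exact: probability_setT.
Qed.

(** * Integration against a measure with a density *)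

Section integral_density.
Context d (T : measurableType d) (R : realType).
Variables (nu lam : {measure set T -> \bar R}) (f : T -> R).
Hypothesis mf : measurable_fun setT f.
Hypothesis f0 : forall x, 0 <= f x.
Hypothesis nuE : forall A, measurable A -> nu A = (\int[lam]_(x in A) (f x)%:E)%E.
Import HBNNSimple.

(** Approximation of g from below by simple functions, with monotone convergence on both sides. *)
Lemma integral_density (g : T -> \bar R) : measurable_fun setT g ->
  (forall x, (0 <= g x)%E) ->
  (\int[nu]_x g x = \int[lam]_x (g x * (f x)%:E))%E.
Proof.
move=> mg g0; pose h := nnsfun_approx measurableT mg.
have gE x : g x = limn (fun n => (h n x)%:E).
  by apply/esym/cvg_lim => //; exact: cvg_nnsfun_approx.
have ndh x : nondecreasing_seq (fun n => (h n x)%:E).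
  by move=> a b ab; rewrite lee_fin; exact/lefP/nd_nnsfun_approx.
transitivity (limn (fun n => \int[nu]_x (h n x)%:E))%E.
  under eq_integral do rewrite gE; apply: monotone_convergence => //.
  - by move=> n; apply/measurable_EFinP.
  - by move=> n x _; rewrite lee_fin.
transitivity (limn (fun n => \int[lam]_x ((h n x)%:E * (f x)%:E)))%E; last first.
  rewrite -monotone_convergence//.
  - apply: eq_integral => x _; apply/cvg_lim => //.
    by apply: cvgeZr => //; exact: cvg_nnsfun_approx.
  - by move=> n; apply: emeasurable_funM; exact/measurable_EFinP.
  - by move=> n x _; rewrite mule_ge0 ?lee_fin.
  - by move=> x _ a b ab; rewrite lee_wpmul2r ?lee_fin//; exact/lefP/nd_nnsfun_approx.
congr (limn _); apply/funext => n.
rewrite integralT_nnsfun sintegralE.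
under [RHS]eq_integral => x _.
  rewrite fimfunE -fsumEFin// ge0_mule_fsuml; last by move=> r; rewrite EFinM nnfun_muleindic_ge0.
  over.
rewrite ge0_integral_fsum//; last 2 first.
- move=> r; apply: emeasurable_funM; last exact/measurable_EFinP.
  by apply/measurable_EFinP; apply: measurable_funM => //; exact: measurable_indic.
- by move=> r x _; apply: mule_ge0; [rewrite EFinM nnfun_muleindic_ge0//|rewrite lee_fin].
apply: eq_fsbigr => r; rewrite inE => -[x0 _ <-].
under eq_integral do rewrite EFinM -muleA.
rewrite ge0_integralZl_EFin//; last 2 first.
- by move=> x _; rewrite mule_ge0 ?lee_fin.
- by apply: emeasurable_funM; apply/measurable_EFinP => //; exact: measurable_indic.
congr (_ * _)%E; rewrite nuE// [LHS]integral_mkcond; apply: eq_integral => x _.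
rewrite patchE indicE; case: ifP => _; by rewrite ?mul1e ?mul0e.
Qed.

End integral_density.

(** * Points with few near neighbours *)

Section knn_events.
Context (R : realType) d (Omega : measurableType d) (P : probability Omega R).
Context (m : nat).
Local Notation T := (m.-tuple R).
Variables (X : nat -> {RV P >-> T}) (mu : probability T R).
Hypothesis hlaw : forall i A, measurable A -> P (X i @^-1` A) = mu A.
Hypothesis hind : mutually_independent X.
Variable k : nat.
Implicit Types (s : seq nat) (r : R) (x y : T).

Definition ball_prob r x : R := fine (mu (cball x r)).

Lemma ball_probE r x : mu (cball x r) = (ball_prob r x)%:E.
Proof. by rewrite /ball_prob fineK// fin_num_measure//; exact: measurable_cball. Qed.

Lemma ball_prob_itv r x : 0 <= ball_prob r x <= 1.
Proof.
rewrite -!lee_fin -ball_probE measure_ge0/=; apply: probability_le1.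
exact: measurable_cball.
Qed.

Lemma measurable_ball_prob r : measurable_fun setT (ball_prob r).
Proof.
apply/measurable_EFinP; rewrite (_ : _ \o _ = mu \o xsection (nearby r)).
  by apply: measurable_fun_xsection; exact: measurable_nearby.
apply/funext => x /=; rewrite -ball_probE; congr (mu _).
by apply/seteqP; split => y; rewrite /xsection /= inE.
Qed.

(* The k-th nearest neighbour of [X i] among the [X l], [l] in [s], is at
   distance more than [r]. *)
Definition few_near i s r : set Omega :=
  [set w | (count (fun l => (edist (X i w) (X l w) <= r)%R) s < k)%N].

Lemma measurable_edistX i l r : measurable [set w | edist (X i w) (X l w) <= r].
Proof. by apply: measurable_fun_set_le; apply: measurable_edist_comp. Qed.

Lemma measurable_few_near i s r : measurable (few_near i s r).
Proof.
apply: (@measurable_count _ _ _ (fun l w => edist (X i w) (X l w) <= r)) => l.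
exact: measurable_edistX.
Qed.

Definition few_near_prob n r : R :=
  fine (\int[mu]_x (binlt n k (ball_prob r x))%:E)%E.

Lemma measurable_binlt_ball n r :
  measurable_fun setT (fun x => (binlt n k (ball_prob r x))%:E).
Proof. by apply/measurable_EFinP/measurable_binlt; exact: measurable_ball_prob. Qed.

Lemma integral_prob_fin (nu : probability T R) (g : T -> R) : measurable_fun setT g ->
  (forall x, 0 <= g x <= 1) ->
  (0 <= \int[nu]_x (g x)%:E <= 1)%E.
Proof.
move=> mg g01; rewrite integral_ge0/=; last first.
  by move=> x _; rewrite lee_fin; case/andP: (g01 x).
apply: (@le_trans _ _ (\int[nu]_x (cst 1%E) x)%E).
  apply: ge0_le_integral => //; last 2 first.
  - exact/measurable_EFinP.
  - by move=> x _; rewrite lee_fin; case/andP: (g01 x).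
  by move=> x _; rewrite lee_fin; case/andP: (g01 x).
by rewrite integral_probability_cst.
Qed.

Lemma few_near_probE n r :
  (\int[mu]_x (binlt n k (ball_prob r x))%:E = (few_near_prob n r)%:E)%E.
Proof.
rewrite /few_near_prob fineK//.
have /andP[h1 h2] := @integral_prob_fin mu (fun x => binlt n k (ball_prob r x))
  (measurable_binlt n k (measurable_ball_prob r)) (fun x => binlt_itv n k (ball_prob_itv r x)).
by rewrite ge0_fin_numE// (le_lt_trans h2) ?ltry.
Qed.

Lemma few_near_prob_itv n r : 0 <= few_near_prob n r <= 1.
Proof.
rewrite -!lee_fin -few_near_probE.
exact: (@integral_prob_fin mu (fun x => binlt n k (ball_prob r x))
  (measurable_binlt n k (measurable_ball_prob r)) (fun x => binlt_itv n k (ball_prob_itv r x))).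
Qed.

Let measurable_near_pred r x : measurable [set y | edist x y <= r].
Proof. exact: measurable_cball. Qed.

Lemma prob_few_near i s r : uniq (i :: s) ->
  P (few_near i s r) = (few_near_prob (size s) r)%:E.
Proof.
move=> uis.
have mE : measurable [set z : T * (size s).-tuple T |
    (count (fun y => (edist z.1 y <= r)%R) z.2 < k)%N].
  apply: (@measurable_count_tuple _ _ _ _ _ (fun (z : T * (size s).-tuple T) y => edist z.1 y <= r)) => //.
  apply: measurable_fun_set_le; apply: measurable_edist_comp => //.
  by apply: measurableT_comp.
have us : uniq s by case/andP: uis.
have := subsample_fubini hlaw hind uis mE.
rewrite (_ : mkset _ = few_near i s r); last first.
  by apply/seteqP; split => w; rewrite /few_near /= count_map.
move=> ->; rewrite -few_near_probE; apply: eq_integral => x _.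
rewrite -(prob_hits hlaw hind k us (measurable_near_pred r x)); congr (P _).
by apply/seteqP; split => w; rewrite /= count_map.
Qed.

Lemma prob_edist_le i j r : i != j ->
  P [set w | edist (X i w) (X j w) <= r] = (\int[mu]_x (ball_prob r x)%:E)%E.
Proof.
move=> ij; have uij : uniq [:: i; j] by rewrite /= inE ij.
have mE : measurable [set z : T * (size [:: j]).-tuple T |
    edist z.1 (tnth z.2 ord0) <= r].
  apply: measurable_fun_set_le; apply: measurable_edist_comp => //.
  by apply: (@measurableT_comp _ _ _ _ _ _ (fun t : 1.-tuple T => tnth t ord0)) => //; exact: measurable_tnth.
have := subsample_fubini hlaw hind uij mE.
rewrite [in LHS]/= => ->; apply: eq_integral => x _.
by rewrite -ball_probE -(hlaw j)//; exact: measurable_cball.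
Qed.

(** When the two points are more than 2r apart, their balls are disjoint and [prob_hits2] bounds the
    joint probability by a product, which is then integrated over both points. Closer pairs give the
    last integral. *)
Lemma prob_few_near2 i j s r : uniq [:: i, j & s] ->
  (P (few_near i s r `&` few_near j s r) <=
   (few_near_prob (size s) r ^+ 2)%:E + \int[mu]_x (ball_prob (2 * r) x)%:E)%E.
Proof.
move=> uijs; have us : uniq s by case/and3P: uijs.
have ij : i != j by move: uijs; rewrite /= inE negb_or => /andP[/andP[]].
pose near := [set w | edist (X i w) (X j w) <= 2 * r].
have mnear : measurable near by exact: measurable_edistX.
pose U := (T * (T * (size s).-tuple T))%type.
pose E1 := [set z : U | edist z.1 z.2.1 <= 2 * r].
pose E2 := [set z : U | (count (fun y => (edist z.1 y <= r)%R) z.2.2 < k)%N].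
pose E3 := [set z : U | (count (fun y => (edist z.2.1 y <= r)%R) z.2.2 < k)%N].
have m21 : measurable_fun setT (fun z : U => z.2.1) by apply: measurableT_comp.
have m22 : measurable_fun setT (fun z : U => z.2.2) by apply: measurableT_comp.
have mE1 : measurable E1.
  by apply: measurable_fun_set_le; apply: measurable_edist_comp.
have mE2 : measurable E2.
  apply: (@measurable_count_tuple _ _ _ _ _ (fun (z : U) y => edist z.1 y <= r)) => //.
  apply: measurable_fun_set_le; apply: measurable_edist_comp => //.
  by apply: measurableT_comp.
have mE3 : measurable E3.
  apply: (@measurable_count_tuple _ _ _ _ _ (fun (z : U) y => edist z.2.1 y <= r)) => //.
  apply: measurable_fun_set_le; apply: measurable_edist_comp => //.
  by apply: (measurableT_comp m21).
pose E := ~` E1 `&` (E2 `&` E3).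
have mE : measurable E by apply: measurableI; [exact: measurableC|exact: measurableI].
have EE w : E (X i w, (X j w, subsample X s w)) =
    (~` near `&` (few_near i s r `&` few_near j s r)) w.
  by rewrite /E /E1 /E2 /E3 /near /few_near /= !count_map.
rewrite -(setTI (_ `&` _)) -(setUv near) setIUl.
apply: (@le_trans _ _ (P (~` near `&` (few_near i s r `&` few_near j s r)) + P near)%E).
  rewrite addeC; apply: le_trans (measureU2 _ _ _) _; last first.
  - apply: leeD => //; apply: le_measure; rewrite ?inE//.
    by apply: measurableI => //; apply: measurableI; exact: measurable_few_near.
  - by apply: measurableI; [exact: measurableC|apply: measurableI; exact: measurable_few_near].
  - by apply: measurableI => //; apply: measurableI; exact: measurable_few_near.
rewrite leeD//; last by rewrite /near prob_edist_le.
have -> : ~` near `&` (few_near i s r `&` few_near j s r) =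
    [set w | E (X i w, (X j w, subsample X s w))].
  by apply/seteqP; split => w /=; rewrite EE.
rewrite (subsample_fubini2 hlaw hind uijs mE).
pose G x := binlt (size s) k (ball_prob r x).
have G0 x : 0 <= G x by case/andP: (binlt_itv (size s) k (ball_prob_itv r x)).
have mG : measurable_fun setT (EFin \o G) by exact: measurable_binlt_ball.
apply: (@le_trans _ _ (\int[mu]_x \int[mu]_y ((G x)%:E * (G y)%:E))%E); last first.
  under eq_integral => x _.
    rewrite ge0_integralZl_EFin//; last by move=> y _; rewrite lee_fin.
    rewrite few_near_probE muleC; over.
  rewrite ge0_integralZl_EFin//; last 2 first.
  - by move=> x _; rewrite lee_fin.
  - by case/andP: (few_near_prob_itv (size s) r).
  by rewrite few_near_probE -EFinM expr2.
apply: integralT_le => x; first by apply: integral_ge0 => y _; exact: measure_ge0.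
apply: integralT_le => y; first exact: measure_ge0.
have [xy|xy] := boolP (edist x y <= 2 * r).
  rewrite (_ : mkset _ = set0) ?measure0; first by rewrite -EFinM lee_fin mulr_ge0.
  by apply/seteqP; split => w // -[].
have dis z : edist x z <= r -> ~~ (edist y z <= r).
  move=> xz; apply: contra xy => yz; exact: edist_near xz yz.
have := prob_hits2 hlaw hind k k us (measurable_near_pred r x) (measurable_near_pred r y) dis.
apply: le_trans; apply: le_measure; rewrite ?inE.
- rewrite (_ : mkset _ = (fun w => (x, (y, subsample X s w))) @^-1` E)//.
  rewrite -[X in measurable X]setTI; apply: (_ : measurable_fun setT _) => //.
  by apply: measurable_fun_pair => //; apply: measurable_fun_pair.
- rewrite (_ : mkset _ = [set w | (hits X (fun z => (edist x z <= r)%R) s w < k)%N] `&`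
      [set w | (hits X (fun z => (edist y z <= r)%R) s w < k)%N]).
    by apply: measurableI; apply: measurable_hits; exact: measurable_near_pred.
  by apply/seteqP; split => w /=; [move/andP|case=> -> ->].
by move=> w [_ []]; rewrite /E2 /E3 /= !count_map => h1 h2; exact/andP.
Qed.

End knn_events.

(** The integrals of g and q are compared in the additive form g <= q + D, which stays meaningful
    when D has infinite integral. *)
Lemma integral_dist_le d (T : measurableType d) (R : realType)
    (mu : {measure set T -> \bar R}) (g q D : T -> R) (a b : R) :
  measurable_fun setT g -> measurable_fun setT q -> measurable_fun setT D ->
  (forall x, 0 <= g x) -> (forall x, 0 <= q x) ->
  (forall x, `|g x - q x| <= D x) ->
  (\int[mu]_x (g x)%:E)%E = a%:E -> (\int[mu]_x (q x)%:E)%E = b%:E ->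
  ((`|a - b|)%:E <= \int[mu]_x (D x)%:E)%E.
Proof.
move=> mg mq mD g0 q0 gqD ga qb.
have D0 x : 0 <= D x by apply: le_trans (gqD x).
have h (g1 q1 : T -> R) : measurable_fun setT q1 ->
    (forall x, 0 <= g1 x) -> (forall x, 0 <= q1 x) -> (forall x, g1 x <= q1 x + D x) ->
    (\int[mu]_x (g1 x)%:E <= \int[mu]_x (q1 x)%:E + \int[mu]_x (D x)%:E)%E.
  move=> mq1 g10 q10 gq; rewrite -ge0_integralD//; last 4 first.
  - by move=> x _; rewrite lee_fin.
  - exact/measurable_EFinP.
  - by move=> x _; rewrite lee_fin.
  - exact/measurable_EFinP.
  by apply: integralT_le => x; rewrite lee_fin.
have := h g q mq g0 q0; have := h q g mg q0 g0; rewrite ga qb.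
have : (0 <= \int[mu]_x (D x)%:E)%E by apply: integral_ge0 => x _; rewrite lee_fin.
case: (\int[mu]_x (D x)%:E)%E => [I||]//; last by move=> *; rewrite leey.
rewrite -!EFinD !lee_fin => _ h1 h2; rewrite ler_norml.
have h3 : b <= a + I by apply: h1 => x; have := gqD x; rewrite ler_norml; lra.
have h4 : a <= b + I by apply: h2 => x; have := gqD x; rewrite ler_norml; lra.
lra.
Qed.

(** * Convergence of the few-neighbours probability to its Poisson limit *)

Section few_near_limit.
Context (R : realType) (m : nat).
Local Notation T := (m.-tuple R).
Variables (mu : probability T R) (f : T -> R) (M : R) (k : nat).
Local Notation lam := (@lebesgue_tuple R m).
Variable V : R.
Hypothesis V0 : 0 < V.
Hypothesis lebesgueV : forall x r, 0 < r -> lam (cball x r) = (r ^+ m * V)%:E.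
Hypothesis mf : measurable_fun setT f.
Hypothesis f0M : forall x, 0 <= f x <= M.
Hypothesis muE : forall A, measurable A -> mu A = (\int[lam]_(x in A) (f x)%:E)%E.

Let f0 x : 0 <= f x. Proof. by case/andP: (f0M x). Qed.
Let M0 : 0 <= M.
Proof. by case/andP: (f0M [tuple 0 | i < m]) => h1; exact: le_trans. Qed.

Lemma measure_le_lebesgue A : measurable A -> (mu A <= M%:E * lam A)%E.
Proof.
move=> mA; rewrite muE// -integral_cst//; apply: ge0_le_integral => //.
- by move=> x _; rewrite lee_fin.
- by apply/measurable_EFinP; exact: measurable_funTS.
by move=> x _; rewrite lee_fin; case/andP: (f0M x).
Qed.

Lemma ball_prob_le r x : 0 < r -> ball_prob mu r x <= M * (r ^+ m * V).
Proof.
move=> r0; rewrite -lee_fin -ball_probE EFinM -(lebesgueV x r0).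
by apply: measure_le_lebesgue; exact: measurable_cball.
Qed.

Lemma integral_ball_prob_le r : 0 < r ->
  (\int[mu]_x (ball_prob mu r x)%:E <= (M * (r ^+ m * V))%:E)%E.
Proof.
move=> r0; apply: (@le_trans _ _ (\int[mu]_x (cst (M * (r ^+ m * V))%:E x))%E).
  apply: integralT_le => x; first by rewrite lee_fin; case/andP: (ball_prob_itv mu r x).
  by rewrite lee_fin ball_prob_le.
by rewrite integral_probability_cst.
Qed.

(** The difference inside the absolute value is the integral of f y - f x over the ball about x.
    Replacing the law by Lebesgue measure in the outer integral costs the factor M and leaves
    [osc]. *)
Lemma ball_prob_osc r : 0 < r ->
  (\int[mu]_x (`|ball_prob mu r x - r ^+ m * V * f x|)%:E <= M%:E * osc r f)%E.
Proof.
move=> r0; pose D (z : T * T) := \1_(nearby r) z * `|f z.2 - f z.1|.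
have mD : measurable_fun setT D.
  apply: measurable_funM; first by apply: measurable_indic; exact: measurable_nearby.
  by apply: measurableT_comp => //; apply: measurable_funB; exact: measurableT_comp.
have D0 z : 0 <= D z by rewrite /D mulr_ge0.
pose J x := (\int[lam]_y (D (x, y))%:E)%E.
have mJ : measurable_fun setT J.
  by apply: (@measurable_fun_fubini_tonelli_F _ _ _ _ _ lam (EFin \o D)) => //; apply/measurable_EFinP.
have oscE : osc r f = (\int[lam]_x J x)%E.
  rewrite /osc (@fubini_tonelli1 _ _ _ _ R lam lam (EFin \o D))//; exact/measurable_EFinP.
have mb : measurable_fun setT (fun x => (`|ball_prob mu r x - r ^+ m * V * f x|)%:E).
  apply/measurable_EFinP; apply: measurableT_comp => //; apply: measurable_funB.
    exact: measurable_ball_prob.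
  exact: measurable_funM.
rewrite (integral_density mf f0 muE)//.
rewrite oscE -ge0_integralZl_EFin//; last by move=> x _; apply: integral_ge0 => y _; rewrite lee_fin.
apply: integralT_le => x; first by rewrite mule_ge0 ?lee_fin.
rewrite muleC; apply: lee_pmul; rewrite ?lee_fin//; first by case/andP: (f0M x).
have mI : measurable_fun setT (fun y => \1_(cball x r) y : R).
  by apply: measurable_indic; exact: measurable_cball.
have IE y : \1_(cball x r) y = \1_(nearby r) (x, y) :> R.
  rewrite !indicE; have -> // : (y \in cball x r) = ((x, y) \in nearby r).
  by apply/idP/idP; rewrite !inE.
apply: (@integral_dist_le _ _ _ lam (fun y => \1_(cball x r) y * f y)
  (fun y => \1_(cball x r) y * f x) (fun y => D (x, y))).
- exact: measurable_funM.
- exact: measurable_funM.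
- by apply: (measurableT_comp mD); exact: measurable_pair1.
- by move=> y; rewrite mulr_ge0.
- by move=> y; rewrite mulr_ge0.
- by move=> y; rewrite -mulrBr normrM ger0_norm// IE /D.
- rewrite -ball_probE muE; last exact: measurable_cball.
  rewrite [RHS]integral_mkcond; apply: eq_integral => y _.
  by rewrite patchE indicE; case: ifP => _; rewrite ?mul1r ?mul0r.
under eq_integral do rewrite mulrC.
rewrite integral_cindic//; last exact: measurable_cball.
by rewrite [X in (_ * X)%E](lebesgueV x r0) -EFinM mulrC.
Qed.

(** Phi(y) of the overview is the value at c = exp (y + psi(k)). *)
Definition poisson_prob c : R := fine (\int[mu]_x (poisson_lt k (c * f x))%:E)%E.

Lemma measurable_poisson_density c : measurable_fun setT (fun x => poisson_lt k (c * f x)).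
Proof.
apply: (@measurableT_comp _ _ _ _ _ _ (@poisson_lt R k)); first exact: measurable_poisson_lt.
exact: measurable_funM.
Qed.

Lemma poisson_density_itv c x : 0 <= c -> 0 <= poisson_lt k (c * f x) <= 1.
Proof. by move=> c0; rewrite poisson_lt_ge0 ?poisson_lt_le1 ?mulr_ge0. Qed.

Lemma poisson_prob_itv c : 0 <= c -> 0 <= poisson_prob c <= 1.
Proof.
move=> c0; have /andP[h1 h2] := integral_prob_fin mu (measurable_poisson_density c)
  (fun x => poisson_density_itv x c0).
rewrite /poisson_prob -!lee_fin fineK ?h1//.
by rewrite ge0_fin_numE// (le_lt_trans h2) ?ltry.
Qed.

Lemma poisson_probE c : 0 <= c ->
  (\int[mu]_x (poisson_lt k (c * f x))%:E)%E = (poisson_prob c)%:E.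
Proof.
move=> c0; have /andP[h1 h2] := integral_prob_fin mu (measurable_poisson_density c)
  (fun x => poisson_density_itv x c0).
by rewrite /poisson_prob fineK// ge0_fin_numE// (le_lt_trans h2) ?ltry.
Qed.

(** Two errors: from binomial to Poisson, at most n p^2 with p <= M r^m V; and from the mean n p to
    n r^m V f x, where [poisson_lt] is 1-Lipschitz and [ball_prob_osc] applies. *)
Lemma few_near_prob_poisson n r : 0 < r ->
  ((`|few_near_prob mu k n r - poisson_prob (n%:R * (r ^+ m * V))|)%:E <=
   (n%:R * (M * (r ^+ m * V)) ^+ 2)%:E + (n%:R * M)%:E * osc r f)%E.
Proof.
move=> r0; set v := r ^+ m * V.
have v0 : 0 <= v by rewrite mulr_ge0 ?exprn_ge0 ?ltW.
have mp := measurable_ball_prob mu r.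
have p01 := ball_prob_itv mu r.
have c0 : 0 <= n%:R * v by rewrite mulr_ge0.
pose B x := `|ball_prob mu r x - v * f x|.
have mB : measurable_fun setT B.
  by apply: measurableT_comp => //; apply: measurable_funB => //; exact: measurable_funM.
pose D x := n%:R * (M * v) ^+ 2 + n%:R * B x.
have mD : measurable_fun setT D.
  by apply: measurable_funD => //; exact: measurable_funM.
apply: (@le_trans _ _ (\int[mu]_x (D x)%:E)%E).
  apply: integral_dist_le (few_near_probE mu k n r) (poisson_probE c0) => //.
  - by apply: measurable_binlt.
  - exact: measurable_poisson_density.
  - by move=> x; case/andP: (binlt_itv n k (p01 x)).
  - by move=> x; case/andP: (poisson_density_itv x c0).
  move=> x; apply: le_trans (ler_distD (poisson_lt k (n%:R * ball_prob mu r x)) _ _) _.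
  have /andP[p0 p1] := p01 x.
  apply: lerD.
    apply: le_trans (binlt_poisson n k (p01 x)) _.
    apply: ler_wpM2l => //; apply: lerXn2r; rewrite ?nnegrE//; last exact: ball_prob_le.
    exact: mulr_ge0.
  apply: le_trans (poisson_lt_lipschitz _ _ _) _; [exact: mulr_ge0|exact: mulr_ge0|].
  by rewrite -[n%:R * v * _]mulrA -mulrBr normrM ger0_norm.
under eq_integral do rewrite /D EFinD.
rewrite ge0_integralD//; last 3 first.
- by move=> x _; rewrite lee_fin mulr_ge0 ?sqr_ge0.
- by move=> x _; rewrite lee_fin; apply: mulr_ge0 => //; exact: normr_ge0.
- by apply/measurable_EFinP; exact: measurable_funM.
apply: leeD.
  by rewrite integral_probability_cst.
under eq_integral do rewrite EFinM.
rewrite ge0_integralZl_EFin//; last 2 first.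
- by move=> x _; rewrite lee_fin; exact: normr_ge0.
- exact/measurable_EFinP.
by rewrite EFinM -muleA; apply: lee_wpmul2l; rewrite ?lee_fin//; exact: ball_prob_osc.
Qed.

(* The radius is normalised so that a ball has volume c / n. *)
Lemma few_near_prob_cvg c e : (0 < m)%N -> 0 < c -> 0 < e -> exists n0, forall n r,
  (n0 <= n)%N -> 0 < r -> n%:R * (r ^+ m * V) = c ->
  `|few_near_prob mu k n r - poisson_prob c| <= e.
Proof.
move=> m0 c0 e0; have fint : (\int[lam]_x (f x)%:E < +oo)%E.
  by rewrite -muE// (le_lt_trans (probability_le1 mu measurableT)) ?ltry.
have osc0 := small_osc_bounded mf f0M fint.
(* With n r^m V = c this makes n M e1 r^m equal to (e / 2) M / (M + 1); M + 1 is positive even when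
   M is 0. *)
pose e1 := e * V / (2 * c * (M + 1)).
have M10 : 0 < M + 1 by rewrite ltr_wpDl.
have e10 : 0 < e1 by rewrite divr_gt0 ?mulr_gt0.
have [r0 r00 osc_le] := osc0 e1 e10.
(* The first threshold forces r <= r0, the second makes (c M)^2 / n at most e / 2, the third keeps n
   positive. *)
exists (maxn (Num.bound (c / (V * r0 ^+ m))) (maxn (Num.bound (2 * (c * M) ^+ 2 / e)) 1)).
move=> n r; rewrite !geq_max => /andP[n1 /andP[n2 n3]] rp nE.
have np : 0 < n%:R :> R by rewrite ltr0n.
have b1 : c / (V * r0 ^+ m) < n%:R.
  apply: lt_le_trans (archi_boundP _) _; last by rewrite ler_nat.
  by rewrite divr_ge0 ?mulr_ge0 ?exprn_ge0 ?ltW.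
have b2 : 2 * (c * M) ^+ 2 / e < n%:R.
  apply: lt_le_trans (archi_boundP _) _; last by rewrite ler_nat.
  by apply: divr_ge0; [apply: mulr_ge0; rewrite ?sqr_ge0|exact: ltW].
have rmE : r ^+ m = c / (n%:R * V) by rewrite -nE; field; rewrite !gt_eqF.
have rr0 : r <= r0.
  rewrite -(@ler_pXn2r _ m)// ?nnegrE; [|exact: ltW|exact: ltW].
  rewrite rmE ler_pdivrMr ?mulr_gt0//.
  move: b1; rewrite ltr_pdivrMr ?mulr_gt0 ?exprn_gt0// => /ltW.
  by rewrite mulrA [X in _ -> c <= X]mulrC.
have := few_near_prob_poisson n rp; rewrite nE -lee_fin => /le_trans; apply.
have rr : 0 < r <= r0 by rewrite rp.
apply: (@le_trans _ _ ((n%:R * (M * (r ^+ m * V)) ^+ 2)%:E + (n%:R * M)%:E * (e1 * r ^+ m)%:E)%E).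
  by apply: leeD => //; apply: lee_wpmul2l (osc_le _ rr); rewrite lee_fin mulr_ge0.
rewrite -EFinM -EFinD lee_fin.
have -> : n%:R * (M * (r ^+ m * V)) ^+ 2 = (c * M) ^+ 2 / n%:R.
  by rewrite rmE; field; rewrite !gt_eqF.
have -> : n%:R * M * (e1 * r ^+ m) = e / 2 * (M / (M + 1)).
  by rewrite rmE /e1; field; rewrite !gt_eqF.
have : (c * M) ^+ 2 / n%:R <= e / 2.
  rewrite ler_pdivrMr//; move: b2; rewrite ltr_pdivrMr// => h; lra.
have : M / (M + 1) <= 1 by rewrite ler_pdivrMr// mul1r lerDl.
have : 0 <= M / (M + 1) by apply: divr_ge0 => //; exact: ltW.
move=> h1 h2 h3; have := ltW e0; nra.
Qed.

(** Needed because one point is judged against N - 1 others, while two points treated jointly are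
    judged against N - 2. *)
Lemma few_near_prob_succ n r : 0 < r ->
  few_near_prob mu k n.+1 r <= few_near_prob mu k n r <=
  few_near_prob mu k n.+1 r + M * (r ^+ m * V).
Proof.
move=> rp; have p01 := ball_prob_itv mu r.
have b0 l x : (0 <= (binlt l k (ball_prob mu r x))%:E)%E.
  by rewrite lee_fin; case/andP: (binlt_itv l k (p01 x)).
rewrite -!lee_fin EFinD -!few_near_probE; apply/andP; split.
  by apply: integralT_le => x //; rewrite lee_fin binlt_leSn.
apply: le_trans (leeD (lexx _) (integral_ball_prob_le rp)).
rewrite -ge0_integralD//; last 3 first.
- exact: measurable_binlt_ball.
- by move=> x _; rewrite lee_fin; case/andP: (p01 x).
- by apply/measurable_EFinP; exact: measurable_ball_prob.
by apply: integralT_le => x //; rewrite lee_fin binlt_geSn.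
Qed.

Lemma few_near_prob_ge n r : (0 < k)%N -> 0 < r ->
  1 - few_near_prob mu k n r <= n%:R * (M * (r ^+ m * V)).
Proof.
move=> k0 rp; have p01 := ball_prob_itv mu r.
rewrite lerBlDr addrC -lee_fin EFinD -few_near_probE EFinM.
apply: (@le_trans _ _ (\int[mu]_x (binlt n k (ball_prob mu r x))%:E +
   n%:R%:E * \int[mu]_x (ball_prob mu r x)%:E)%E); last first.
  by apply: leeD => //; apply: lee_wpmul2l; rewrite ?lee_fin//; exact: integral_ball_prob_le.
have mb : measurable_fun setT (EFin \o ball_prob mu r).
  by apply/measurable_EFinP; exact: measurable_ball_prob.
rewrite -ge0_integralZl_EFin//; last by move=> x _; rewrite lee_fin; case/andP: (p01 x).
rewrite -ge0_integralD//; last 4 first.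
- by move=> x _; rewrite lee_fin; case/andP: (binlt_itv n k (p01 x)).
- exact: measurable_binlt_ball.
- by move=> x _; rewrite -EFinM lee_fin mulr_ge0//; case/andP: (p01 x).
- exact: measurable_funeM.
rewrite -(_ : \int[mu]_x (cst 1%E x) = 1)%E; last first.
  by rewrite integral_probability_cst.
apply: integralT_le => x //; rewrite -EFinM -EFinD lee_fin -lerBlDr.
by case: (k) k0 => // k' _; exact: binlt_ge.
Qed.

End few_near_limit.

(** * First and second moments of the fraction of lonely points *)

Section frac_near.
Context (R : realType) d (Omega : measurableType d) (P : probability Omega R).
Context (m : nat).
Local Notation T := (m.-tuple R).
Variables (X : nat -> {RV P >-> T}) (mu : probability T R).
Hypothesis hlaw : forall i A, measurable A -> P (X i @^-1` A) = mu A.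
Hypothesis hind : mutually_independent X.
Variable k : nat.
Implicit Types (N i j : nat) (r : R).

Definition others N i : seq nat := rem i (iota 0 N).

Lemma uniq_others N i : uniq (i :: others N i).
Proof. by rewrite /= /others mem_rem_uniq ?iota_uniq// inE eqxx rem_uniq ?iota_uniq. Qed.

Lemma size_others N i : (i < N)%N -> size (others N i) = N.-1.
Proof. by move=> iN; rewrite size_rem ?size_iota// mem_iota. Qed.

(** On samples without ties, and for the radius attached to y, this is the event that the i-th
    summand of the estimator exceeds y. *)
Definition lonely N r i : set Omega := few_near X k i (others N i) r.

Lemma measurable_lonely N r i : measurable (lonely N r i).
Proof. exact: measurable_few_near. Qed.

Lemma prob_lonely N r i : (i < N)%N ->
  P (lonely N r i) = (few_near_prob mu k N.-1 r)%:E.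
Proof.
move=> iN; rewrite /lonely (prob_few_near hlaw hind)// ?size_others//.
exact: uniq_others.
Qed.

(** Dropping i and j from the reference points can only lower both counts, hence enlarges both
    events and brings them into the form of [prob_few_near2]. *)
Lemma prob_lonely2 N r i j : (i < N)%N -> (j < N)%N -> i != j ->
  (P (lonely N r i `&` lonely N r j) <= (few_near_prob mu k N.-2 r ^+ 2)%:E +
     \int[mu]_x (ball_prob mu (2 * r) x)%:E)%E.
Proof.
move=> iN jN ij; pose s := rem j (others N i).
have jo : j \in others N i.
  by rewrite mem_rem_uniq ?iota_uniq// inE eq_sym ij mem_iota.
have uo : uniq (others N i) by have := uniq_others N i; case/andP.
have us : uniq [:: i, j & s].
  rewrite /= inE negb_or ij /s rem_uniq// andbT !mem_rem_uniq//.
  have := uniq_others N i; rewrite /= => /andP[ii _].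
  by rewrite !inE eqxx/= andbT negb_and ii orbT.
have ss : size s = N.-2 by rewrite size_rem// size_others.
rewrite -ss; apply: le_trans (prob_few_near2 hlaw hind k r us).
apply: le_measure; rewrite ?inE; try by apply: measurableI; exact: measurable_few_near.
have sub l w : l \in [:: i; j] -> lonely N r l w -> few_near X k l s r w.
  rewrite /lonely /few_near /= => lij; apply: leq_ltn_trans.
  rewrite -!size_filter; apply: uniq_leq_size; first by rewrite filter_uniq// rem_uniq.
  move=> a; rewrite !mem_filter => /andP[-> /=].
  rewrite /s mem_rem_uniq// inE /others => /andP[aj].
  rewrite !mem_rem_uniq ?iota_uniq// !inE => /andP[ai ->]; rewrite andbT.
  by move: lij; rewrite !inE => /orP[]/eqP->; rewrite ?aj ?ai.
by move=> w [wi wj]; split; apply: sub; rewrite ?inE ?eqxx ?orbT.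
Qed.

Definition lonely_frac N r w : R := N%:R^-1 * \sum_(i < N) \1_(lonely N r i) w.

Lemma measurable_lonely_frac N r : measurable_fun setT (lonely_frac N r).
Proof.
apply: measurable_funM => //; apply: measurable_sum => i.
by apply: measurable_indic; exact: measurable_lonely.
Qed.

Lemma lonely_frac_ge0 N r w : 0 <= lonely_frac N r w.
Proof. by rewrite mulr_ge0 ?invr_ge0// sumr_ge0. Qed.

Lemma integral_lonely_frac N r : (0 < N)%N ->
  (\int[P]_w (lonely_frac N r w)%:E)%E = (few_near_prob mu k N.-1 r)%:E.
Proof.
move=> N0; under eq_integral do rewrite EFinM.
rewrite ge0_integralZl_EFin//; last 2 first.
- by move=> w _; rewrite lee_fin sumr_ge0.
- apply/measurable_EFinP; apply: measurable_sum => i.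
  by apply: measurable_indic; exact: measurable_lonely.
under eq_integral do rewrite -sumEFin.
rewrite ge0_integral_sum//; last first.
- by move=> i; apply/measurable_EFinP/measurable_indic; exact: measurable_lonely.
rewrite (eq_bigr (fun=> (few_near_prob mu k N.-1 r)%:E)); last first.
  move=> i _; rewrite integral_indic//; last exact: measurable_lonely.
  by rewrite setIT; exact: prob_lonely.
rewrite sumEFin sumr_const card_ord -EFinM -[X in _ * X]mulr_natl mulrA.
by rewrite mulVf ?mul1r// pnatr_eq0 -lt0n.
Qed.

(** The square is expanded into N^2 pairs. All of them get the bound of [prob_lonely2], and the N
    diagonal ones an additional 1, whence the term 1 / N. *)
Lemma integral_lonely_frac_sqr N r : (0 < N)%N ->
  (\int[P]_w (lonely_frac N r w ^+ 2)%:E <= (N%:R^-1 + few_near_prob mu k N.-2 r ^+ 2)%:E +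
     \int[mu]_x (ball_prob mu (2 * r) x)%:E)%E.
Proof.
move=> N0; set near := (\int[mu]_x (ball_prob mu (2 * r) x)%:E)%E.
set g := few_near_prob mu k N.-2 r.
have near0 : (0 <= near)%E.
  by apply: integral_ge0 => x _; rewrite lee_fin; case/andP: (ball_prob_itv mu (2 * r) x).
have sqE w : (lonely_frac N r w ^+ 2)%:E =
    ((N%:R^-1 ^+ 2)%:E * (\sum_(p : 'I_N * 'I_N) (\1_(lonely N r p.1 `&` lonely N r p.2) w)%:E))%E.
  rewrite sumEFin -EFinM /lonely_frac exprMn; congr (_ * _)%:E.
  rewrite expr2 big_distrlr/= pair_bigA/=; apply: eq_bigr => p _.
  by rewrite indicI.
under eq_integral do rewrite sqE.
have mI (p : 'I_N * 'I_N) : measurable (lonely N r p.1 `&` lonely N r p.2).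
  by apply: measurableI; exact: measurable_lonely.
rewrite ge0_integralZl_EFin//; last 2 first.
- by move=> w _; apply: sume_ge0 => p _; rewrite lee_fin.
- by apply: emeasurable_sum => p; apply/measurable_EFinP; exact: measurable_indic.
rewrite ge0_integral_sum//; last first.
- by move=> p; apply/measurable_EFinP; exact: measurable_indic.
apply: (@le_trans _ _ ((N%:R^-1 ^+ 2)%:E *
    \sum_(p : 'I_N * 'I_N) ((p.1 == p.2)%:R%:E + ((g ^+ 2)%:E + near)))%E).
  apply: lee_wpmul2l; first by rewrite lee_fin sqr_ge0.
  apply: lee_sum => -[i j] _; rewrite integral_indic ?setIT//.
  have [->|ij] := eqVneq i j.
    apply: (@le_trans _ _ 1%E); first exact: probability_le1.
    by rewrite leeDl// adde_ge0 ?lee_fin ?sqr_ge0.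
  by rewrite add0e; exact: prob_lonely2.
move: near0; rewrite -/near; case: near => [nb||]// _; last by rewrite addey ?leey.
under eq_bigr do rewrite -!EFinD.
rewrite sumEFin -EFinM -EFinD lee_fin big_split/= sumr_const card_prod card_ord.
rewrite -(pair_bigA _ (fun i j : 'I_N => (i == j)%:R : R))/=.
have -> : \sum_(i < N) \sum_(j < N) (i == j)%:R = \sum_(i < N) 1 :> R.
  apply: eq_bigr => i _; rewrite (bigD1 i)//= eqxx big1 ?addr0// => j.
  by rewrite eq_sym => /negbTE ->.
rewrite sumr_const card_ord -[X in _ + X]mulr_natl natrM le_eqVlt; apply/orP; left; apply/eqP.
by field; rewrite pnatr_eq0 -lt0n.
Qed.

Lemma integral_lonely_frac_dist N r b : (0 < N)%N -> 0 <= b ->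
  (\int[P]_w ((lonely_frac N r w - b) ^+ 2)%:E <=
   (N%:R^-1 + few_near_prob mu k N.-2 r ^+ 2 + b ^+ 2 - 2 * b * few_near_prob mu k N.-1 r)%:E +
     \int[mu]_x (ball_prob mu (2 * r) x)%:E)%E.
Proof.
move=> N0 b0; set I := (\int[P]_w _)%E; set g1 := few_near_prob mu k N.-1 r.
have mS := @measurable_lonely_frac N r.
have S0 := @lonely_frac_ge0 N r.
(* The cross term is kept on the left, so that every integrand is nonnegative. *)
have eq : (I + (2 * b * g1)%:E = \int[P]_w (lonely_frac N r w ^+ 2)%:E + (b ^+ 2)%:E)%E.
  have -> : (2 * b * g1)%:E = (\int[P]_w (2 * b * lonely_frac N r w)%:E)%E.
    under eq_integral do rewrite EFinM.
    rewrite ge0_integralZl_EFin ?integral_lonely_frac//.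
    - by move=> w _; rewrite lee_fin.
    - exact/measurable_EFinP.
    - by rewrite mulr_ge0.
  have -> : ((b ^+ 2)%:E = \int[P]_w (cst (b ^+ 2)%:E) w)%E.
    by rewrite integral_probability_cst.
  rewrite /I -!ge0_integralD//.
  - by apply: eq_integral => w _; rewrite -!EFinD; congr EFin; ring.
  - by move=> w _; rewrite lee_fin sqr_ge0.
  - by apply/measurable_EFinP; apply: measurable_funX.
  - by move=> w _; rewrite lee_fin sqr_ge0.
  - by move=> w _; rewrite lee_fin sqr_ge0.
  - by apply/measurable_EFinP; apply: measurable_funX; exact: measurable_funB.
  - by move=> w _; rewrite lee_fin; apply: mulr_ge0 => //; exact: mulr_ge0.
  - by apply/measurable_EFinP; exact: measurable_funM.
have h := integral_lonely_frac_sqr r N0.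
have near0 : (0 <= \int[mu]_x (ball_prob mu (2 * r) x)%:E)%E.
  by apply: integral_ge0 => x _; rewrite lee_fin; case/andP: (ball_prob_itv mu (2 * r) x).
move: h near0; case: (\int[mu]_x _)%E => [nb||]// h _; last by rewrite addey ?leey.
rewrite -EFinD [X in (_ <= X%:E)%E](_ : _ =
  N%:R^-1 + few_near_prob mu k N.-2 r ^+ 2 + nb + b ^+ 2 - 2 * b * g1); last by ring.
by rewrite EFinB leeBrDr// eq [(_ + _ + nb + _)%:E]EFinD leeD.
Qed.

End frac_near.

(** * Mean-square convergence of the fraction of lonely points *)

Section frac_near_cvg.
Context (R : realType) d (Omega : measurableType d) (P : probability Omega R).
Context (m : nat).
Local Notation T := (m.-tuple R).
Variables (X : nat -> {RV P >-> T}) (mu : probability T R) (f : T -> R) (M V : R).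
Local Notation lam := (@lebesgue_tuple R m).
Hypothesis hlaw : forall i A, measurable A -> P (X i @^-1` A) = mu A.
Hypothesis hind : mutually_independent X.
Variable k : nat.
Hypothesis V0 : 0 < V.
Hypothesis lebesgueV : forall x r, 0 < r -> lam (cball x r) = (r ^+ m * V)%:E.
Hypothesis mf : measurable_fun setT f.
Hypothesis f0M : forall x, 0 <= f x <= M.
Hypothesis muE : forall A, measurable A -> mu A = (\int[lam]_(x in A) (f x)%:E)%E.

Let M0 : 0 <= M.
Proof. by case/andP: (f0M [tuple 0 | i < m]) => h1; exact: le_trans. Qed.

Lemma lonely_frac_cvg c e : (0 < m)%N -> 0 < c -> 0 < e -> exists N0, forall N r,
  (N0 <= N)%N -> 0 < r -> N.-1%:R * (r ^+ m * V) = c ->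
  (\int[P]_w ((lonely_frac X k N r w - poisson_prob mu f k c) ^+ 2)%:E <= e%:E)%E.
Proof.
move=> m0 c0 e0; set phi := poisson_prob mu f k c.
have e40 : 0 < e / 4 by rewrite divr_gt0.
have [n0 gphi] := few_near_prob_cvg k V0 lebesgueV mf f0M muE m0 c0 e40.
(* Makes (3 + 2^m) [eta] at most e / 4, where [eta] = M c / (N - 1) bounds the probability of a
   ball: 2^m [eta] is spent on close pairs, 3 [eta] on the passage between N - 1 and N - 2 other
   points. *)
pose B := 4 * (M * c) * (3 + 2 ^+ m) / e.
exists (maxn n0.+2 (maxn (Num.bound (4 / e)) (Num.bound B).+2)) => N r.
rewrite !geq_max => /andP[N1 /andP[N2 N3]] r0 rE.
have B0 : 0 <= B.
  apply: divr_ge0; last exact: ltW.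
  by rewrite mulr_ge0 ?mulr_ge0 ?addr_ge0 ?exprn_ge0// ltW.
case: N N1 N2 N3 rE => [|[|n]]// N1 N2 N3; rewrite [_.+2.-1]/= => rE.
set eta := M * (r ^+ m * V).
have np : 0 < n.+1%:R :> R by [].
have etaE : eta = M * c / n.+1%:R by rewrite /eta -rE; field; rewrite gt_eqF.
have eta0 : 0 <= eta by rewrite etaE divr_ge0 ?mulr_ge0// ltW.
have eta_le : (3 + 2 ^+ m) * eta <= e / 4.
  have bn : B < n.+1%:R.
    by apply: lt_le_trans (archi_boundP B0) _; rewrite ler_nat; exact: ltnW.
  rewrite etaE mulrA ler_pdivrMr//; move: bn; rewrite /B ltr_pdivrMr// => /ltW bn.
  lra.
have Ne : n.+2%:R^-1 <= e / 4.
  rewrite -[e / 4]invrK lef_pV2 ?posrE ?invr_gt0// invf_div.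
  apply: ltW; apply: lt_le_trans (archi_boundP _) _; first by rewrite divr_ge0// ltW.
  by rewrite ler_nat.
have g1 := gphi n.+1 r (ltnW N1) r0 rE.
have := few_near_prob_succ k lebesgueV mf f0M muE n r0.
have near : (\int[mu]_x (ball_prob mu (2 * r) x)%:E <= (2 ^+ m * eta)%:E)%E.
  apply: le_trans (integral_ball_prob_le lebesgueV mf f0M muE _) _; first by rewrite mulr_gt0.
  by rewrite exprMn lee_fin /eta le_eqVlt; apply/orP; left; apply/eqP; ring.
have /andP[p0 p1] := poisson_prob_itv mu k mf f0M (ltW c0).
have := integral_lonely_frac_dist hlaw hind k r (ltn0Sn n.+1) p0.
rewrite -/phi [n.+2.-1]/= [n.+2.-2]/=.
have /andP[g10 g11] := few_near_prob_itv mu k n.+1 r.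
have /andP[g20 g21] := few_near_prob_itv mu k n r.
move=> h; move: g1 g10 g11 g20 g21 h; rewrite -/phi -/eta.
set g1 := few_near_prob mu k n.+1 r; set g2 := few_near_prob mu k n r.
move=> g1phi g10 g11 g20 g21 h /andP[g12 g2e].
apply: le_trans h _; apply: le_trans (leeD (lexx _) near) _.
rewrite -EFinD lee_fin; move: g1phi; rewrite ler_norml => /andP[h1 h2].
have p0' : 0 <= phi := p0; have p1' : phi <= 1 := p1.
have : (g2 - phi) ^+ 2 <= e / 4 + eta.
  by have [a0|a0] := leP 0 (g2 - phi); nra.
have : phi * (g2 - g1) <= eta by nra.
(* Completing the square at [g2] leaves the cross term 2 phi (g2 - g1), which is at most 2 [eta]. *)
have -> : n.+2%:R^-1 + g2 ^+ 2 + phi ^+ 2 - 2 * phi * g1 + 2 ^+ m * eta =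
  n.+2%:R^-1 + (g2 - phi) ^+ 2 + 2 * (phi * (g2 - g1)) + 2 ^+ m * eta by ring.
have fin (x y z h q : R) : x <= e / 4 -> z <= h -> y <= e / 4 + h ->
  3 * h + q <= e / 4 -> x + y + 2 * z + q <= e by move: (ltW e0); lra.
by move=> h3 h4; apply: fin Ne h3 h4 _; rewrite -mulrDl.
Qed.

End frac_near_cvg.

(** * Two bounds for the probability of being lonely at large radius *)

Section lonely_tail.
Context (R : realType) d (Omega : measurableType d) (P : probability Omega R).
Context (m : nat).
Local Notation T := (m.-tuple R).
Variables (X : nat -> {RV P >-> T}) (mu : probability T R).
Hypothesis hlaw : forall i A, measurable A -> P (X i @^-1` A) = mu A.
Hypothesis hind : mutually_independent X.
Variable k : nat.
Hypothesis m0 : (0 < m)%N.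

(** Number of intervals of length r / m, per coordinate, that suffice to cover [-t, t]. *)
Definition grid_cells (t r : R) : nat := (Num.truncn (2 * t * m%:R / r)).+1.

(* In a grid of side r / m two points of the same cell are at distance at most
   r, so a cell holds at most k lonely points. *)
Lemma card_lonely_le N r t w : (0 < k)%N -> 0 < r -> 0 <= t ->
  (#|[pred i : 'I_N | (w \in lonely X k N r i) && (enorm (X i w) <= t)%R]| <=
   k * grid_cells t r ^ m)%N.
Proof.
move=> k0 r0 t0; set S := [pred i : 'I_N | _]; set q := grid_cells t r.
have mr0 : 0 < m%:R / r by rewrite divr_gt0// ltr0n.
pose idx (i : 'I_N) (a : 'I_m) := Num.truncn ((tnth (X i w) a + t) * (m%:R / r)).
pose cell (i : 'I_N) : {ffun 'I_m -> 'I_q} := [ffun a => inord (idx i a)].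
have coord i a : i \in S -> `|tnth (X i w) a| <= t.
  by rewrite inE => /andP[_]; apply: le_trans; exact: enorm_coord.
have idx_lt i a : i \in S -> (idx i a < q)%N.
  move=> iS; rewrite ltnS /idx le_truncn//.
  have := coord i a iS; rewrite ler_norml => /andP[h1 h2].
  by rewrite -mulrA ler_pM2r//; lra.
have near i j : i \in S -> j \in S -> cell i = cell j -> edist (X i w) (X j w) <= r.
  move=> iS jS cij.
  have h0 : 0 <= r / m%:R by rewrite divr_ge0// ltW.
  have -> : r = m%:R * (r / m%:R) by rewrite mulrCA mulfV ?mulr1// pnatr_eq0 -lt0n.
  apply: edist_le_coord => // a.
  have : idx i a = idx j a.
    have := congr1 (fun c : {ffun 'I_m -> 'I_q} => val (c a)) cij.
    by rewrite !ffunE/= !inordK//; exact: idx_lt.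
  have pos l : l \in S -> 0 <= (tnth (X l w) a + t) * (m%:R / r).
    move=> lS; apply: mulr_ge0; last exact: ltW.
    by have := coord l a lS; rewrite ler_norml; lra.
  rewrite /idx => ij.
  have /andP[] := truncn_itv (pos i iS); have /andP[] := truncn_itv (pos j jS).
  rewrite ij [_.+1%:R]mulrS; set z := (Num.truncn _)%:R => h1 h2 h3 h4.
  rewrite -(@ler_pM2r _ (m%:R / r))// -[X in _ * X <= _]gtr0_norm// -normrM.
  have -> : r / m%:R * (m%:R / r) = 1.
    by field; rewrite gt_eqF//= pnatr_eq0 -lt0n.
  by rewrite ler_norml; lra.
rewrite -sum1_card (partition_big cell xpredT)//=.
apply: (@leq_trans (\sum_(c : {ffun 'I_m -> 'I_q}) k)); last first.
  by rewrite sum_nat_const card_ffun !card_ord mulnC.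
apply: leq_sum => c _; rewrite sum1_card.
set Sc := (X in (#|X| <= _)%N).
have [/existsP[i0 i0S]|no] := boolP [exists i, Sc i]; last first.
  by rewrite eq_card0// => i; apply/negP => iS; case/negP: no; apply/existsP; exists i.
have /andP[i0S' /eqP ci0] : (i0 \in S) && (cell i0 == c) := i0S.
(* The other points of the cell are within r of the lonely point [i0], so there are fewer than k of
   them; with [i0] the cell holds at most k. *)
rewrite (cardD1 i0) (_ : i0 \in _ = true)// add1n.
have /andP[+ _] : (w \in lonely X k N r i0) && (enorm (X i0 w) <= t) := i0S'.
rewrite inE /lonely /few_near /=; apply: leq_ltn_trans.
rewrite -size_filter cardE -(size_map val); apply: uniq_leq_size.
  by rewrite map_inj_uniq ?enum_uniq//; exact: val_inj.
move=> a /mapP[i]; rewrite mem_enum !inE => /andP[ii0 /andP[iS /eqP ci]] ->.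
rewrite mem_filter near//=; last by rewrite ci0 ci.
by rewrite /others mem_rem_uniq ?iota_uniq// inE mem_iota/=; apply/andP; split; [exact: ii0|exact: ltn_ord].
Qed.

Definition norm_tail (t : R) : \bar R := mu [set x : T | (t < enorm x)%R].

Let measurable_norm_tail t : measurable [set x : T | (t < enorm x)%R].
Proof.
rewrite (_ : mkset _ = ~` [set x | enorm x <= t]).
  apply: measurableC; apply: measurable_fun_set_le; exact: measurable_enorm.
by apply/seteqP; split => x /=; rewrite ltNge => /negP.
Qed.

Let far i t : set Omega := [set w | t < enorm (X i w)].

Let measurable_far i t : measurable (far i t).
Proof.
rewrite -[X in measurable X]setTI.
exact: (@measurable_funPT _ _ _ _ (X i) measurableT _ (measurable_norm_tail t)).
Qed.

Let prob_far i t : P (far i t) = norm_tail t.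
Proof. by rewrite /norm_tail -(hlaw i (measurable_norm_tail t)). Qed.

Lemma norm_tailE t : norm_tail t = (fine (norm_tail t))%:E.
Proof. by rewrite fineK// fin_num_measure. Qed.

(** The left side is the mean fraction of lonely points. A lonely point within t of the origin is
    counted by [card_lonely_le]; the others are among the points beyond t. *)
Lemma few_near_prob_grid N r t : (0 < N)%N -> (0 < k)%N -> 0 < r -> 0 <= t ->
  ((few_near_prob mu k N.-1 r)%:E <=
   ((k * grid_cells t r ^ m)%:R / N%:R)%:E + norm_tail t)%E.
Proof.
move=> N0 k0 r0 t0.
rewrite -(integral_lonely_frac hlaw hind k r N0).
pose F w : R := N%:R^-1 * \sum_(i < N) \1_(far i t) w.
have mF : measurable_fun setT F.
  apply: measurable_funM => //; apply: measurable_sum => i.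
  by apply: measurable_indic; exact: measurable_far.
have F0 w : 0 <= F w by rewrite mulr_ge0 ?invr_ge0// sumr_ge0.
pose K : R := (k * grid_cells t r ^ m)%:R / N%:R.
have K0 : 0 <= K by rewrite divr_ge0.
have IF : (\int[P]_w (F w)%:E = norm_tail t)%E.
  under eq_integral do rewrite EFinM.
  rewrite ge0_integralZl_EFin//; last 2 first.
  - by move=> w _; rewrite lee_fin sumr_ge0.
  - apply/measurable_EFinP; apply: measurable_sum => i.
    by apply: measurable_indic; exact: measurable_far.
  under eq_integral do rewrite -sumEFin.
  rewrite ge0_integral_sum//; last first.
  - by move=> i; apply/measurable_EFinP/measurable_indic; exact: measurable_far.
  rewrite (eq_bigr (fun=> norm_tail t)); last first.
    move=> i _; rewrite integral_indic//.
    by rewrite setIT; exact: prob_far.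
  rewrite norm_tailE sumEFin sumr_const card_ord -EFinM -[X in _ * X]mulr_natl mulrA.
  by rewrite mulVf ?mul1r// pnatr_eq0 -lt0n.
rewrite -IF.
rewrite [X in (_ <= X + _)%E](_ : _ = \int[P]_w (cst K%:E w))%E; last first.
  by rewrite integral_probability_cst.
rewrite -ge0_integralD//; last 2 first.
- by move=> w _; rewrite lee_fin.
- exact/measurable_EFinP.
apply: integralT_le => w; first by rewrite lee_fin lonely_frac_ge0.
rewrite -EFinD lee_fin /K /F mulrC /lonely_frac -mulrDr ler_wpM2l ?invr_ge0//.
apply: (@le_trans _ _ (#|[pred i : 'I_N | (w \in lonely X k N r i) &&
    (enorm (X i w) <= t)%R]|%:R + \sum_(i < N) \1_(far i t) w)).
  rewrite -sum1_card natr_sum [X in _ <= X + _]big_mkcond/= -big_split/=.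
  apply: ler_sum => i _; rewrite indicE inE/=.
  have [wl|wl]/= := boolP (w \in lonely X k N r i); last by rewrite add0r.
  have [_|nt] := boolP (enorm (X i w) <= t); first by rewrite lerDl.
  by rewrite add0r indicE mem_set// /far/= ltNge.
by rewrite lerD2r ler_nat; exact: card_lonely_le.
Qed.

(** If all points are within r / 2 of the origin, all mutual distances are at most r, and since N -
    1 >= k no point is lonely. The bound is a union bound over the N points, strong when N is small
    compared with a power of r. *)
Lemma few_near_prob_far N r : (k < N)%N ->
  ((few_near_prob mu k N.-1 r)%:E <= N%:R%:E * norm_tail (r / 2))%E.
Proof.
move=> kN; have N0 : (0 < N)%N by exact: leq_ltn_trans kN.
rewrite -(prob_lonely hlaw hind k r N0).
apply: (@le_trans _ _ (P (\big[setU/set0]_(i < N) far i (r / 2)))).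
  apply: le_measure; rewrite ?inE.
  - exact: measurable_lonely.
  - exact: bigsetU_measurable.
  move=> w; rewrite /lonely /few_near /= => lt_k.
  have : has (fun l => ~~ (edist (X 0%N w) (X l w) <= r)%R) (others N 0).
    rewrite has_predC; apply/negP; rewrite all_count => /eqP E.
    by move: lt_k; rewrite E size_others// ltnNge -ltnS prednK// kN.
  case/hasP => l lo; have lN : (l < N)%N by move/mem_rem: lo; rewrite mem_iota.
  move=> far0l; rewrite -(bigcup_mkord _ (fun i => far i (r / 2))).
  have [h0|h0] := boolP (enorm (X 0%N w) <= r / 2); last first.
    by exists 0%N => //; rewrite /far /= ltNge.
  exists l => //; rewrite /far /= ltNge; apply: contra far0l => hl.
  have -> : r = 2 * (r / 2) by field.
  exact: edist_le_enorm.
apply: (@le_trans _ _ (\sum_(i < N) P (far i (r / 2)%R))%E).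
  apply: (Boole_inequality P (A := fun i => far i (r / 2))) => i _; exact: measurable_far.
rewrite (eq_bigr (fun=> norm_tail (r / 2))); last by move=> i _; exact: prob_far.
by rewrite norm_tailE sumEFin sumr_const card_ord -EFinM mulr_natl.
Qed.

End lonely_tail.

(** * Exponential tails, uniform in the sample size *)

Section tails.
Context (R : realType) d (Omega : measurableType d) (P : probability Omega R).
Context (m : nat).
Local Notation T := (m.-tuple R).
Variables (X : nat -> {RV P >-> T}) (mu : probability T R) (f : T -> R) (M V : R).
Local Notation lam := (@lebesgue_tuple R m).
Hypothesis hlaw : forall i A, measurable A -> P (X i @^-1` A) = mu A.
Hypothesis hind : mutually_independent X.
Variable k : nat.
Hypothesis V0 : 0 < V.
Hypothesis lebesgueV : forall x r, 0 < r -> lam (cball x r) = (r ^+ m * V)%:E.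
Hypothesis mf : measurable_fun setT f.
Hypothesis f0M : forall x, 0 <= f x <= M.
Hypothesis muE : forall A, measurable A -> mu A = (\int[lam]_(x in A) (f x)%:E)%E.
Hypothesis m0 : (0 < m)%N.
Hypothesis k0 : (0 < k)%N.
Variables (C alpha : R).
Hypothesis C0 : 0 <= C.
Hypothesis alpha0 : 0 < alpha.
Hypothesis tailC : forall z : R, (norm_tail mu (expR z) <= (C * expR (- alpha * z))%:E)%E.

Definition radius (N : nat) (c : R) : R := (c / (N.-1%:R * V)) `^ (m%:R^-1).

Lemma radius_gt0 N c : (1 < N)%N -> 0 < c -> 0 < radius N c.
Proof.
move=> N1 c0; rewrite powR_gt0// divr_gt0// mulr_gt0// ltr0n.
by case: N N1 => [|[]].
Qed.

Lemma radiusE N c : (1 < N)%N -> 0 < c -> N.-1%:R * (radius N c ^+ m * V) = c.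
Proof.
move=> N1 c0; have N0 : 0 < N.-1%:R :> R by rewrite ltr0n; case: N N1 => [|[]].
rewrite /radius -powR_mulrn ?powR_ge0// -powRrM mulVf ?pnatr_eq0 -?lt0n//.
rewrite powRr1 ?divr_ge0 ?mulr_ge0 ?ltW//.
by field; rewrite !gt_eqF.
Qed.

Let a : R := alpha / m%:R.
Let mp : 0 < m%:R :> R. Proof. by rewrite ltr0n. Qed.
Let a0 : 0 < a. Proof. by rewrite divr_gt0. Qed.
(** With a = alpha / m, this is the solution of s (1 + a) = a / 2. For N < e^(sL) the union bound is
    of order N^(1 + a) e^(-aL), hence at most of order e^(-aL/2): half of the exponent survives. The
    solution also satisfies s <= 1/2 and s <= a / 2, as the grid bound for N >= e^(sL) requires. *)
Definition tail_rate : R := alpha / m%:R / (2 * (1 + alpha / m%:R)).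
Local Notation s := tail_rate.
Let a10 : 0 < 2 * (1 + a). Proof. by rewrite mulr_gt0// addr_gt0. Qed.
Lemma tail_rate_gt0 : 0 < s. Proof. by rewrite divr_gt0. Qed.
Let s_half : s <= 2^-1.
Proof. by rewrite /s -/a ler_pdivrMr//; lra. Qed.
Let sE : s * (1 + a) = a / 2.
Proof. by rewrite /s -/a; field; rewrite gt_eqF// addr_gt0. Qed.
Let s_a : s <= a / 2.
Proof. by rewrite -sE ler_peMr ?(ltW tail_rate_gt0)// lerDl ltW. Qed.

(** The summands account in turn for a fine grid, a grid with at most two cells per side, the points
    beyond the cut-off t, and the regime of small N. *)
Definition tail_const : R := k%:R * ((4 * m%:R) ^+ m * V) + k%:R * 2 ^+ m + C
   + C * expR (alpha * ln 2 + alpha / m%:R * ln V).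

Lemma few_near_prob_tail N L r : (k < N)%N -> 0 <= L -> 0 < r ->
  N.-1%:R * (r ^+ m * V) = expR L ->
  few_near_prob mu k N.-1 r <= tail_const * expR (- s * L).
Proof.
move=> kN L0 r0 rE; have N0 : (0 < N)%N by exact: leq_ltn_trans kN.
have N1 : (0 < N.-1)%N by rewrite -ltnS prednK//; exact: leq_ltn_trans kN.
have Np : 0 < N%:R :> R by rewrite ltr0n.
have N1p : 0 < N.-1%:R :> R by rewrite ltr0n.
have rmE : r ^+ m = expR L / (N.-1%:R * V) by rewrite -rE; field; rewrite !gt_eqF.
pose E := expR (- s * L); have E0 : 0 < E by exact: expR_gt0.
(* The cut-off satisfies t^m = e^(L/2). Then (t / r)^m / (N - 1) is V e^(-L/2), while the mass
   beyond t is at most C e^(-aL/2). *)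
pose t := expR (L / (2 * m%:R)); have t0 : 0 < t by exact: expR_gt0.
pose D := C * expR (alpha * ln 2 + a * ln V).
have D0 : 0 <= D by rewrite mulr_ge0// expR_ge0.
have A0 : 0 <= k%:R * ((4 * m%:R) ^+ m * V).
  by rewrite mulr_ge0// mulr_ge0 ?exprn_ge0 ?mulr_ge0// ltW.
have B0 : 0 <= k%:R * 2 ^+ m :> R by rewrite mulr_ge0// exprn_ge0.
have [NE|NE] := leP (expR (s * L)) N%:R.
  have cells : (grid_cells m t r)%:R ^+ m <= (4 * m%:R) ^+ m * V * (N%:R * E) + 2 ^+ m.
    pose z := 2 * t * m%:R / r.
    have z0 : 0 <= z by rewrite divr_ge0 ?mulr_ge0// ltW.
    have cz : (grid_cells m t r)%:R <= z + 1.
      by rewrite /grid_cells -natr1 lerD2r truncn_le.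
    have [z1|z1] := leP 1 z.
      apply: (@le_trans _ _ ((2 * z) ^+ m)).
        apply: lerXn2r; rewrite ?nnegrE//; first exact: mulr_ge0.
        by apply: le_trans cz _; rewrite mulr_natl mulr2n lerD2l.
      apply: (@le_trans _ _ ((4 * m%:R) ^+ m * V * (N%:R * E))); last by rewrite lerDl exprn_ge0.
      have -> : (2 * z) ^+ m = (4 * m%:R) ^+ m * V * (N.-1%:R * expR (- 2^-1 * L)).
        have -> : 2 * z = 4 * m%:R * t / r by rewrite /z; field; rewrite gt_eqF.
        rewrite !exprMn exprVn rmE /t -expRM_natl.
        have -> : expR (m%:R * (L / (2 * m%:R))) = expR L * expR (- 2^-1 * L).
          by rewrite -expRD; congr expR; field; rewrite gt_eqF.
        by field; rewrite !gt_eqF// expR_gt0.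
      apply: ler_wpM2l; first by rewrite mulr_ge0 ?exprn_ge0 ?mulr_ge0// ltW.
      apply: ler_pM => //; rewrite ?expR_ge0 ?ler_nat ?leq_pred//.
      by rewrite /E ler_expR; have := ler_wpM2r L0 s_half; lra.
    apply: (@le_trans _ _ (2 ^+ m)).
      apply: lerXn2r; rewrite ?nnegrE//; apply: le_trans cz _.
    by rewrite -lerBrDr; apply: le_trans (ltW z1) _; lra.
    by rewrite lerDr mulr_ge0 ?mulr_ge0 ?exprn_ge0 ?mulr_ge0// ltW.
  have NEi : N%:R^-1 <= E.
    rewrite -[E]invrK lef_pV2 ?posrE ?invr_gt0// /E -expRN.
    by rewrite mulNr opprK.
  have := few_near_prob_grid hlaw hind m0 N0 k0 r0 (ltW t0).
  rewrite -lee_fin => /le_trans; apply.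
  apply: le_trans (leeD (lexx _) (tailC _)) _.
  rewrite -EFinD lee_fin natrM natrX.
  have h1 : k%:R * (grid_cells m t r)%:R ^+ m / N%:R <=
      k%:R * ((4 * m%:R) ^+ m * V) * E + k%:R * 2 ^+ m * E.
    apply: (@le_trans _ _ (k%:R * ((4 * m%:R) ^+ m * V * (N%:R * E) + 2 ^+ m) / N%:R)).
      by rewrite ler_wpM2r ?invr_ge0// ler_wpM2l.
    rewrite mulrDr mulrDl lerD//; first by rewrite le_eqVlt; apply/orP; left; apply/eqP; field; rewrite gt_eqF.
    by rewrite ler_wpM2l.
  have h2 : C * expR (- alpha * (L / (2 * m%:R))) <= C * E.
    rewrite ler_wpM2l// ler_expR; have := ler_wpM2r L0 s_a.
    have -> : - alpha * (L / (2 * m%:R)) = - (a / 2 * L) by rewrite /a; field; rewrite gt_eqF.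
    by rewrite mulNr lerN2.
  rewrite /tail_const -/a -/D -/E; apply: le_trans (lerD h1 h2) _.
  by rewrite -!mulrDl ler_wpM2r ?(ltW E0)// lerDl.
(* Here N < e^(sL), and r^m = e^L / ((N - 1) V) is so large that the union bound suffices. *)
have := few_near_prob_far hlaw hind r kN.
rewrite -lee_fin => /le_trans; apply.
have r20 : 0 < r / 2 by rewrite divr_gt0.
rewrite -[r / 2]lnK ?posrE//.
have NsL : ln N%:R <= s * L.
  by rewrite -(expRK (s * L)) ler_ln ?posrE ?expR_gt0// ltW.
have N1sL : ln N.-1%:R <= s * L.
  by apply: le_trans NsL; rewrite ler_ln ?posrE// ler_nat leq_pred.
have lnr : m%:R * ln r = L - ln V - ln N.-1%:R.
  rewrite mulr_natl -lnXn// rmE ln_div ?posrE ?expR_gt0 ?mulr_gt0//.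
  by rewrite lnM ?posrE// expRK; lra.
apply: (@le_trans _ _ (N%:R%:E * (C * expR (- alpha * ln (r / 2)))%:E)%E).
  by apply: lee_wpmul2l; rewrite ?lee_fin.
rewrite -EFinM lee_fin.
have h : N%:R * (C * expR (- alpha * ln (r / 2))) <= D * E.
  rewrite /D /E -mulrA -expRD mulrCA ler_wpM2l//.
  rewrite -[X in X * _ <= _]lnK ?posrE// -expRD ler_expR.
  rewrite ln_div ?posrE//.
  have -> : - alpha * (ln r - ln 2) = alpha * ln 2 - a * (m%:R * ln r).
    by rewrite /a; field; rewrite gt_eqF.
  rewrite lnr; have := ler_wpM2r L0 s_a; have := ler_wpM2l (ltW a0) N1sL.
  have : s * L + a * (s * L) = a / 2 * L by rewrite -sE; ring.
  lra.
apply: le_trans h _; rewrite -/E ler_wpM2r ?(ltW E0)// /tail_const -/a -/D lerDr.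
by rewrite addr_ge0// addr_ge0.
Qed.

(** A bound valid for all N passes to the Poisson limit with the same constant. The boolean selects
    the probability or its complement, so that one argument serves both tails. *)
Let limit_le c B (r := fun N => radius N c) (g := fun N => few_near_prob mu k N.-1 (r N)) (b : bool) : 0 < c ->
  (forall N, (k < N)%N -> (if b then g N else 1 - g N) <= B) ->
  (if b then poisson_prob mu f k c else 1 - poisson_prob mu f k c) <= B.
Proof.
move=> c0 hB; apply/ler_addgt0Pr => e e0.
have [n0 H] := few_near_prob_cvg k V0 lebesgueV mf f0M muE m0 c0 e0.
pose N := (maxn n0 k).+2; have kN : (k < N)%N by rewrite ltnS leqW// leq_maxr.
have := H N.-1 (r N); rewrite radiusE// radius_gt0// => /(_ _ isT erefl).
have nN : (n0 <= N.-1)%N by rewrite leqW// leq_maxl.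
move=> /(_ nN); rewrite ler_norml => /andP[h1 h2].
by have := hB N kN; rewrite /g; case: b {hB}; lra.
Qed.

Lemma poisson_prob_tail L : 0 <= L ->
  poisson_prob mu f k (expR L) <= tail_const * expR (- s * L).
Proof.
move=> L0; apply: (@limit_le _ _ true) => [|N kN]; first exact: expR_gt0.
have N1 : (1 < N)%N by exact: leq_ltn_trans kN.
apply: few_near_prob_tail => //; first by rewrite radius_gt0// expR_gt0.
by rewrite radiusE// expR_gt0.
Qed.

Lemma poisson_prob_ge c : 0 < c -> 1 - poisson_prob mu f k c <= M * c.
Proof.
move=> c0; apply: (@limit_le _ _ false) => // N kN.
have N1 : (1 < N)%N by exact: leq_ltn_trans kN.
apply: le_trans (few_near_prob_ge lebesgueV mf f0M muE N.-1 k0 (radius_gt0 N1 c0)) _.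
by rewrite mulrCA radiusE.
Qed.

End tails.

(** * Approximation by staircases *)

Section layers.
Context (R : realType).

(** Since 2j + 1 = (j + 1)^2 - j^2, the sum over the j below u telescopes to the square of the
    smaller of J and the ceiling of u. *)
Lemma min_sqr_le_layers (u : R) J : 0 <= u ->
  Num.min u J%:R ^+ 2 <= \sum_(j < J) ((2 * j + 1)%:R * (j%:R < u)%R%:R).
Proof.
move=> u0; elim: J => [|J IH]; first by rewrite big_ord0 min_r// expr0n.
rewrite big_ord_recr/=; have [uJ|Ju] := leP u J%:R.
  rewrite mulr0 addr0; apply: le_trans IH.
  by rewrite !min_l// (le_trans uJ)// ler_nat.
rewrite mulr1; move: IH; rewrite (min_r (ltW Ju)) => IH.
apply: (@le_trans _ _ (J.+1%:R ^+ 2)).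
  by apply: lerXn2r; rewrite ?nnegrE ?le_min ?u0//= ge_min lexx orbT.
apply: (@le_trans _ _ (J%:R ^+ 2 + (2 * J + 1)%:R)); last by rewrite lerD2r.
by rewrite -!natrX -natrD ler_nat; lia.
Qed.

Lemma sqr_le_layers (u : R) : 0 <= u ->
  ((u ^+ 2)%:E <= \sum_(0 <= j <oo) ((2 * j + 1)%:R * (j%:R < u)%R%:R)%:E)%E.
Proof.
move=> u0; pose J := (Num.truncn u).+1.
apply: (@le_trans _ _ (\sum_(0 <= j < J) ((2 * j + 1)%:R * (j%:R < u)%R%:R)%:E)%E); last first.
  by apply: nneseries_lim_ge => j _ _; rewrite lee_fin mulr_ge0.
rewrite sumEFin lee_fin big_mkord; apply: le_trans (min_sqr_le_layers J u0).
rewrite min_l// ltW//; have /andP[//] := truncn_itv u0.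
Qed.

Lemma geometric_layers (q : R) J : 0 <= q < 1 ->
  \sum_(j < J) ((2 * j + 1)%:R * q ^+ j) <= (1 + q * (2 / (1 - q))) / (1 - q).
Proof.
move=> /andP[q0 q1]; have q10 : 0 < 1 - q by rewrite subr_gt0.
(* An antidifference of the summand: (2j + 1) q^j = G j - G (j + 1). *)
pose G j : R := (2 / (1 - q) * j%:R + (1 + q * (2 / (1 - q))) / (1 - q)) * q ^+ j.
have GE : \sum_(j < J) ((2 * j + 1)%:R * q ^+ j) = G 0%N - G J.
  elim: J => [|J IH]; first by rewrite big_ord0 subrr.
  rewrite big_ord_recr/= IH /G exprS natrD natrM -natr1; field.
  by rewrite gt_eqF.
rewrite GE /G mulr0 add0r expr0 mulr1 gerBl.
apply: mulr_ge0; last exact: exprn_ge0.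
by rewrite addr_ge0 ?mulr_ge0 ?divr_ge0 ?addr_ge0 ?mulr_ge0 ?invr_ge0// ltW.
Qed.

End layers.

Section stair_approximation.
Context (R : realType) d (U : measurableType d) (P : probability U R).
Variables (Y : U -> R) (A b : R).
Hypothesis mY : measurable_fun setT Y.
Hypothesis A0 : 0 <= A.
Hypothesis b0 : 0 < b.
Hypothesis tail_gt : forall y, 0 <= y ->
  (P [set w | (y < Y w)%R] <= (A * expR (- b * y))%:E)%E.
Hypothesis tail_le : forall y, 0 <= y ->
  (P [set w | (Y w <= - y)%R] <= (A * expR (- b * y))%:E)%E.

(** The first term comes from the height 1 / n of the steps, the second from the tails beyond n. The
    variable enters only through A and b, so the same error serves every sample size and the limit
    variable. *)
Definition stair_error (n : nat) : R :=
  let q := expR (- b) in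
  2 / n%:R ^+ 2 + 4 * A * ((1 + q * (2 / (1 - q))) / (1 - q)) * expR (- b * n%:R).

Let big_dev n j : set U := [set w | j%:R < Num.max 0 (`|Y w| - n%:R)].

Let big_devE n j : (0 < n)%N -> big_dev n j = [set w | n%:R + j%:R < `|Y w|].
Proof.
move=> n0; apply/seteqP; split => w; rewrite /big_dev /= lt_max ltNge ler0n/=; lra.
Qed.

Let measurable_big_dev n j : measurable (big_dev n j).
Proof.
rewrite (_ : big_dev n j = (fun w => Num.max 0 (`|Y w| - n%:R)) @^-1` `]j%:R, +oo[%classic); last first.
  by apply/seteqP; split => w; rewrite /big_dev /= in_itv/= andbT.
rewrite -[X in measurable X]setTI; apply: (_ : measurable_fun setT _) => //.
apply: measurable_maxr => //; apply: measurable_funB => //.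
exact: measurableT_comp.
Qed.

Let prob_big_dev n j : (0 < n)%N ->
  (P (big_dev n j) <= (2 * A * expR (- b * n%:R) * expR (- b) ^+ j)%:E)%E.
Proof.
move=> n0; set t := n%:R + j%:R : R; have t0 : 0 <= t by rewrite addr_ge0.
have mgt : measurable [set w | t < Y w].
  rewrite (_ : mkset _ = Y @^-1` `]t, +oo[%classic); last first.
    by apply/seteqP; split => w; rewrite /= in_itv/= andbT.
  by rewrite -[X in measurable X]setTI; apply: mY.
have mle : measurable [set w | Y w <= - t].
  rewrite (_ : mkset _ = Y @^-1` `]-oo, - t]%classic); last first.
    by apply/seteqP; split => w; rewrite /= in_itv.
  by rewrite -[X in measurable X]setTI; apply: mY.
apply: (@le_trans _ _ (P ([set w | t < Y w] `|` [set w | Y w <= - t]))).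
  apply: le_measure; rewrite ?inE//; first exact: measurableU.
  move=> w; rewrite big_devE//= -/t ltr_normr => /orP[h|h]; [by left|right] => /=; lra.
apply: le_trans (measureU2 _ _ _) _ => //.
apply: le_trans (leeD (tail_gt t0) (tail_le t0)) _.
rewrite -EFinD lee_fin -expRM_natl -mulrA -expRD.
rewrite (_ : - b * n%:R + j%:R * - b = - b * t); last by rewrite /t; ring.
by rewrite -mulrA -mulr2n mulr_natl.
Qed.

Let q := expR (- b).
Let q01 : 0 <= q < 1.
Proof. by rewrite expR_ge0/= -expR0 ltr_expR oppr_lt0. Qed.

(** With u the excess of |Y| over n, the squared error is at most 2 / n^2 + 2 u^2. The square u^2 is
    bounded by its layers, and the j-th layer has probability at most 2 A e^(-bn) e^(-bj). *)
Lemma stair_approx n : (0 < n)%N ->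
  (\int[P]_w ((Y w - stair n (Y w)) ^+ 2)%:E <= (stair_error n)%:E)%E.
Proof.
move=> n0; pose u w := Num.max 0 (`|Y w| - n%:R).
pose F j w : \bar R := ((2 * j + 1)%:R * \1_(big_dev n j) w)%:E.
have F0 j w : (0 <= F j w)%E by rewrite lee_fin mulr_ge0.
have mF j : measurable_fun setT (F j).
  by apply/measurable_EFinP; exact: measurable_cindic.
have mS : measurable_fun setT (fun w => \sum_(0 <= j <oo) F j w)%E.
  by apply: ge0_emeasurable_sum.
pose K := 2 / n%:R ^+ 2 : R; have K0 : 0 <= K by rewrite divr_ge0 ?exprn_ge0.
apply: (@le_trans _ _ (\int[P]_w (K%:E + 2%:E * \sum_(0 <= j <oo) F j w))%E).
  apply: integralT_le => w; first by rewrite lee_fin sqr_ge0.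
  apply: (@le_trans _ _ (K%:E + 2%:E * (u w ^+ 2)%:E)%E); last first.
    rewrite leeD2l//; apply: lee_wpmul2l; first by rewrite lee_fin.
    have u0 : 0 <= u w by rewrite le_max lexx.
    apply: le_trans (sqr_le_layers u0) _.
    apply: lee_nneseries => [j _ _|j _]; first by rewrite lee_fin mulr_ge0.
    rewrite lee_fin ler_wpM2l// indicE.
    by have -> // : (j%:R < u w) = (w \in big_dev n j) by apply/idP/idP; rewrite inE.
  rewrite -EFinM -EFinD lee_fin.
  have := stair_dist (Y w) n0; rewrite -/(u w); set D := Y w - _ => h.
  rewrite -real_normK ?num_real// /K.
  have n0' : 0 <= n%:R^-1 :> R by rewrite invr_ge0.
  have u0 : 0 <= u w by rewrite le_max lexx.
  have -> : 2 / n%:R ^+ 2 = 2 * n%:R^-1 ^+ 2 :> R by rewrite exprVn.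
  have hD : `|D| ^+ 2 <= (n%:R^-1 + u w) ^+ 2 by apply: lerXn2r; rewrite ?nnegrE ?addr_ge0.
  by apply: le_trans hD _; have := sqr_ge0 (n%:R^-1 - u w); nra.
rewrite ge0_integralD//; last 2 first.
- by move=> w _; rewrite mule_ge0//; exact: nneseries_ge0.
- exact: measurable_funeM.
rewrite integral_probability_cst.
rewrite ge0_integralZl_EFin//; last by move=> w _; exact: nneseries_ge0.
rewrite integral_nneseries//.
have -> : (stair_error n)%:E = (K%:E +
    (4 * A * ((1 + q * (2 / (1 - q))) / (1 - q)) * expR (- b * n%:R))%:E)%E.
  by rewrite -EFinD.
apply: leeD => //.
have Q0 : 0 <= 2 * A * expR (- b * n%:R) by rewrite !mulr_ge0// expR_ge0.
apply: (@le_trans _ _ (2%:E * (2 * A * expR (- b * n%:R) * ((1 + q * (2 / (1 - q))) / (1 - q)))%:E)%E); last first.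
  by rewrite -EFinM lee_fin le_eqVlt; apply/orP; left; apply/eqP; ring.
apply: lee_wpmul2l; first by rewrite lee_fin.
apply: lime_le; first by apply: is_cvg_nneseries => j _ _; exact: integral_ge0.
apply: nearW => J.
apply: (@le_trans _ _ (\sum_(0 <= j < J) ((2 * A * expR (- b * n%:R)) * ((2 * j + 1)%:R * q ^+ j))%:E)%E).
  apply: lee_sum => j _; rewrite integral_cindic//.
  rewrite mulrCA EFinM; apply: lee_wpmul2l; first by rewrite lee_fin.
  exact: prob_big_dev.
rewrite sumEFin lee_fin big_mkord -mulr_sumr ler_wpM2l//.
exact: geometric_layers.
Qed.

Lemma stair_error_small e : 0 < e -> exists2 n, (0 < n)%N & stair_error n <= e.
Proof.
move=> e0; pose G := 4 * A * ((1 + q * (2 / (1 - q))) / (1 - q)).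
have [q0 q1] := andP q01; have q10 : 0 < 1 - q by rewrite subr_gt0.
have G0 : 0 <= G.
  apply: mulr_ge0; first exact: mulr_ge0.
  apply: divr_ge0 (ltW q10); apply: addr_ge0 => //; apply: mulr_ge0 => //.
  by apply: divr_ge0 (ltW q10).
have B0 : 0 <= (2 + G / b) / e by rewrite divr_ge0 ?addr_ge0 ?divr_ge0// ltW.
exists (Num.bound ((2 + G / b) / e)).+1 => //; set n := _.+1.
have n0 : 0 < n%:R :> R by [].
have := archi_boundP B0; rewrite ltr_pdivrMr// => h.
have hn : 2 + G / b <= n%:R * e.
  by apply: ltW; apply: lt_le_trans h _; rewrite ler_wpM2r ?(ltW e0)// ler_nat.
apply: (@le_trans _ _ ((2 + G / b) / n%:R)); last by rewrite ler_pdivrMr// [leRHS]mulrC.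
rewrite mulrDl /stair_error -/q -/G lerD//.
  by rewrite ler_wpM2l// lef_pV2 ?posrE ?exprn_gt0// expr2 ler_peMl ?ler1n.
rewrite -mulrA ler_wpM2l// mulNr expRN -invfM lef_pV2 ?posrE ?expR_gt0 ?mulr_gt0//.
by apply: le_trans (expR_ge1Dx _); rewrite lerDr.
Qed.

End stair_approximation.

Lemma density_probability d (U : measurableType d) (R : realType)
    (lam : {measure set U -> \bar R}) (w : U -> R) :
  measurable_fun setT w -> (forall x, 0 <= w x) ->
  (\int[lam]_x (w x)%:E = 1)%E ->
  exists nu : probability U R,
    forall A, nu A = (\int[lam]_(x in A) (w x)%:E)%E.
Proof.
move=> mw w0 w1; pose nu A := (\int[lam]_(x in A) (w x)%:E)%E.
have nu0 : nu set0 = 0%E by exact: integral_set0.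
have nu_ge0 A : (0 <= nu A)%E by apply: integral_ge0 => x _; rewrite lee_fin.
have nu_sa : semi_sigma_additive nu.
  apply: semi_sigma_additive_nng_induced; first exact/measurable_EFinP.
  by move=> x; rewrite lee_fin.
pose S := @isMeasure.Build _ U R nu nu0 nu_ge0 nu_sa.
pose nuM : {measure set U -> \bar R} := HB.pack nu S.
pose S' := @Measure_isProbability.Build _ _ _ nuM w1.
by exists (HB.pack_for (probability U R) (nuM : set U -> \bar R) nuM S').
Qed.

(** * The limit variable *)

Section limit_variable.
Context (R : realType) (m : nat).
Local Notation T := (m.-tuple R).
Variables (mu : probability T R) (f : T -> R) (a : nat) (psi : R).
Local Notation lam := (@lebesgue_tuple R m).
Local Notation leb := (@lebesgue_measure R).
Local Notation RR := (measurableTypeR R).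
Hypothesis mf : measurable_fun setT f.
Variable M : R.
Hypothesis f0M : forall x, 0 <= f x <= M.
Let f0 x : 0 <= f x. Proof. by case/andP: (f0M x). Qed.
Hypothesis muE : forall A, measurable A -> mu A = (\int[lam]_(x in A) (f x)%:E)%E.

Definition gamma_density (t : R) : R := \1_`]0, +oo[%classic t * poisson_mass a t.

(** Joint density of X and an independent Gamma variable of shape [a.+1], which plays the part of k.
    It vanishes where f x = 0 or t <= 0, so the default values of [ln] there carry no mass. *)
Definition limit_density (z : T * RR) : R := f z.1 * gamma_density z.2.

Definition limit_var (z : T * RR) : R := ln z.2 - psi - ln (f z.1).

Let poisson_mass_ge0 (t : R) : 0 <= t -> 0 <= poisson_mass a t.
Proof. by move=> t0; rewrite mulr_ge0 ?expR_ge0// mulr_ge0 ?invr_ge0 ?exprn_ge0. Qed.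

Lemma gamma_density_ge0 t : 0 <= gamma_density t.
Proof.
rewrite /gamma_density indicE; have [|_] := boolP (t \in _); last by rewrite mul0r.
by rewrite inE/= in_itv/= andbT mul1r => /ltW /poisson_mass_ge0.
Qed.

Lemma measurable_gamma_density : measurable_fun setT gamma_density.
Proof.
apply: measurable_funM; last exact: measurable_poisson_mass.
by apply: measurable_indic; exact: measurable_itv.
Qed.

Lemma measurable_limit_density : measurable_fun setT limit_density.
Proof.
apply: measurable_funM; first exact: measurableT_comp.
by apply: (measurableT_comp measurable_gamma_density).
Qed.

Lemma limit_density_ge0 z : 0 <= limit_density z.
Proof. by rewrite mulr_ge0// gamma_density_ge0. Qed.

Lemma measurable_limit_var : measurable_fun setT limit_var.
Proof.
apply: measurable_funB.
  apply: measurable_funB => //.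
  by apply: (@measurableT_comp _ _ _ _ _ _ (@ln R)).
apply: (@measurableT_comp _ _ _ _ _ _ (@ln R)); first exact: measurable_ln.
exact: measurableT_comp.
Qed.

(** Tonelli with the Gamma variable innermost. The inner integral is prescribed only where f x > 0,
    as [limit_var] has its intended meaning only there. *)
Lemma integral_limit_density (A : set (T * RR)) (g : T -> R) : measurable A ->
  (forall x, 0 <= g x) -> measurable_fun setT g ->
  (forall x, (0 < f x)%R -> \int[leb]_t (\1_A (x, t) * gamma_density t)%:E = (g x)%:E)%E ->
  (\int[lam \x leb]_(z in A) (limit_density z)%:E = \int[mu]_x (g x)%:E)%E.
Proof.
move=> mA g0 mg gE.
rewrite (integral_density mf f0 muE); last 2 first.
- exact/measurable_EFinP.
- by move=> x; rewrite lee_fin.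
rewrite [LHS]integral_mkcond.
pose D z : R := \1_A z * limit_density z.
have mD : measurable_fun setT D.
  by apply: measurable_funM; [exact: measurable_indic|exact: measurable_limit_density].
have D0 z : 0 <= D z by rewrite mulr_ge0// limit_density_ge0.
transitivity (\int[lam \x leb]_z (D z)%:E)%E.
  apply: eq_integral => z _; rewrite patchE /D indicE.
  by case: ifP => _; rewrite ?mul1r ?mul0r.
rewrite (@fubini_tonelli1 _ _ _ _ R lam leb (EFin \o D)); last 2 first.
- exact/measurable_EFinP.
- by move=> z; rewrite lee_fin.
apply: eq_integral => x _; rewrite /fubini_F /=.
have [fx0|fx0] := eqVneq (f x) 0.
  rewrite fx0 mule0 integral0_eq// => t _.
  by rewrite /D /limit_density /= fx0 mul0r mulr0.
rewrite -gE ?lt_neqAle ?f0 1?eq_sym ?fx0// muleC.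
rewrite -ge0_integralZl_EFin//.
- by apply: eq_integral => t _; rewrite -EFinM /D /limit_density/=; congr EFin; ring.
- by move=> t _; rewrite lee_fin mulr_ge0// gamma_density_ge0.
- apply/measurable_EFinP; apply: measurable_funM; last exact: measurable_gamma_density.
  apply: (measurableT_comp (measurable_indic mA)); exact: measurable_pair1.
Qed.

Lemma integral_limit_density1 : (\int[lam \x leb]_z (limit_density z)%:E = 1)%E.
Proof.
rewrite (@integral_limit_density setT (cst 1))//; last first.
  move=> x _; rewrite -(integral_poisson_mass_oy R a) [RHS]integral_mkcond.
  apply: eq_integral => t _; rewrite patchE /gamma_density !indicE in_setT mul1r.
  by case: ifP => _; rewrite ?mul1r ?mul0r.
rewrite (eq_integral (cst 1%E))//.
by rewrite integral_probability_cst.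
Qed.

Variable nu : probability (T * RR)%type R.
Hypothesis nuE : forall A, nu A = (\int[lam \x leb]_(x in A) (limit_density x)%:E)%E.

Lemma measurable_limit_var_gt y : measurable [set z | (y < limit_var z)%R].
Proof.
rewrite (_ : mkset _ = limit_var @^-1` `]y, +oo[%classic); last first.
  by apply/seteqP; split => w; rewrite /= in_itv/= andbT.
by rewrite -[X in measurable X]setTI; apply: measurable_limit_var.
Qed.

(** For t > 0 and f x > 0, the condition ln t - psi - ln (f x) > y reads t > c f x, and the Gamma
    tail beyond c f x is [poisson_lt] at that point. *)
Lemma limit_var_tail y :
  nu [set z | (y < limit_var z)%R] = (poisson_prob mu f a.+1 (expR (y + psi)))%:E.
Proof.
set c := expR (y + psi); have c0 : 0 <= c by exact: expR_ge0.
rewrite nuE -(poisson_probE _ _ mf f0M c0).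
apply: integral_limit_density.
- exact: measurable_limit_var_gt.
- by move=> x; rewrite poisson_lt_ge0// mulr_ge0.
- exact: measurable_poisson_density.
move=> x fx0; have l0 : 0 < c * f x by rewrite mulr_gt0// expR_gt0.
have lnl : ln (c * f x) = y + psi + ln (f x) by rewrite lnM ?posrE ?expR_gt0// expRK.
rewrite -(integral_poisson_mass a (ltW l0)) -integral_itv_obnd_cbnd; last first.
  by apply/measurable_EFinP/measurable_funTS; exact: measurable_poisson_mass.
rewrite [RHS]integral_mkcond; apply: eq_integral => t _.
rewrite patchE /gamma_density; case: ifPn => [|/negP]; rewrite inE/= in_itv/= andbT => ht.
  have t0 : 0 < t by apply: lt_trans ht.
  rewrite !indicE !mem_set ?mul1r//=; first by rewrite in_itv/= t0.
  have : ln (c * f x) < ln (t : R) by rewrite ltr_ln ?posrE.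
  by rewrite lnl /limit_var/=; lra.
have [t0|t0] := leP t 0.
  rewrite [X in _ * (X * _)]indicE memNset ?mul0r ?mulr0//=.
  by rewrite in_itv/= andbT ltNge t0.
rewrite [X in X * _]indicE memNset ?mul0r//= /limit_var/=.
by move=> h; apply: ht; rewrite -ltr_ln ?posrE// lnl; lra.
Qed.

Hypothesis psiE : psi = digamma a.+1%:R.

Let W z : R := limit_var z * limit_density z.

Let mW : measurable_fun setT W.
Proof. exact: measurable_funM measurable_limit_var measurable_limit_density. Qed.

Let integral_nu (g : T * RR -> \bar R) : measurable_fun setT g ->
  (forall z, 0 <= g z)%E ->
  (\int[nu]_z g z = \int[lam \x leb]_z (g z * (limit_density z)%:E))%E.
Proof.
apply: (@integral_density _ _ _ nu (lam \x leb)%E) => //.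
- exact: measurable_limit_density.
- exact: limit_density_ge0.
- by move=> A _; exact: nuE.
Qed.

Let integrableW : nu.-integrable setT (EFin \o limit_var) ->
  (lam \x leb)%E.-integrable setT (EFin \o W).
Proof.
move=> /integrableP[_ h]; apply/integrableP; split; first exact/measurable_EFinP.
move: h; rewrite integral_nu; last 2 first.
- by apply: measurableT_comp => //; apply/measurable_EFinP; exact: measurable_limit_var.
- by move=> z; exact: abse_ge0.
congr (_ < _)%E; apply: eq_integral => z _ /=.
by rewrite -EFinM /W normrM [X in _ = (_ * X)%:E]ger0_norm// limit_density_ge0.
Qed.

(** The mean of ln t under the Gamma density is psi, by [digamma_nat], and cancels the shift in
    [limit_var]. *)
Let inner x : (\int[leb]_t (W (x, t))%:E = (- (f x * ln (f x)))%:E)%E.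
Proof.
pose D : set RR := `]0, +oo[%classic; have mD : measurable D by exact: measurable_itv.
have i1 := integrable_ln_poisson_mass R a.
have mass1 := integral_poisson_mass_oy R a.
have i2 : leb.-integrable D (EFin \o poisson_mass a).
  apply/integrableP; split.
    by apply/measurable_EFinP/measurable_funTS; exact: measurable_poisson_mass.
  under eq_integral => t.
    rewrite inE /D/= in_itv/= andbT => t0.
    rewrite /= ger0_norm; last exact/poisson_mass_ge0/ltW.
    over.
  by rewrite mass1 ltry.
transitivity (\int[leb]_(t in D) ((f x)%:E * (ln t * poisson_mass a t)%:E -
   (f x * (psi + ln (f x)))%:E * (poisson_mass a t)%:E))%E.
  rewrite [RHS]integral_mkcond; apply: eq_integral => t _; rewrite patchE.
  rewrite /W /limit_density /gamma_density /limit_var /= indicE.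
  case: ifP => _; last by rewrite mul0r !mulr0.
  by rewrite -!EFinM -EFinB; congr EFin; rewrite mul1r; ring.
rewrite integralB//; [|exact: integrableZl|exact: integrableZl].
rewrite !integralZl// mass1 mule1.
have -> : (\int[leb]_(t in D) (ln t * poisson_mass a t)%:E = psi%:E)%E.
  by rewrite psiE digamma_nat fineK//; exact: integrable_fin_num.
by rewrite -EFinM -EFinB; congr EFin; ring.
Qed.

(** Integrability licenses Fubini with the Gamma variable innermost; it also makes f ln f
    integrable, so the sign can be taken out of the integral. *)
Lemma limit_var_mean : nu.-integrable setT (EFin \o limit_var) ->
  (\int[nu]_z (limit_var z)%:E = entropy f)%E.
Proof.
move=> iY; have iW := integrableW iY.
have mY : measurable_fun setT (EFin \o limit_var).
  by apply/measurable_EFinP; exact: measurable_limit_var.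
transitivity (\int[lam \x leb]_z (W z)%:E)%E.
  (* [integral_nu] is for nonnegative functions, so the positive and negative parts are treated
     separately. *)
  rewrite [LHS]integralE [RHS]integralE; congr (_ - _)%E.
    rewrite integral_nu//; last exact: measurable_funepos.
    apply: eq_integral => z _; rewrite !funeposE.
    by rewrite -!EFin_max -EFinM maxr_pMl ?mul0r// limit_density_ge0.
  rewrite integral_nu//; last exact: measurable_funeneg.
  apply: eq_integral => z _; rewrite !funenegE.
  by rewrite -!EFin_max -EFinM maxr_pMl ?mul0r ?mulNr// limit_density_ge0.
rewrite -(fubini1 iW).
have iF : lam.-integrable setT (fun x => (- (f x * ln (f x)))%:E).
  move: (integrable_fubini_F iW); apply: eq_integrable => // x _.
  by rewrite /fubini_F /= inner.
have iG : lam.-integrable setT (fun x => (f x * ln (f x))%:E).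
  have := integrableN iF; apply: eq_integrable => // x _.
  by rewrite /= opprK.
rewrite /fubini_F /= /entropy -mulN1e -EFinN -integralZl//.
by apply: eq_integral => x _; rewrite inner -EFinM mulN1r.
Qed.

End limit_variable.

(** In the sorted list the entries at most r form an initial segment; its length is below k exactly
    when the entry at position k - 1 exceeds r. *)
Lemma lt_nth_sort (R : realType) (s : seq R) (k : nat) (r : R) : (0 < k)%N ->
  (k <= size s)%N ->
  (r < nth 0 (sort <=%R s) k.-1) = (count (fun v => (v <= r)%R) s < k)%N.
Proof.
move=> k0 ks; set s' := sort _ s.
have ss' : size s' = size s by rewrite size_sort.
have k1s : (k.-1 < size s')%N by rewrite ss' prednK.
have sorted_s' : sorted <=%R s' by apply: sort_sorted; exact: le_total.
have mono i j : (i <= j)%N -> (j < size s')%N -> nth 0 s' i <= nth 0 s' j.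
  move=> ij js; apply: (sorted_leq_nth le_trans lexx 0 sorted_s') => //.
  by rewrite inE (leq_ltn_trans ij).
rewrite -(permP (permEl (perm_sort <=%R s))) -/s'.
have [lt_r|le_r] := ltP r (nth 0 s' k.-1).
  apply/esym; rewrite -(cat_take_drop k.-1 s') count_cat.
  have -> : count (fun v => (v <= r)%R) (drop k.-1 s') = 0%N.
    apply/eqP; rewrite -leqn0 leqNgt -has_count; apply/hasPn => v /(nthP 0)[j].
    rewrite size_drop nth_drop => jl <-; rewrite -ltNge; apply: lt_le_trans lt_r _.
    by apply: mono; [exact: leq_addr|rewrite -ltn_subRL].
  rewrite addn0; apply: leq_ltn_trans (count_size _ _) _.
  by rewrite size_take k1s prednK.
apply/esym/negbTE; rewrite -leqNgt -(cat_take_drop k s') count_cat.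
apply: leq_trans (leq_addr _ _); rewrite -[X in (X <= _)%N](_ : size (take k s') = k); last first.
  by rewrite size_takel// ss'.
rewrite leq_eqVlt eq_sym -all_count; apply/orP; left; apply/allP => v /(nthP 0)[j].
rewrite size_takel ?ss'// => jk; rewrite nth_take// => <-; apply: le_trans le_r.
by apply: mono => //; rewrite -ltnS prednK.
Qed.

(** * The estimator *)

Section knn_lonely.
Context (R : realType) d (Omega : measurableType d) (P : probability Omega R).
Context (m : nat).
Local Notation T := (m.-tuple R).
Variables (X : nat -> {RV P >-> T}) (k : nat).
Hypothesis k0 : (0 < k)%N.

(** On this event the finite set [sample] has N elements, matched one to one with the indices; ties
    would merge points and change the neighbour counts. *)
Definition distinct_sample N : set Omega :=
  [set w | forall i j, (i < N)%N -> (j < N)%N -> i != j -> 0 < edist (X i w) (X j w)].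

Lemma distinct_neq N w i j : distinct_sample N w -> (i < N)%N -> (j < N)%N ->
  X i w = X j w -> i = j.
Proof.
move=> dw iN jN Xij; apply/eqP; apply: contraT => ij.
have := dw i j iN jN ij; have /eqP -> : edist (X i w) (X j w) == 0; last by rewrite ltxx.
by rewrite Xij edist_eq0.
Qed.

Lemma perm_sample N w i : distinct_sample N w -> (i < N)%N ->
  perm_eq (enum_fset (sample X N w `\ X i w)%fset) [seq X l w | l <- others N i].
Proof.
move=> dw iN; have mo l : l \in others N i = (l != i) && (l < N)%N.
  by rewrite /others mem_rem_uniq ?iota_uniq// inE mem_iota.
have uo : uniq (others N i) by case/andP: (uniq_others N i).
apply: uniq_perm; first exact: fset_uniq.
  rewrite map_inj_in_uniq// => a b; rewrite !mo => /andP[_ aN] /andP[_ bN].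
  by move/(distinct_neq dw aN bN).
move=> y; rewrite in_fsetD1; apply/andP/mapP.
  move=> [yi /imfsetP[/= l _ yl]]; exists (val l) => //; rewrite mo ltn_ord andbT.
  by apply: contra yi => /eqP li; rewrite yl li.
move=> [l]; rewrite mo => /andP[li lN] ->; split.
  by apply: contra li => /eqP /(distinct_neq dw lN iN) ->.
by apply/imfsetP; exists (Ordinal lN).
Qed.

Lemma lt_knn_dist N w i r : distinct_sample N w -> (i < N)%N -> (k < N)%N ->
  (r < knn_dist k (X i w) (sample X N w)) = (w \in lonely X k N r i).
Proof.
move=> dw iN kN; have pe := perm_sample dw iN.
have N0 : (0 < N)%N by exact: leq_ltn_trans kN.
rewrite /knn_dist lt_nth_sort//; last first.
  by rewrite size_map (perm_size pe) size_map size_others// -ltnS prednK.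
rewrite count_map (permP pe) count_map.
by apply/idP/idP; rewrite inE.
Qed.

Lemma knn_dist_gt0 N w i : distinct_sample N w -> (i < N)%N -> (k < N)%N ->
  0 < knn_dist k (X i w) (sample X N w).
Proof.
move=> dw iN kN; rewrite lt_knn_dist// inE /lonely /few_near /=.
rewrite (_ : count _ _ = 0%N)//; apply/eqP; rewrite -leqn0 leqNgt -has_count.
apply/hasPn => l; rewrite /others mem_rem_uniq ?iota_uniq// inE mem_iota => /andP[li lN].
by rewrite -ltNge dw// eq_sym.
Qed.

Variable V : R.
Hypothesis V0 : 0 < V.
Hypothesis m0 : (0 < m)%N.
Variable psi : R.

Definition log_volume N i w : R :=
  ln (knn_dist k (X i w) (sample X N w) ^+ m * V * (N%:R - 1) * expR (- psi)).

Lemma lt_log_volume N w i y : distinct_sample N w -> (i < N)%N -> (k < N)%N ->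
  (y < log_volume N i w) = (w \in lonely X k N (radius m V N (expR (y + psi))) i).
Proof.
move=> dw iN kN; have N1 : (1 < N)%N by exact: leq_ltn_trans kN.
have N0 : (0 < N)%N by exact: ltn_trans N1.
have kd0 := knn_dist_gt0 dw iN kN.
have Np : 0 < N.-1%:R :> R by rewrite ltr0n; case: N N1 {N0 dw iN kN kd0} => [|[]].
have NE : N%:R - 1 = N.-1%:R :> R by rewrite -[in N%:R](prednK N0) -natr1 addrK.
rewrite -lt_knn_dist// /log_volume NE; set K := knn_dist _ _ _ in kd0 *.
have r0 := radius_gt0 m V0 N1 (expR_gt0 (y + psi)).
have := radiusE V0 m0 N1 (expR_gt0 (y + psi)); set r := radius _ _ _ _ in r0 * => rE.
rewrite -[y]expRK ltr_ln ?posrE ?mulr_gt0 ?exprn_gt0 ?expR_gt0//.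
transitivity (r ^+ m < K ^+ m); last by rewrite ltr_pXn2r ?nnegrE ?ltW.
rewrite expRN ltr_pdivlMr ?expR_gt0// -expRD -rE.
rewrite -mulrA [V * _]mulrC [_ * (_ * V)]mulrA [_ * (_ * V)]mulrA ltr_pM2r//.
by rewrite mulrC ltr_pM2r.
Qed.

Lemma measurable_distinct_sample N : measurable (distinct_sample N).
Proof.
rewrite (_ : distinct_sample N = \bigcap_i \bigcap_j
   (if (i < N)%N && (j < N)%N && (i != j) then ~` [set w | edist (X i w) (X j w) <= 0]
    else setT)); last first.
  apply/seteqP; split => w dw.
    move=> i _ j _; case: ifPn => // /andP[/andP[iN jN] ij] /=.
    by apply/negP; rewrite -ltNge dw.
  move=> i j iN jN ij; have := dw i I j I; rewrite iN jN ij /= => /negP.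
  by rewrite -ltNge.
apply: bigcapT_measurable => i; apply: bigcapT_measurable => j.
case: ifPn => // _; apply: measurableC; exact: measurable_edistX.
Qed.

(** Set to 0 on samples with ties. Its superlevel sets are then built from [lonely] and
    [distinct_sample], which gives measurability. *)
Definition log_volume' N i w : R := \1_(distinct_sample N) w * log_volume N i w.

Lemma measurable_log_volume' N i : (i < N)%N -> (k < N)%N ->
  measurable_fun setT (log_volume' N i).
Proof.
move=> iN kN mT; apply: (measurability _ (RGenOInfty.measurableE R)) => // _ [_ [y ->] <-].
rewrite setTI.
rewrite (_ : _ @^-1` _ = (distinct_sample N `&` lonely X k N (radius m V N (expR (y + psi))) i) `|`
   (if y < 0 then ~` distinct_sample N else set0)); last first.
  apply/seteqP; split => w /=; rewrite in_itv/= andbT /log_volume' indicE.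
    have [dw|dw] := boolP (w \in distinct_sample N).
      move: (dw); rewrite inE mul1r => dw'; rewrite lt_log_volume// inE.
      by left.
    rewrite mul0r => ->; right; move/negP: dw; by rewrite inE.
  case=> [[dw]|].
    by rewrite (mem_set dw) mul1r lt_log_volume// inE.
  by case: ifP => // y0 dw; rewrite memNset// mul0r.
apply: measurableU.
  by apply: measurableI; [exact: measurable_distinct_sample|exact: measurable_lonely].
by case: ifP => // _; apply: measurableC; exact: measurable_distinct_sample.
Qed.

End knn_lonely.

(** * Ties have probability zero *)

Section distinct_almost_surely.
Context (R : realType) d (Omega : measurableType d) (P : probability Omega R).
Context (m : nat).
Local Notation T := (m.-tuple R).
Variables (X : nat -> {RV P >-> T}) (mu : probability T R) (f : T -> R) (M V : R).
Local Notation lam := (@lebesgue_tuple R m).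
Hypothesis hlaw : forall i A, measurable A -> P (X i @^-1` A) = mu A.
Hypothesis hind : mutually_independent X.
Hypothesis m0 : (0 < m)%N.
Hypothesis V0 : 0 < V.
Hypothesis lebesgueV : forall x r, 0 < r -> lam (cball x r) = (r ^+ m * V)%:E.
Hypothesis mf : measurable_fun setT f.
Hypothesis f0M : forall x, 0 <= f x <= M.
Hypothesis muE : forall A, measurable A -> mu A = (\int[lam]_(x in A) (f x)%:E)%E.

Lemma prob_edist0 i j : i != j -> P [set w | edist (X i w) (X j w) <= 0] = 0%E.
Proof.
move=> ij; have M0 : 0 <= M.
  by case/andP: (f0M [tuple 0 | i < m]) => h1; exact: le_trans.
apply/eqP; rewrite eq_le measure_ge0 andbT; apply/lee_addgt0Pr => e e0; rewrite add0e.
(* Two points are within r of each other with probability at most M r^m V; this r makes the bound at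
   most e. *)
pose v := e / (M * V + 1); pose r := v `^ (m%:R^-1).
have B0 : 0 < M * V + 1 by rewrite ltr_wpDl// mulr_ge0// ltW.
have v0 : 0 < v by rewrite divr_gt0.
have r0 : 0 < r by rewrite powR_gt0.
have rE : r ^+ m = v.
  by rewrite /r -powR_mulrn ?powR_ge0// -powRrM mulVf ?pnatr_eq0 -?lt0n// powRr1// ltW.
apply: (@le_trans _ _ (P [set w | edist (X i w) (X j w) <= r])).
  apply: le_measure; rewrite ?inE; try exact: measurable_edistX.
  by move=> w /= /le_trans; apply; exact: ltW.
rewrite (prob_edist_le hlaw hind r ij).
apply: le_trans (integral_ball_prob_le lebesgueV mf f0M muE r0) _.
rewrite lee_fin rE (_ : M * (v * V) = e * (M * V / (M * V + 1))); last first.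
  by rewrite /v; field; rewrite gt_eqF.
by rewrite ler_piMr ?(ltW e0)// ler_pdivrMr// mul1r lerDl.
Qed.

Lemma prob_not_distinct N : P (~` distinct_sample X N) = 0%E.
Proof.
apply/eqP; rewrite eq_le measure_ge0 andbT.
pose B i j := if (i != j) then [set w | edist (X i w) (X j w) <= 0] else set0.
have mB i j : measurable (B i j).
  by rewrite /B; case: ifP => // _; exact: measurable_edistX.
have PB i j : P (B i j) = 0%E.
  by rewrite /B; case: ifP => // ij; exact: prob_edist0.
apply: (@le_trans _ _ (P (\big[setU/set0]_(i < N) \big[setU/set0]_(j < N) B i j))).
  apply: le_measure; rewrite ?inE.
  - by apply: measurableC; exact: measurable_distinct_sample.
  - by apply: bigsetU_measurable => i _; exact: bigsetU_measurable.
  move=> w dw; apply: contrapT => nB; apply: dw => i j iN jN ij.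
  rewrite ltNge; apply/negP => le0; apply: nB.
  rewrite -(bigcup_mkord _ (fun i => \big[setU/set0]_(j < N) B i j)).
  exists i => //; rewrite -(bigcup_mkord _ (B i)); exists j => //.
  by rewrite /B ij.
apply: le_trans (Boole_inequality P (A := fun i => \big[setU/set0]_(j < N) B i j) _) _.
  by move=> i _; exact: bigsetU_measurable.
rewrite big1// => i _; apply/eqP; rewrite eq_le measure_ge0 andbT.
apply: le_trans (Boole_inequality P (A := B i) _) _ => //.
by rewrite big1// => j _; exact: PB.
Qed.

End distinct_almost_surely.

Lemma sqr_sum_le (R : realType) n (u : 'I_n -> R) :
  (\sum_(i < n) u i) ^+ 2 <= n%:R * \sum_(i < n) u i ^+ 2.
Proof.
rewrite expr2 big_distrlr/=.
apply: (@le_trans _ _ (\sum_(i < n) \sum_(j < n) ((u i ^+ 2 + u j ^+ 2) / 2))).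
  apply: ler_sum => i _; apply: ler_sum => j _.
  by have := sqr_ge0 (u i - u j); lra.
rewrite le_eqVlt; apply/orP; left; apply/eqP.
set S := \sum_(i < n) u i ^+ 2.
transitivity (\sum_(i < n) (u i ^+ 2 *+ n + S) / 2).
  by apply: eq_bigr => i _; rewrite -mulr_suml big_split/= sumr_const card_ord.
rewrite -mulr_suml big_split/= sumr_const card_ord sumrMnl -/S.
by rewrite -mulr_natl; field.
Qed.

Lemma normr_stair (R : realType) n (y : R) : (0 < n)%N -> `|stair n y| <= n%:R.
Proof.
move=> n0; have np : 0 < n%:R :> R by rewrite ltr0n.
rewrite /stair; set S := \sum_(_ < _) _; have S0 : 0 <= S by exact: sumr_ge0.
have S1 : S <= (2 * n ^ 2)%:R.
  rewrite -[X in X%:R]card_ord -sumr_const; apply: ler_sum => j _.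
  by case: (_ < _).
have h0 : 0 <= n%:R^-1 * S by rewrite mulr_ge0 ?invr_ge0.
have h1 : n%:R^-1 * S <= 2 * n%:R.
  rewrite mulrC ler_pdivrMr//; apply: le_trans S1 _.
  by rewrite -mulrA -expr2 natrM natrX.
by rewrite ler_norml; lra.
Qed.

(** * Tails after the shift by psi *)

Section shifted_tails.
Context (R : realType) (K M s psi : R).
Hypotheses (K0 : 0 <= K) (M0 : 0 <= M) (s0 : 0 < s) (s1 : s <= 1).

(** The added 1 covers y + psi < 0, where the only bound is G <= 1 <= e^(-s (y + psi)). The last
    term is the lower tail M e^(psi - y), and e^(-y) <= e^(-s y) because s <= 1. *)
Definition shifted_const : R := (K + 1) * expR (- s * psi) + M * expR psi.

Lemma shifted_const_ge0 : 0 <= shifted_const.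
Proof. by rewrite addr_ge0// mulr_ge0 ?expR_ge0// addr_ge0. Qed.

Lemma shifted_tails (G : R -> R) : (forall L, 0 <= G L <= 1) ->
  (forall L, 0 <= L -> G L <= K * expR (- s * L)) ->
  (forall L, 1 - G L <= M * expR L) ->
  forall y, 0 <= y -> G (y + psi) <= shifted_const * expR (- s * y) /\
    1 - G (- y + psi) <= shifted_const * expR (- s * y).
Proof.
move=> G01 GK GM y y0; have Ey := expR_ge0 (- s * y).
have Ep := expR_ge0 (- s * psi); have Em := mulr_ge0 M0 (expR_ge0 psi).
rewrite /shifted_const !mulrDl mul1r; split.
  have E : expR (- s * psi) * expR (- s * y) = expR (- s * (y + psi)).
    by rewrite -expRD; congr expR; ring.
  rewrite -[K * _ * _]mulrA E.
  apply: (@le_trans _ _ (K * expR (- s * (y + psi)) + expR (- s * (y + psi)))); last first.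
    by rewrite lerDl; exact: mulr_ge0.
  have [h|h] := leP 0 (y + psi).
    by apply: le_trans (GK _ h) _; rewrite lerDl expR_ge0.
  have /andP[_ G1] := G01 (y + psi); apply: le_trans G1 _.
  rewrite -[leLHS]add0r lerD//; first by rewrite mulr_ge0// expR_ge0.
  rewrite -[leLHS]expR0 ler_expR mulNr -mulrN; apply: mulr_ge0; first exact: ltW.
  by rewrite oppr_ge0 ltW.
apply: le_trans (GM _) _; rewrite -[leLHS]add0r; apply: lerD.
  by apply: addr_ge0; apply: mulr_ge0 => //; exact: mulr_ge0.
rewrite expRD [expR (- y) * _]mulrC mulrA; apply: ler_wpM2l => //.
by rewrite ler_expR mulNr lerN2 ler_piMl.
Qed.

End shifted_tails.

Lemma measurable_stair (R : realType) n : measurable_fun setT (@stair R n).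
Proof.
apply: measurable_funD => //; apply: measurable_funM => //.
apply: measurable_sum => j; set t := _ + _ / _.
rewrite (_ : (fun y => _) = \1_`]t, +oo[%classic).
  by apply: measurable_indic; exact: measurable_itv.
apply/funext => y; rewrite indicE.
by have -> : (t < y) = (y \in `]t, +oo[%classic) by apply/idP/idP; rewrite inE/= in_itv/= andbT.
Qed.

(** * Mean-square convergence of the estimator *)

Section convergence.
Context (R : realType) d (Omega : measurableType d) (P : probability Omega R).
Context (m : nat).
Local Notation T := (m.-tuple R).
Variables (X : nat -> {RV P >-> T}) (mu : probability T R) (f : T -> R) (M V : R).
Local Notation lam := (@lebesgue_tuple R m).
Hypothesis hlaw : forall i A, measurable A -> P (X i @^-1` A) = mu A.
Hypothesis hind : mutually_independent X.
Variable a : nat.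
Local Notation k := a.+1.
Hypothesis V0 : 0 < V.
Hypothesis lebesgueV : forall x r, 0 < r -> lam (cball x r) = (r ^+ m * V)%:E.
Hypothesis mf : measurable_fun setT f.
Hypothesis f0M : forall x, 0 <= f x <= M.
Hypothesis muE : forall A, measurable A -> mu A = (\int[lam]_(x in A) (f x)%:E)%E.
Hypothesis m0 : (0 < m)%N.
Variables (C alpha : R).
Hypothesis C0 : 0 <= C.
Hypothesis alpha0 : 0 < alpha.
Hypothesis tailC : forall z : R, (norm_tail mu (expR z) <= (C * expR (- alpha * z))%:E)%E.

Local Notation psi := (digamma (k%:R : R)).
Local Notation s := (tail_rate m alpha).
Local Notation K := (tail_const m V k C alpha).

Let M0 : 0 <= M.
Proof. by case/andP: (f0M [tuple 0 | i < m]) => h1; exact: le_trans. Qed.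

Let s0 : 0 < s. Proof. exact: tail_rate_gt0. Qed.

Let s1 : s <= 1.
Proof.
have a0 : 0 < alpha / m%:R by rewrite divr_gt0// ltr0n.
by rewrite /tail_rate ler_pdivrMr; lra.
Qed.

Let K0 : 0 <= K.
Proof.
by rewrite /tail_const !addr_ge0// ?mulr_ge0 ?exprn_ge0 ?expR_ge0 ?mulr_ge0// ltW.
Qed.

Local Notation A := (shifted_const K M s psi).

Let A0 : 0 <= A. Proof. exact: shifted_const_ge0. Qed.

Let GN N L := few_near_prob mu k N.-1 (radius m V N (expR L)).

Let GN_tail N y : (k < N)%N -> 0 <= y ->
  GN N (y + psi) <= A * expR (- s * y) /\ 1 - GN N (- y + psi) <= A * expR (- s * y).
Proof.
move=> kN; have N1 : (1 < N)%N by exact: leq_ltn_trans kN.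
apply: (@shifted_tails _ _ _ _ _ K0 M0 s0 s1 (GN N)) => L; first exact: few_near_prob_itv.
  move=> L0; apply: (few_near_prob_tail hlaw hind V0 m0 _ C0 alpha0 tailC) => //.
    by apply: radius_gt0 => //; exact: expR_gt0.
  by apply: radiusE => //; exact: expR_gt0.
have r0 := radius_gt0 m V0 N1 (expR_gt0 L).
apply: le_trans (few_near_prob_ge lebesgueV mf f0M muE N.-1 (ltn0Sn a) r0) _.
by rewrite mulrCA (radiusE V0 m0 N1 (expR_gt0 L)).
Qed.

Let Ginf_tail y : 0 <= y -> poisson_prob mu f k (expR (y + psi)) <= A * expR (- s * y) /\
  1 - poisson_prob mu f k (expR (- y + psi)) <= A * expR (- s * y).
Proof.
apply: (@shifted_tails _ _ _ _ _ K0 M0 s0 s1 (fun L => poisson_prob mu f k (expR L))) => L.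
- exact: (poisson_prob_itv mu k mf f0M (expR_ge0 L)).
- exact: (poisson_prob_tail hlaw hind V0 lebesgueV mf f0M muE m0 _ C0 alpha0 tailC).
- exact: (poisson_prob_ge V0 lebesgueV mf f0M muE m0 _ (expR_gt0 L)).
Qed.

Local Notation Y N i := (log_volume' X k V psi N i).

Let measurable_Y N i : (i < N)%N -> (k < N)%N -> measurable_fun setT (Y N i).
Proof. exact: measurable_log_volume'. Qed.

Let prob_notD N : P (~` distinct_sample X N) = 0%E.
Proof. exact: (prob_not_distinct hlaw hind m0 V0 lebesgueV mf f0M muE). Qed.

(** Ties form a null event, so an inclusion checked off ties is enough. *)
Let prob_Y_le N (B : set Omega) (E : set Omega) : measurable B -> measurable E ->
  (forall w, distinct_sample X N w -> B w -> E w) -> (P B <= P E)%E.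
Proof.
move=> mB mE BE.
have mD : measurable (~` distinct_sample X N) by apply: measurableC; exact: measurable_distinct_sample.
apply: (@le_trans _ _ (P (E `|` ~` distinct_sample X N))).
  apply: le_measure; rewrite ?inE//; first exact: measurableU.
  move=> w Bw; have [dw|dw] := pselect (distinct_sample X N w); last by right.
  by left; exact: BE.
apply: le_trans (measureU2 _ mE mD) _.
by rewrite [X in (_ + X)%E](_ : _ = 0%E) ?adde0//; exact: prob_notD.
Qed.

Let Yd N i w : distinct_sample X N w -> Y N i w = log_volume X k V psi N i w.
Proof. by move=> dw; rewrite /log_volume' indicE mem_set// mul1r. Qed.

Lemma log_volume_approx N i n : (i < N)%N -> (k < N)%N -> (0 < n)%N ->
  (\int[P]_w ((Y N i w - stair n (Y N i w)) ^+ 2)%:E <= (stair_error A s n)%:E)%E.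
Proof.
move=> iN kN n0; have mY := measurable_Y iN kN.
have lonelyP L : P (lonely X k N (radius m V N (expR L)) i) = (GN N L)%:E.
  exact: prob_lonely.
apply: (stair_approx mY A0 s0) => // y y0; have [h1 h2] := GN_tail kN y0.
  apply: (@le_trans _ _ (GN N (y + psi))%:E); last by rewrite lee_fin.
  rewrite -lonelyP; apply: (@prob_Y_le N); last 2 first.
  - exact: measurable_lonely.
  - by move=> w dw; rewrite /= Yd// (lt_log_volume _ V0 m0)// inE.
  rewrite (_ : mkset _ = Y N i @^-1` `]y, +oo[%classic); last first.
    by apply/seteqP; split => w; rewrite /= in_itv/= andbT.
  by rewrite -[X in measurable X]setTI; apply: mY.
apply: (@le_trans _ _ (1 - GN N (- y + psi))%:E); last by rewrite lee_fin.
rewrite EFinB -lonelyP -(probability_setC P (measurable_lonely _ _ _ _ _)).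
apply: (@prob_Y_le N); last 2 first.
- by apply: measurableC; exact: measurable_lonely.
- move=> w dw; rewrite /= Yd// => le_y lw; have := lt_log_volume (ltn0Sn a) V0 m0 psi (- y) dw iN kN.
  by rewrite (mem_set lw) ltNge le_y.
rewrite (_ : mkset _ = Y N i @^-1` `]-oo, - y]%classic); last first.
  by apply/seteqP; split => w; rewrite /= in_itv.
by rewrite -[X in measurable X]setTI; apply: mY.
Qed.

(** The mean of [stair n] of the limit variable, written with its tail probabilities. *)
Definition stair_limit n : R :=
  - n%:R + n%:R^-1 * \sum_(j < 2 * n ^ 2) poisson_prob mu f k (expR (- n%:R + j%:R / n%:R + psi)).

(** The tails inherited from finite samples make the limit variable integrable, so its mean, the
    entropy, is a real number. The squared difference of the means is at most the mean squared
    difference. *)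
Lemma entropy_approx : exists2 h : R, entropy f = h%:E &
  forall n, (0 < n)%N -> (stair_limit n - h) ^+ 2 <= stair_error A s n.
Proof.
have [nu nuE] := density_probability (measurable_limit_density a mf)
  (limit_density_ge0 a f0M) (integral_limit_density1 a mf f0M muE).
have mY := measurable_limit_var psi mf; set Z := limit_var f psi in mY.
have tailE y := limit_var_tail psi mf f0M muE nuE y.
have approx n : (0 < n)%N ->
    (\int[nu]_w ((Z w - stair n (Z w)) ^+ 2)%:E <= (stair_error A s n)%:E)%E.
  apply: (stair_approx mY A0 s0) => // y y0; have [h1 h2] := Ginf_tail y0.
    by rewrite tailE lee_fin.
  rewrite (_ : mkset _ = ~` [set w | - y < Z w]); last first.
    by apply/seteqP; split => w /=; rewrite leNgt => /negP.
  rewrite (probability_setC nu (measurable_limit_var_gt psi mf _)).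
  by rewrite [X in (_ - X)%E]tailE -EFinB lee_fin.
(* Z differs from the bounded function [stair 1] of Z by a function with finite second moment; |x|
   <= (x^2 + 1) / 2 then bounds |Z| by 2 plus a square. *)
have iZ : nu.-integrable setT (EFin \o Z).
  apply/integrableP; split; first exact/measurable_EFinP.
  have mZ1 : measurable_fun setT (fun w => (Z w - stair 1 (Z w)) ^+ 2).
    apply: measurable_funX; apply: measurable_funB => //.
    by apply: measurableT_comp => //; exact: measurable_stair.
  apply: (@le_lt_trans _ _ (\int[nu]_w ((cst 2%:E) w + ((Z w - stair 1 (Z w)) ^+ 2)%:E))%E).
    apply: integralT_le => w; first exact: abse_ge0.
    rewrite /= lee_fin; set z := Z w; have h1 := @normr_stair R 1 z isT.
    have h2 := sqr_ge0 (`|z - stair 1 z| - 1).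
    have h3 : `|z| <= `|z - stair 1 z| + `|stair 1 z|.
      by rewrite -[X in `|X| <= _](subrK (stair 1 z)) ler_normD.
    have h4 : `|z - stair 1 z| ^+ 2 = (z - stair 1 z) ^+ 2 by rewrite real_normK ?num_real.
    have h5 := normr_ge0 (z - stair 1 z); rewrite -h4; nra.
  rewrite ge0_integralD//; last 3 first.
  - by move=> w _; rewrite lee_fin.
  - by move=> w _; rewrite lee_fin sqr_ge0.
  - exact/measurable_EFinP.
  rewrite integral_probability_cst.
  by apply: lte_add_pinfty; rewrite ?ltry// (le_lt_trans (approx 1%N isT))// ltry.
have hE := limit_var_mean mf f0M nuE erefl iZ.
have : (\int[nu]_z (Z z)%:E)%E \is a fin_num by exact: integrable_fin_num.
rewrite [X in X \is a fin_num]hE => hfin; exists (fine (entropy f)); first by rewrite fineK.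
move=> n n0; set h := fine _; have hh : (\int[nu]_z (Z z)%:E = h%:E)%E by rewrite /h fineK.
pose F w := stair n (Z w).
have mF : measurable_fun setT F by apply: measurableT_comp => //; exact: measurable_stair.
have iF : nu.-integrable setT (EFin \o F).
  apply/integrableP; split; first exact/measurable_EFinP.
  apply: (@le_lt_trans _ _ (\int[nu]_w (cst n%:R%:E w))%E).
    apply: integralT_le => w; first exact: abse_ge0.
    by rewrite /= lee_fin normr_stair.
  by rewrite integral_probability_cst ltry.
have icst (c : R) : nu.-integrable setT (EFin \o cst c).
  by apply: finite_measure_integrable_cst.
have intcst (c : R) : (\int[nu]_w (cst c w)%:E = c%:E)%E.
  by rewrite (eq_integral (cst c%:E))// integral_probability_cst.
pose t (j : 'I_(2 * n ^ 2)) : R := - n%:R + j%:R / n%:R.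
have intF : (\int[nu]_w (F w)%:E = (stair_limit n)%:E)%E.
  pose G w : R := n%:R^-1 * \sum_(j < 2 * n ^ 2) \1_[set z | t j < Z z] w.
  have FG w : F w = G w - cst n%:R w.
    rewrite /F /stair /G addrC; congr (_ * _ + _); apply: eq_bigr => j _.
    rewrite indicE.
    by have -> : (t j < Z w) = (w \in [set z | t j < Z z]) by apply/idP/idP; rewrite inE.
  have mG : measurable_fun setT G.
    apply: measurable_funM => //; apply: measurable_sum => j.
    by apply: measurable_indic; exact: measurable_limit_var_gt.
  have iG : nu.-integrable setT (EFin \o G).
    have := integrableD measurableT iF (icst n%:R); apply: eq_integrable => // w _ /=.
    by rewrite -EFinD FG subrK.
  under eq_integral do rewrite FG.
  rewrite integralB_EFin// intcst /stair_limit [X in _ = X%:E]addrC EFinB; congr (_ - _)%E.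
  under eq_integral do rewrite /G EFinM.
  rewrite ge0_integralZl_EFin//; last 2 first.
  - by move=> w _; rewrite lee_fin sumr_ge0.
  - apply/measurable_EFinP; apply: measurable_sum => j.
    by apply: measurable_indic; exact: measurable_limit_var_gt.
  rewrite EFinM; congr (_ * _)%E; under eq_integral do rewrite -sumEFin.
  rewrite ge0_integral_sum//; last first.
  - move=> j; apply/measurable_EFinP/measurable_indic; exact: measurable_limit_var_gt.
  rewrite -sumEFin; apply: eq_bigr => j _.
  rewrite integral_indic//; last exact: measurable_limit_var_gt.
  by rewrite setIT; exact: tailE.
have iD : nu.-integrable setT (EFin \o (fun w => Z w - F w)).
  exact: (integrableB measurableT iZ iF).
set lambda := stair_limit n - h.
have intD : (\int[nu]_w (Z w - F w)%:E = (- lambda)%:E)%E.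
  rewrite integralB_EFin// hh [X in (_ - X)%E]intF -EFinB.
  by rewrite /lambda opprB.
have m2 : measurable_fun setT (fun w => (Z w - F w) ^+ 2).
  by apply: measurable_funX; exact: measurable_funB.
have i2 : nu.-integrable setT (EFin \o (fun w => (Z w - F w) ^+ 2)).
  apply/integrableP; split; first exact/measurable_EFinP.
  under eq_integral do rewrite /= ger0_norm ?sqr_ge0//.
  by rewrite (le_lt_trans (approx n n0))// ltry.
have intL : (\int[nu]_w (- (2 * lambda) * (Z w - F w))%:E = (2 * lambda ^+ 2)%:E)%E.
  under eq_integral do rewrite EFinM.
  by rewrite integralZl// intD -EFinM; congr EFin; ring.
(* Integrating (Z - F + lambda)^2 >= 0, where Z - F has mean -lambda, gives 2 lambda^2 <= error +
   lambda^2. *)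
have : (\int[nu]_w (- (2 * lambda) * (Z w - F w))%:E <=
    \int[nu]_w ((Z w - F w) ^+ 2 + cst (lambda ^+ 2) w)%:E)%E.
  apply: le_integral => //.
  - exact: (integrableZl measurableT (- (2 * lambda)) iD).
  - exact: (integrableD measurableT i2 (icst _)).
  by move=> w _; rewrite lee_fin /=; have := sqr_ge0 (Z w - F w + lambda); nra.
rewrite integralD_EFin// intcst.
rewrite intL => h1.
have := le_trans h1 (leeD (approx n n0) (lexx _)).
by rewrite -EFinD lee_fin; lra.
Qed.

(** Three errors: the summands against their staircases; the sample mean of the staircases against
    its limit, a combination of deviations of lonely fractions; and that limit against h. The factor
    3 is that of the square of a sum of three terms. *)
Lemma sample_stair_dist N n w (h : R) : (k < N)%N -> (0 < n)%N ->
  distinct_sample X N w ->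
  (N%:R^-1 * \sum_(i < N) Y N i w - h) ^+ 2 <=
    3 * (N%:R^-1 * \sum_(i < N) (Y N i w - stair n (Y N i w)) ^+ 2) +
    6 * \sum_(j < 2 * n ^ 2)
      (lonely_frac X k N (radius m V N (expR (- n%:R + j%:R / n%:R + psi))) w -
       poisson_prob mu f k (expR (- n%:R + j%:R / n%:R + psi))) ^+ 2 +
    3 * (stair_limit n - h) ^+ 2.
Proof.
move=> kN n0 dw; have N0 : (0 < N)%N by exact: leq_ltn_trans kN.
have Np : 0 < N%:R :> R by rewrite ltr0n.
have np : 0 < n%:R :> R by rewrite ltr0n.
pose t (j : 'I_(2 * n ^ 2)) : R := - n%:R + j%:R / n%:R.
pose u j : R := lonely_frac X k N (radius m V N (expR (t j + psi))) w -
       poisson_prob mu f k (expR (t j + psi)).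
set S1 := N%:R^-1 * \sum_(i < N) (_ - _) ^+ 2; rewrite -/(u _).
pose e1 : R := N%:R^-1 * \sum_(i < N) (Y N i w - stair n (Y N i w)).
pose e2 : R := n%:R^-1 * \sum_j u j.
have E1 : e1 ^+ 2 <= S1.
  rewrite /e1 /S1 exprMn expr2 -mulrA ler_wpM2l ?invr_ge0 ?ler0n//.
  by rewrite mulrC ler_pdivrMr// mulrC; exact: sqr_sum_le.
(* Cauchy-Schwarz over 2 n^2 levels against the factor n^(-2) leaves 2, whence the coefficient 6. *)
have E2 : e2 ^+ 2 <= 2 * \sum_j u j ^+ 2.
  rewrite /e2 exprMn exprVn mulrC ler_pdivrMr ?exprn_gt0//.
  by apply: le_trans (sqr_sum_le u) _; rewrite natrM natrX mulrAC.
have stairE : N%:R^-1 * \sum_(i < N) stair n (Y N i w) = e2 + stair_limit n.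
  have -> : N%:R^-1 * \sum_(i < N) stair n (Y N i w) = - n%:R +
      n%:R^-1 * \sum_j lonely_frac X k N (radius m V N (expR (t j + psi))) w.
    rewrite /stair big_split/= sumr_const card_ord mulrDr -mulr_sumr; congr (_ + _).
      by rewrite -[X in _ * X]mulr_natl mulKf// gt_eqF.
    rewrite mulrCA; congr (_ * _); rewrite exchange_big/= mulr_sumr.
    apply: eq_bigr => j _; rewrite /lonely_frac; congr (_ * _).
    apply: eq_bigr => i _; rewrite indicE -(lt_log_volume (ltn0Sn a) V0 m0)//.
    by rewrite Yd.
  rewrite /e2 /u sumrB /stair_limit mulrBr; ring.
have -> : N%:R^-1 * \sum_(i < N) Y N i w - h = e1 + e2 + (stair_limit n - h).
  rewrite /e1 sumrB mulrBr stairE; ring.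
have h3 (x y z : R) : (x + y + z) ^+ 2 <= 3 * x ^+ 2 + 3 * y ^+ 2 + 3 * z ^+ 2.
  have := sqr_ge0 (x - y); have := sqr_ge0 (x - z); have := sqr_ge0 (y - z); nra.
apply: le_trans (h3 _ _ _) _; rewrite lerD2r lerD ?ler_wpM2l//.
by move: E2; lra.
Qed.

(** The uniform staircase error fixes n from e alone; N is then taken large for the finitely many
    levels of that staircase. *)
Lemma estimator_cvg : exists2 h : R, entropy f = h%:E &
  (fun N : nat => (\int[P]_w ((N%:R^-1 * \sum_(i < N) log_volume X k V psi N i w - h) ^+ 2)%:E)%E)
    @ \oo --> 0%E.
Proof.
have [h hE happ] := entropy_approx; exists h => //.
set u := fun N : nat => _.
have u0 N : (0 <= u N)%E by apply: integral_ge0 => w _; rewrite lee_fin sqr_ge0.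
have small e : 0 < e -> \forall N \near \oo, (u N <= e%:E)%E.
  move=> e0; have e12 : 0 < e / 12 by rewrite divr_gt0.
  (* The staircase error enters twice with coefficient 3, for the sample and for the limit, each
     time costing e / 4. *)
  have [n n0 en] := stair_error_small A0 s0 e12.
  pose J := (2 * n ^ 2)%N; pose c (j : 'I_J) := expR (- n%:R + j%:R / n%:R + psi) : R.
  (* The J levels with coefficient 6 cost at most e / 2; [J.+1] makes the denominator positive at
     sight. *)
  pose eps := e / (12 * J.+1%:R); have eps0 : 0 < eps by rewrite divr_gt0 ?mulr_gt0.
  have [N0 hN0] := choice (fun j => lonely_frac_cvg hlaw hind k V0 lebesgueV mf f0M muE m0
    (expR_gt0 (- n%:R + (j : 'I_J)%:R / n%:R + psi)) eps0).
  exists (maxn k.+1 (\max_j N0 j)) => // N /=; rewrite geq_max => /andP[kN NN0].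
  have N1 : (1 < N)%N by exact: leq_ltn_trans kN.
  have Np : 0 < N%:R :> R by rewrite ltr0n; exact: leq_ltn_trans kN.
  pose q (i : 'I_N) w := (Y N i w - stair n (Y N i w)) ^+ 2.
  pose v j w := (lonely_frac X k N (radius m V N (c j)) w - poisson_prob mu f k (c j)) ^+ 2.
  have mq i : measurable_fun setT (q i).
    have mYi : measurable_fun setT (Y N i) by exact: measurable_Y.
    apply: measurable_funX; apply: measurable_funB => //.
    by apply: measurableT_comp => //; exact: measurable_stair.
  have mv j : measurable_fun setT (v j).
    by apply: measurable_funX; apply: measurable_funB => //; exact: measurable_lonely_frac.
  have q0 i w : 0 <= q i w by exact: sqr_ge0.
  have v0 j w : 0 <= v j w by exact: sqr_ge0.
  have iq : (\int[P]_w (3 * (N%:R^-1 * \sum_i q i w))%:E <= (e / 4)%:E)%E.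
    under eq_integral do rewrite mulrA EFinM.
    rewrite ge0_integralZl_EFin//; last 2 first.
    - by move=> w _; rewrite lee_fin sumr_ge0.
    - by apply/measurable_EFinP; apply: measurable_sum.
    under eq_integral do rewrite -sumEFin.
    rewrite ge0_integral_sum//; last 2 first.
    - by move=> i; apply/measurable_EFinP.
    - by move=> i w _; rewrite lee_fin.
    apply: (@le_trans _ _ ((3 * N%:R^-1)%:E * \sum_(i < N) (e / 12)%:E)%E).
      apply: lee_wpmul2l; first by rewrite lee_fin mulr_ge0 ?invr_ge0// ltW.
      apply: lee_sum => i _; apply: (@le_trans _ _ (stair_error A s n)%:E).
        exact: log_volume_approx.
      by rewrite lee_fin.
    rewrite sumEFin sumr_const card_ord -EFinM lee_fin -[X in _ * X]mulr_natl.
    by rewrite le_eqVlt; apply/orP; left; apply/eqP; field; rewrite gt_eqF.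
  have iv : (\int[P]_w (6 * \sum_j v j w)%:E <= (e / 2)%:E)%E.
    under eq_integral do rewrite EFinM.
    rewrite ge0_integralZl_EFin//; last 2 first.
    - by move=> w _; rewrite lee_fin sumr_ge0.
    - by apply/measurable_EFinP; apply: measurable_sum.
    under eq_integral do rewrite -sumEFin.
    rewrite ge0_integral_sum//; last 2 first.
    - by move=> j; apply/measurable_EFinP.
    - by move=> j w _; rewrite lee_fin.
    apply: (@le_trans _ _ (6%:E * \sum_(j < J) eps%:E)%E).
      apply: lee_wpmul2l; first by rewrite lee_fin.
      apply: lee_sum => j _; apply: hN0.
      - by apply: leq_trans NN0; exact: leq_bigmax.
      - by apply: radius_gt0 => //; exact: expR_gt0.
      - by apply: radiusE => //; exact: expR_gt0.
    rewrite sumEFin sumr_const card_ord -EFinM lee_fin -[X in _ * X]mulr_natl /eps.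
    have -> : 6 * (J%:R * (e / (12 * J.+1%:R))) = e / 2 * (J%:R / J.+1%:R).
      by field; rewrite gt_eqF.
    by rewrite ler_piMr ?divr_ge0 ?(ltW e0)// ler_pdivrMr// mul1r ler_nat.
  have ih : 3 * (stair_limit n - h) ^+ 2 <= e / 4.
    by have := le_trans (happ n n0) en; lra.
  pose D := distinct_sample X N.
  have mD : measurable (~` D) by apply: measurableC; exact: measurable_distinct_sample.
  have mI : measurable_fun setT (fun w => (\1_(~` D) w)%:E : \bar R).
    by apply/measurable_EFinP; exact: measurable_indic.
  (* The estimator need not be measurable on the null set of samples with ties;
     there the integrand is dominated by +oo. *)
  apply: (@le_trans _ _ (\int[P]_w (((3 * (N%:R^-1 * \sum_i q i w))%:E +
      (6 * \sum_j v j w)%:E) + ((cst (e / 4)%:E w) + +oo * (\1_(~` D) w)%:E)))%E).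
    apply: integralT_le => w; first by rewrite lee_fin sqr_ge0.
    have [dw|dw] := pselect (D w); last first.
      rewrite [X in (_ * X)%E](_ : _ = 1%E) ?mule1 ?addey ?leey//.
      by rewrite indicE mem_set.
    rewrite [X in (_ * X)%E](_ : _ = 0%E) ?mule0 ?adde0; last by rewrite indicE memNset.
    rewrite -!EFinD lee_fin; apply: le_trans (lerD (lexx _) ih).
    rewrite (eq_bigr (fun i : 'I_N => Y N i w)); last by move=> i _; rewrite Yd.
    exact: sample_stair_dist.
  have mqs : measurable_fun setT (fun w => (3 * (N%:R^-1 * \sum_i q i w))%:E).
    apply/measurable_EFinP; apply: measurable_funM => //; apply: measurable_funM => //.
    exact: measurable_sum.
  have mvs : measurable_fun setT (fun w => (6 * \sum_j v j w)%:E).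
    by apply/measurable_EFinP; apply: measurable_funM => //; exact: measurable_sum.
  have mIo : measurable_fun setT (fun w => +oo * (\1_(~` D) w : R)%:E)%E.
    exact: measurable_funeM.
  have qs0 w : (0 <= (3 * (N%:R^-1 * \sum_i q i w))%:E)%E.
    by rewrite lee_fin mulr_ge0// mulr_ge0 ?invr_ge0 ?sumr_ge0// ltW.
  have vs0 w : (0 <= (6 * \sum_j v j w)%:E)%E by rewrite lee_fin mulr_ge0// sumr_ge0.
  have e40 : 0 <= e / 4 by rewrite divr_ge0// ltW.
  have I0 w : (0 <= +oo * (\1_(~` D) w)%:E :> \bar R)%E by rewrite mule_ge0// lee_fin.
  rewrite ge0_integralD//; last 4 first.
  - by move=> w _; rewrite adde_ge0.
  - exact: emeasurable_funD.
  - by move=> w _; rewrite adde_ge0// lee_fin.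
  - exact: emeasurable_funD.
  rewrite ge0_integralD// ge0_integralD//.
  rewrite ge0_integralZl//.
  rewrite integral_indic// setIT [X in (+oo * X)%E](_ : _ = 0%E); last exact: prob_notD.
  rewrite mule0 adde0 integral_probability_cst.
  apply: le_trans (leeD (leeD iq iv) (lexx _)) _.
  by rewrite -!EFinD lee_fin; lra.
apply/fine_cvgP; split.
  have := small 1 ltr01; apply: filterS => N uN.
  by rewrite ge0_fin_numE// (le_lt_trans uN)// ltry.
apply/cvgrPdist_le => e e0; have := small e e0; apply: filterS => N uN.
rewrite sub0r normrN ger0_norm; last by rewrite fine_ge0.
by rewrite -lee_fin fineK// ge0_fin_numE// (le_lt_trans uN)// ltry.
Qed.

End convergence.

Theorem theorem3 (R : realType) (d : measure_display) (Omega : measurableType d)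
    (P : probability Omega R) (m : nat) (hm : (1 <= m)%N)
    (f : m.-tuple R -> R) (hf : is_pdf f)
    (X : {RV P >-> m.-tuple R}) (hX : has_density X f)
    (Xs : nat -> {RV P >-> m.-tuple R})
    (hXs : forall i, has_density (Xs i) f)
    (hind : mutually_independent Xs)
    (hmom : exists2 alpha : R, 0 < alpha &
       ('E_P[(fun w => enorm (X w) `^ alpha)%R] < +oo)%E)
    (hbdd : exists2 M : R, 0 < M & forall x, f x <= M)
    (k : nat) (hk : (1 <= k)%N) :
  (fun N : nat =>
     \int[P]_w ((entropy_estimator k Xs N w)%:E - entropy f) ^+ 2)%E
    @ \oo --> 0%E.
Proof.
have [mf f0 _] := hf; have [alpha alpha0 mom] := hmom; have [M _ fM] := hbdd.
have f0M x : 0 <= f x <= M by rewrite f0 fM.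
pose mu : probability (m.-tuple R) R := distribution P (Xs 0%N).
have muE A : measurable A -> mu A = (\int[lebesgue_tuple m]_(x in A) (f x)%:E)%E.
  by move=> mA; exact: hXs.
have hlaw i A : measurable A -> P (Xs i @^-1` A) = mu A.
  by move=> mA; rewrite muE// -(hXs i A mA).
have [_ V0] := lebesgue_unit_ball R m.
have lebV x r := @lebesgue_cball R m x r.
pose g w := enorm (X w) `^ alpha.
have mg : measurable_fun setT g.
  apply: (@measurableT_comp _ _ _ _ _ _ (fun x => x `^ alpha)).
    exact: measurable_powR.
  apply: (@measurableT_comp _ _ _ _ _ _ (@enorm R m)) => //.
  exact: measurable_enorm.
have g0 w : 0 <= g w by exact: powR_ge0.
have E0 : (0 <= 'E_P[g])%E by rewrite unlock integral_ge0// => w _; rewrite lee_fin.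
pose C := fine 'E_P[g]; have C0 : 0 <= C by exact: fine_ge0.
have EC : (\int[P]_w (g w)%:E = C%:E)%E.
  have EgC : ('E_P[g] = C%:E)%E by rewrite /C fineK// ge0_fin_numE.
  by rewrite -EgC unlock.
have tailC z : (norm_tail mu (expR z) <= (C * expR (- alpha * z))%:E)%E.
  have mB : measurable [set x : m.-tuple R | (expR z < enorm x)%R].
    rewrite (_ : mkset _ = ~` [set x | enorm x <= expR z]).
      by apply: measurableC; apply: measurable_fun_set_le; exact: measurable_enorm.
    by apply/seteqP; split => x /=; rewrite ltNge => /negP.
  have -> : norm_tail mu (expR z) = P [set w | (expR z < enorm (X w))%R].
    by rewrite /norm_tail muE// -(hX _ mB).
  have mXB : measurable [set w | expR z < enorm (X w)].
    rewrite -[X in measurable X]setTI.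
    exact: (@measurable_funPT _ _ _ _ X measurableT _ mB).
  pose c := expR (- alpha * z).
  (* Markov's inequality: on the event |X| > e^z one has 1 <= e^(-alpha z) |X|^alpha. The moment is
     that of X, which shares its density, hence its law, with the sample. *)
  apply: (@le_trans _ _ (\int[P]_w (c%:E * (g w)%:E))%E); last first.
    rewrite ge0_integralZl_EFin//; last 3 first.
    - by move=> w _; rewrite lee_fin.
    - exact/measurable_EFinP.
    - exact: expR_ge0.
    by rewrite EC -EFinM mulrC.
  rewrite -[X in P X]setIT -integral_indic//; apply: integralT_le => w; first by rewrite lee_fin.
  rewrite -EFinM lee_fin indicE; have [|_] := boolP (w \in _); last first.
    by rewrite mulr_ge0// expR_ge0.
  rewrite inE /= => zX; rewrite /c /g /powR gt_eqF ?(lt_trans (expR_gt0 _) zX)//.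
  rewrite -expRD -[leLHS]expR0 ler_expR mulNr addrC subr_ge0 ler_wpM2l ?(ltW alpha0)//.
  by rewrite -[leLHS]expRK ler_ln ?posrE ?expR_gt0 ?(lt_trans (expR_gt0 _) zX)// ltW.
case: k hk => // a _.
have [h hE cvg0] := @estimator_cvg R d Omega P m Xs mu f M (unit_ball_vol R m)
  hlaw hind a V0 lebV mf f0M muE hm C alpha C0 alpha0 tailC.
apply: cvg_trans cvg0; apply: near_eq_cvg; apply: nearW => N.
by apply: eq_integral => w _; rewrite hE -EFinB.
Qed.
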